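(* Assume that $\kappa:\mathbb{R}\to\mathbb{R}$ and $\nu:\mathbb{R}\to\mathbb{R}$ satisfy, for constants $\kappa_*,\kappa^*,\kappa_{lip},\nu_*,\nu^*,\nu_{lip}>0$, $0<\kappa_*\le\kappa(t)\le\kappa^*$, $|\kappa(t_1)-\kappa(t_2)|\le\kappa_{lip}|t_1-t_2|$, $0<\nu_*\le\nu(t)\le\nu^*$, $|\nu(t_1)-\nu(t_2)|\le\nu_{lip}|t_1-t_2|$ for all $t,t_1,t_2\in\mathbb{R}$. Consider the discrete nonlinear problem: find $(\boldsymbol{u}_h,\mathsf{p}_h,T_h)\in\mathbf{V}_h\times\mathrm{Q}_h\times\mathrm{V}_h$ such that $$a_h(T_h;\boldsymbol{u}_h,\boldsymbol{v}_h)+c_{N,h}^{skew}(\boldsymbol{u}_h;\boldsymbol{u}_h,\boldsymbol{v}_h)+c_{F,h}(\boldsymbol{u}_h;\boldsymbol{u}_h,\boldsymbol{v}_h)+d_h(\boldsymbol{u}_h,\boldsymbol{v}_h)+b(\boldsymbol{v}_h,\mathsf{p}_h)=(\boldsymbol{f}_h,\boldsymbol{v}_h)_{0,\Omega},$$ $$b(\boldsymbol{u}_h,\mathsf{q}_h)=0,\qquad \mathfrak{a}_h(T_h;T_h,S_h)+\mathfrak{c}_h^{skew}(\boldsymbol{u}_h;T_h,S_h)=(g_h,S_h)_{0,\Omega}$$ for all $(\boldsymbol{v}_h,\mathsf{q}_h,S_h)\in\mathbf{V}_h\times\mathrm{Q}_h\times\mathrm{V}_h$. If this problem admits a solution $(\boldsymbol{u}_h,\mathsf{p}_h,T_h)\in\mathbf{Z}_h\times\mathrm{Q}_h\times\mathrm{V}_h$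 such that $\boldsymbol{u}_h\in\mathbf{W}^1_q(\mathcal{T}_h)$ and $T_h\in\mathrm{W}^1_q(\mathcal{T}_h)$ for some $q>2$, and if $$\frac{C_V\nu_{lip}\,\widehat{\mathfrak{C}}\,\mathsf{C}\,\|g_h\|_{0,\Omega}\,|\boldsymbol{u}_h|_{\mathbf{W}^1_q(\mathcal{T}_h)}}{\alpha_*\nu_*\beta_*\kappa_*\big(\beta_*\kappa_*-C_T\kappa_{lip}|T_h|_{\mathrm{W}^1_q(\mathcal{T}_h)}\big)}+\frac{\widehat{C}_N\mathsf{C}}{\alpha_*^2\nu_*^2}\|\boldsymbol{f}_h\|_{0,\Omega}<1,\qquad C_T\kappa_{lip}|T_h|_{\mathrm{W}^1_q(\mathcal{T}_h)}<\beta_*\kappa_*,$$ then this solution is unique, i.e. the discrete problem has no other solution in $\mathbf{V}_h\times\mathrm{Q}_h\times\mathrm{V}_h$.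
   Context: **Domain, data.** $\Omega\subset\mathbb{R}^2$ is an open bounded polygonal domain with Lipschitz boundary; $r\in[3,4]$; $\boldsymbol{f}\in[\mathrm{L}^2(\Omega)]^2$, $g\in\mathrm{L}^2(\Omega)$. $\mathrm{V}=\mathrm{H}^1_0(\Omega)$, $\mathbf{V}=[\mathrm{H}^1_0(\Omega)]^2$, $\mathrm{Q}=\mathrm{L}^2_0(\Omega)$ (zero mean). $\|\cdot\|_{0,A}$ is the $\mathrm{L}^2(A)$-norm, $(\cdot,\cdot)_{0,A}$ its inner product, $|\cdot|_{1,A}$ the $\mathrm{H}^1(A)$-seminorm. $\mathsf{C}=\mathsf{C}(\Omega)$ is the Poincaré constant: $\|v\|_{1,\Omega}\le\mathsf{C}|v|_{1,\Omega}$ for $v\in\mathrm{V}$, and likewise (with the same constant) on $\mathbf{V}$. **Meshes.** $\{\mathcal{T}_h\}_{h>0}$ is a sequence of decompositions of $\Omega$ into polygons $E$ with diameter $h_E$, $h=\max_E h_E$, and there is $\varrho>0$ such that for all $h$ and all $E\in\mathcal{T}_h$: $E$ is star-shaped with respect to a ball of radius $\ge\varrho h_E$, and the distance between any two vertices of $E$ is $\ge\varrho h_E$. The broken space $\mathrm{W}^1_q(\mathcal{T}_h)$ consists of $v\in\mathrm{L}^2(\Omega)$ with $v|_E\in\mathrm{W}^1_q(E)$ for all $E$, with seminorm $|v|_{\mathrm{W}^1_q(\mathcal{T}_h)}=(\sum_E|v|^q_{\mathrm{W}^1_q(E)})^{1/q}$; $\mathbf{W}^1_q(\mathcal{T}_h)$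 is its vector-valued version. **Polynomials and projections.** $k\in\mathbb{N}$ is a fixed polynomial degree. $\mathbb{P}_n(A)$ denotes polynomials of degree $\le n$ on $A$ (with $\mathbb{P}_n=\{0\}$ for $n<0$). With $\mathbf{x}_E$ the centroid of $E$, $\mathbb{P}_{n\backslash m}(E)=\mathrm{span}\{((\mathbf{x}-\mathbf{x}_E)/h_E)^{\boldsymbol{\alpha}}: m+1\le|\boldsymbol{\alpha}|\le n\}$. $\Pi^{0,E}_n$ is the $\mathrm{L}^2(E)$-orthogonal projection onto $\mathbb{P}_n(E)$, $\boldsymbol{\Pi}^{0,E}_n$ its vector version, $\boldsymbol{\Xi}^{0,E}_{k-1}$ the $\mathrm{L}^2(E)$-orthogonal projection of $2\times2$ tensors onto $[\mathbb{P}_{k-1}(E)]^{2\times2}$. $\Pi^{\nabla,E}_n:\mathrm{H}^1(E)\to\mathbb{P}_n(E)$ is defined by $(\nabla q_n,\nabla(v-\Pi^{\nabla,E}_nv))_{0,E}=0$ for all $q_n\in\mathbb{P}_n(E)$ and $\int_{\partial E}(v-\Pi^{\nabla,E}_nv)=0$; $\boldsymbol{\Pi}^{\nabla,E}_n$ is its vector version. **Discrete spaces.** With $\mathbf{x}^\perp=(x_2,-x_1)$, $\mathbf{W}_h(E)=\{\boldsymbol{v}_h\in[\mathrm{H}^1(E)]^2\cap[\mathcal{C}^0(\partial E)]^2: -\Delta\boldsymbol{v}_h-\nabla\mathsf{q}\in\mathbf{x}^\perp\mathbb{P}_{k-1}(E)\text{ for some }\mathsf{q}\in\mathrm{L}^2_0(E),\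 \mathrm{div}\,\boldsymbol{v}_h\in\mathbb{P}_{k-1}(E),\ \boldsymbol{v}_h|_e\in[\mathbb{P}_k(e)]^2\ \forall\text{ edges }e\subset\partial E\}$, $\mathbf{V}_h(E)=\{\boldsymbol{v}_h\in\mathbf{W}_h(E):(\boldsymbol{v}_h-\boldsymbol{\Pi}^{\nabla,E}_k\boldsymbol{v}_h,\mathbf{x}^\perp q)_{0,E}=0\ \forall q\in\mathbb{P}_{k-1\backslash k-3}(E)\}$, $\mathbf{V}_h=\{\boldsymbol{v}_h\in\mathbf{V}:\boldsymbol{v}_h|_E\in\mathbf{V}_h(E)\ \forall E\in\mathcal{T}_h\}$; $\mathrm{Q}_h=\{\mathsf{q}_h\in\mathrm{Q}:\mathsf{q}_h|_E\in\mathbb{P}_{k-1}(E)\ \forall E\in\mathcal{T}_h\}$; $\mathbf{Z}_h=\{\boldsymbol{v}_h\in\mathbf{V}_h:b(\boldsymbol{v}_h,\mathsf{q}_h)=0\ \forall\mathsf{q}_h\in\mathrm{Q}_h\}$; $\mathrm{U}_h(E)=\{S_h\in\mathrm{H}^1(E)\cap\mathcal{C}^0(\partial E):\Delta S_h\in\mathbb{P}_k(E),\ S_h|_e\in\mathbb{P}_k(e)\ \forall e\subset\partial E\}$, $\mathrm{V}_h(E)=\{S_h\in\mathrm{U}_h(E):(S_h-\Pi^{\nabla,E}_kS_h,q)_{0,E}=0\ \forall q\in\mathbb{P}_{k\backslash k-2}(E)\}$, $\mathrm{V}_h=\{S_h\in\mathrm{V}:S_h|_E\in\mathrm{V}_h(E)\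 \forall E\in\mathcal{T}_h\}$. **Discrete forms** (each is the sum over $E\in\mathcal{T}_h$ of its local version). $b(\boldsymbol{v},\mathsf{q})=-\int_\Omega\mathsf{q}\,\mathrm{div}\,\boldsymbol{v}$, and $a_h^E(X_h;\boldsymbol{v}_h,\boldsymbol{w}_h)=\int_E\nu(\Pi^{0,E}_kX_h)\,\boldsymbol{\Xi}^{0,E}_{k-1}\nabla\boldsymbol{v}_h:\boldsymbol{\Xi}^{0,E}_{k-1}\nabla\boldsymbol{w}_h+\nu(\Pi^{0,E}_0X_h)S^E_V((\mathbf{I}-\boldsymbol{\Pi}^{0,E}_k)\boldsymbol{v}_h,(\mathbf{I}-\boldsymbol{\Pi}^{0,E}_k)\boldsymbol{w}_h)$, $\mathfrak{a}_h^E(X_h;R_h,S_h)=\int_E\kappa(\Pi^{0,E}_kX_h)\,\boldsymbol{\Pi}^{0,E}_{k-1}\nabla R_h\cdot\boldsymbol{\Pi}^{0,E}_{k-1}\nabla S_h+\kappa(\Pi^{0,E}_0X_h)S^E_T((\mathrm{I}-\Pi^{0,E}_k)R_h,(\mathrm{I}-\Pi^{0,E}_k)S_h)$, $c_{N,h}^E(\boldsymbol{z}_h;\boldsymbol{v}_h,\boldsymbol{w}_h)=\int_E[\boldsymbol{\Xi}^{0,E}_{k-1}(\nabla\boldsymbol{v}_h)\,\boldsymbol{\Pi}^{0,E}_k\boldsymbol{z}_h]\cdot\boldsymbol{\Pi}^{0,E}_k\boldsymbol{w}_h$, $\ c_{N,h}^{skew}(\boldsymbol{z}_h;\boldsymbol{v}_h,\boldsymbol{w}_h)=\tfrac12(c_{N,h}(\boldsymbol{z}_h;\boldsymbol{v}_h,\boldsymbol{w}_h)-c_{N,h}(\boldsymbol{z}_h;\boldsymbol{w}_h,\boldsymbol{v}_h))$,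 $c_{F,h}^E(\boldsymbol{z}_h;\boldsymbol{v}_h,\boldsymbol{w}_h)=\int_E|\boldsymbol{\Pi}^{0,E}_k\boldsymbol{z}_h|^{r-2}\,\boldsymbol{\Pi}^{0,E}_k\boldsymbol{v}_h\cdot\boldsymbol{\Pi}^{0,E}_k\boldsymbol{w}_h$, $\mathfrak{c}_h^E(\boldsymbol{v}_h;R_h,S_h)=\int_E(\boldsymbol{\Pi}^{0,E}_k\boldsymbol{v}_h\cdot\boldsymbol{\Pi}^{0,E}_{k-1}\nabla R_h)\,\Pi^{0,E}_kS_h$, $\ \mathfrak{c}_h^{skew}(\boldsymbol{v}_h;R_h,S_h)=\tfrac12(\mathfrak{c}_h(\boldsymbol{v}_h;R_h,S_h)-\mathfrak{c}_h(\boldsymbol{v}_h;S_h,R_h))$, $d_h^E(\boldsymbol{v}_h,\boldsymbol{w}_h)=\int_E\boldsymbol{\Pi}^{0,E}_k\boldsymbol{v}_h\cdot\boldsymbol{\Pi}^{0,E}_k\boldsymbol{w}_h$. Here $S^E_V$ on $\mathbf{V}_h(E)\times\mathbf{V}_h(E)$ and $S^E_T$ on $\mathrm{V}_h(E)\times\mathrm{V}_h(E)$ are symmetric bilinear forms with $|\boldsymbol{v}_h|_{1,E}^2\lesssim S^E_V(\boldsymbol{v}_h,\boldsymbol{v}_h)\lesssim|\boldsymbol{v}_h|^2_{1,E}$ for $\boldsymbol{v}_h\in\mathbf{V}_h(E)\cap\ker\boldsymbol{\Pi}^{0,E}_k$ and $|X_h|_{1,E}^2\lesssim S^E_T(X_h,X_h)\lesssim|X_h|^2_{1,E}$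 for $X_h\in\mathrm{V}_h(E)\cap\ker\Pi^{0,E}_k$, with constants independent of $h$ and $E$. The discrete data are $\boldsymbol{f}_h|_E=\boldsymbol{\Pi}^{0,E}_k\boldsymbol{f}$, $g_h|_E=\Pi^{0,E}_kg$. **Constants.** The following positive constants, independent of $h$, are those in these (known) properties of the discrete forms, valid for all discrete arguments: $a_h(X_h;\boldsymbol{v}_h,\boldsymbol{v}_h)\ge\alpha_*\nu_*|\boldsymbol{v}_h|_{1,\Omega}^2$; $\mathfrak{a}_h(X_h;S_h,S_h)\ge\beta_*\kappa_*|S_h|^2_{1,\Omega}$; $c_{N,h}^{skew}(\boldsymbol{z}_h;\boldsymbol{v}_h,\boldsymbol{w}_h)\le\widehat{C}_N|\boldsymbol{z}_h|_{1,\Omega}|\boldsymbol{v}_h|_{1,\Omega}|\boldsymbol{w}_h|_{1,\Omega}$; $\mathfrak{c}_h^{skew}(\boldsymbol{v}_h;R_h,S_h)\le\widehat{\mathfrak{C}}|\boldsymbol{v}_h|_{1,\Omega}|R_h|_{1,\Omega}|S_h|_{1,\Omega}$; the discrete inf-sup condition $\sup_{\boldsymbol{v}_h\in\mathbf{V}_h}b(\boldsymbol{v}_h,\mathsf{q}_h)/|\boldsymbol{v}_h|_{1,\Omega}\ge\tilde\beta\|\mathsf{q}_h\|_{0,\Omega}$ for all $\mathsf{q}_h\in\mathrm{Q}_h$ (standing property of $(\mathbf{V}_h,\mathrm{Q}_h)$, $\tilde\beta>0$). For $q>2$, $C_V$ and $C_T$ are the positive constants (depending on $\Omega$, $k$,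 $\varrho$) in the Lipschitz properties $|a_h(X_h;\boldsymbol{v}_h,\boldsymbol{w}_h)-a_h(S_h;\boldsymbol{v}_h,\boldsymbol{w}_h)|\le C_V\nu_{lip}|X_h-S_h|_{1,\Omega}|\boldsymbol{v}_h|_{\mathbf{W}^1_q(\mathcal{T}_h)}|\boldsymbol{w}_h|_{1,\Omega}$ for $X_h,S_h\in\mathrm{V}_h$, $\boldsymbol{v}_h\in\mathbf{V}_h\cap\mathbf{W}^1_q(\mathcal{T}_h)$, $\boldsymbol{w}_h\in\mathbf{V}_h$, and $|\mathfrak{a}_h(X_h;R_h,P_h)-\mathfrak{a}_h(S_h;R_h,P_h)|\le C_T\kappa_{lip}|X_h-S_h|_{1,\Omega}|R_h|_{\mathrm{W}^1_q(\mathcal{T}_h)}|P_h|_{1,\Omega}$ for $X_h,S_h,P_h\in\mathrm{V}_h$, $R_h\in\mathrm{V}_h\cap\mathrm{W}^1_q(\mathcal{T}_h)$. *)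

(* Defs.v *)
From HB Require Import structures.
From mathcomp Require Import all_boot all_order all_algebra.
From mathcomp Require Import all_classical all_reals all_analysis.
Set Implicit Arguments.
Unset Strict Implicit.
Unset Printing Implicit Defensive.
Import Order.TTheory GRing.Theory Num.Theory.
Import numFieldNormedType.Exports.
Local Open Scope classical_set_scope.
Local Open Scope ring_scope.

(* Functions on a subset A of the plane (in L^p(A), W^1_p(A), ...) are
   represented by total functions on R * R whose values outside A are
   irrelevant; equality of such functions is almost everywhere equality on A.
   Vector fields are families of two scalar components. *)

Section Plane.
Variable R : realType.
Implicit Types (A : set (R * R)) (f g v phi : R * R -> R) (x a b : R * R).

Definition mu2 := (@lebesgue_measure R \x @lebesgue_measure R)%E.

Definition dir (j : 'I_2) : R * R := if j == ord0 then (1, 0) else (0, 1).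

Definition coord x (j : 'I_2) : R := if j == ord0 then x.1 else x.2.

Definition perp x (i : 'I_2) : R := if i == ord0 then x.2 else - x.1.

(* The norm of the normed module R * R is the max norm, hence this. *)
Definition edist x y : R := Num.sqrt ((x.1 - y.1) ^+ 2 + (x.2 - y.2) ^+ 2).

Definition diameter A : R := sup [set d | exists x y, [/\ A x, A y & d = edist x y]].

Definition centroid A : R * R :=
  let area := \int[mu2]_(x in A) 1 in
  ((\int[mu2]_(x in A) x.1) / area, (\int[mu2]_(x in A) x.2) / area).

Definition Lp A (p : R) f : Prop := f \_ A \in Lfun mu2 p%:E.

Definition normL A (p : R) f : R := fine 'N[mu2]_(p%:E) [EFin \o (f \_ A)].

Definition L20 A f : Prop := Lp A 2 f /\ (\int[mu2]_(x in A) f x) = 0.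

Definition pder (j : 'I_2) phi : R * R -> R := fun x => 'D_(dir j) phi x.

Definition C1 phi : Prop :=
  forall j, (forall x, derivable phi x (dir j)) /\ continuous (pder j phi).

Definition Cc1 A phi : Prop :=
  [/\ C1 phi, compact (closure [set x | phi x != 0]) &
      closure [set x | phi x != 0] `<=` A].

Definition L1loc A f : Prop := forall K, compact K -> K `<=` A -> Lp K 1 f.

(* Weak derivatives are tested with C^1_c(A), and H^1_0(A) is the closure of
   C^1_c(A), as in Gilbarg and Trudinger, Chapter 7. *)
Definition is_wpartial A (j : 'I_2) f g : Prop :=
  L1loc A g /\ forall phi, Cc1 A phi ->
    (\int[mu2]_(x in A) (f x * pder j phi x)) =
    - (\int[mu2]_(x in A) (g x * phi x)).

(* Weak derivatives are unique up to almost everywhere equality, so that the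
   choice made here is harmless. *)
Definition wpartial A (j : 'I_2) f : R * R -> R :=
  xget (cst 0) [set g | is_wpartial A j f g].

Definition W1 A (p : R) f : Prop :=
  Lp A p f /\ forall j, exists2 g, is_wpartial A j f g & Lp A p g.

Definition H1 A f : Prop := W1 A 2 f.

Definition H10 A f : Prop :=
  H1 A f /\ forall e : R, 0 < e -> exists2 phi, Cc1 A phi &
    normL A 2 (f \- phi) < e /\
    forall j, normL A 2 (wpartial A j f \- pder j phi) < e.

Definition semiH1 A f : R :=
  Num.sqrt (\sum_(j < 2) normL A 2 (wpartial A j f) ^+ 2).

Definition normH1 A f : R := Num.sqrt (normL A 2 f ^+ 2 + semiH1 A f ^+ 2).

Definition vfield := 'I_2 -> R * R -> R.
Implicit Types (u w : vfield).

Definition normLv A u : R := Num.sqrt (\sum_(i < 2) normL A 2 (u i) ^+ 2).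

Definition semiH1v A u : R := Num.sqrt (\sum_(i < 2) semiH1 A (u i) ^+ 2).

Definition normH1v A u : R := Num.sqrt (normLv A u ^+ 2 + semiH1v A u ^+ 2).

Definition divg A u : R * R -> R := fun x => \sum_(i < 2) wpartial A i (u i) x.

(* span of the monomials x^al with lo < |al| <= hi *)
Definition polyspan (lo hi : int) (p : R * R -> R) : Prop :=
  exists c : nat -> nat -> R, p = fun x =>
    \sum_(i < `|hi|.+1) \sum_(j < `|hi|.+1 | (lo < (i + j)%:Z <= hi)%R)
      c i j * (x.1 ^+ i * x.2 ^+ j).

(* P_n, which is {0} for n < 0 *)
Definition Pn (n : int) (p : R * R -> R) : Prop := polyspan (-1) n p.

Definition Pdiff A (n m : int) (q : R * R -> R) : Prop :=
  exists2 p, polyspan m n p &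
    q = fun x => p ((diameter A)^-1 *: (x - centroid A)).

Definition inPn A (n : int) f : Prop := exists2 p, Pn n p & ae_eq mu2 A f p.

(* L^2(A)-orthogonal projection onto P_n(A); the projections of vector and
   tensor fields act componentwise. *)
Definition Pi0 A (n : int) f : R * R -> R :=
  xget (cst 0) [set p | Pn n p /\ forall q, Pn n q ->
                        \int[mu2]_(x in A) ((f x - p x) * q x) = 0].

Definition segpt (e : (R * R) * (R * R)) (t : R) : R * R :=
  e.1 + t *: (e.2 - e.1).

Definition seg (e : (R * R) * (R * R)) : set (R * R) := segpt e @` `[0, 1].

Definition bdry A : set (R * R) := closure A `\` A°.

Definition lipschitz_boundary A : Prop :=
  forall x0, bdry A x0 -> exists (d : R * R) (del eta L : R) (gam : R -> R),
    [/\ d.1 ^+ 2 + d.2 ^+ 2 = 1, 0 < del, 0 < eta,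
        forall s t, `|gam s - gam t| <= L * `|s - t| &
        forall s t, `|s| < del -> `|t| < eta ->
          (A (x0 + s *: d + t *: (- d.2, d.1)) <-> gam s < t)].

Definition polygonal_boundary A : Prop :=
  exists es : seq ((R * R) * (R * R)),
    bdry A = [set x | exists2 e, e \in es & seg e x].

Definition polygonal_domain A : Prop :=
  [/\ open A, connected A, A !=set0, bounded_set A & polygonal_boundary A].

(* A polygon is given by the cyclic list of its vertices together with its
   interior; vertices with a straight angle (hanging nodes) are allowed. *)
Notation polygon := (seq (R * R) * set (R * R))%type.
Implicit Types (E : polygon).

Definition edges E : seq ((R * R) * (R * R)) := zip E.1 (rot 1 E.1).

Definition polyline E : set (R * R) :=
  [set x | exists2 e, e \in edges E & seg e x].

Definition is_polygon E : Prop :=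
  [/\ (3 <= size E.1)%N /\ uniq E.1,
      (forall e e', e \in edges E -> e' \in edges E -> e != e' ->
         seg e `&` seg e' `<=` [set e.1; e.2] `&` [set e'.1; e'.2]),
      [/\ open E.2, connected E.2, E.2 !=set0 & bounded_set E.2] &
      bdry E.2 = polyline E].

Definition star_shaped_ball A (c : R * R) (rad : R) : Prop :=
  forall y x (t : R), edist c y < rad -> A x -> 0 <= t <= 1 ->
    A (y + t *: (x - y)).

Definition shape_regular (rho : R) E : Prop :=
  (exists c rad, rho * diameter E.2 <= rad /\ star_shaped_ball E.2 c rad) /\
  (forall a b, a \in E.1 -> b \in E.1 -> a != b ->
     rho * diameter E.2 <= edist a b).

Definition is_decomposition A (T : seq polygon) : Prop :=
  [/\ uniq T,
      forall E, E \in T -> is_polygon E /\ E.2 `<=` A,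
      forall E F, E \in T -> F \in T -> E != F -> E.2 `&` F.2 = set0 &
      closure A = [set x | exists2 E, E \in T & closure E.2 x]].

Definition meshsize (T : seq polygon) : R :=
  \big[Order.max/0]_(E <- T) diameter E.2.

Definition eint (e : (R * R) * (R * R)) g : R :=
  edist e.1 e.2 * \int[@lebesgue_measure R]_(t in `[0, 1]) g (segpt e t).

Definition bint E g : R := \sum_(e <- edges E) eint e g.

(* The graph of the trace operator H^1(E) -> L^2(bd E), the continuous
   extension of the restriction of C^1 functions to the boundary. *)
Definition has_trace E v g : Prop :=
  [/\ H1 E.2 v,
      forall e, e \in edges E ->
        ((g \o segpt e) \_ `[0, 1]) \in Lfun (@lebesgue_measure R) 2%:E &
      forall eps : R, 0 < eps -> exists2 phi, C1 phi &
        [/\ normL E.2 2 (v \- phi) < eps,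
            forall j, normL E.2 2 (wpartial E.2 j v \- pder j phi) < eps &
            bint E (fun x => (phi x - g x) ^+ 2) < eps]].

(* v in C^0(bd E) with v|_e in P_k(e) for all edges e *)
Definition C0_poly_trace E (k : nat) v : Prop :=
  exists g, [/\ has_trace E v g, {within polyline E, continuous g} &
    forall e, e \in edges E -> exists2 p : {poly R}, (size p <= k.+1)%N &
      forall t, 0 <= t <= 1 -> g (segpt e t) = p.[t]].

(* p = Pi^nabla_n v.  The two conditions determine p uniquely. *)
Definition is_Pinabla E (n : int) v (p : R * R -> R) : Prop :=
  [/\ Pn n p,
      forall q, Pn n q -> \int[mu2]_(x in E.2)
        (\sum_(j < 2) pder j q x * (wpartial E.2 j v x - pder j p x)) = 0 &
      exists2 g, has_trace E v g & bint E (g \- p) = 0].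

Definition Wh_loc (k : nat) E u : Prop :=
  [/\ forall i, H1 E.2 (u i),
      exists q s, [/\ L20 E.2 q, Pn (k%:Z - 1) s &
        forall w, (forall i, Cc1 E.2 (w i)) ->
          (\int[mu2]_(x in E.2)
             (\sum_(i < 2) \sum_(j < 2) wpartial E.2 j (u i) x * pder j (w i) x))
          + (\int[mu2]_(x in E.2) (q x * \sum_(i < 2) pder i (w i) x))
          = \int[mu2]_(x in E.2) (\sum_(i < 2) s x * perp x i * w i x)],
      inPn E.2 (k%:Z - 1) (divg E.2 u) &
      forall i, C0_poly_trace E k (u i)].

Definition Vvec_loc (k : nat) E u : Prop :=
  Wh_loc k E u /\
  exists p : vfield, (forall i, is_Pinabla E k%:Z (u i) (p i)) /\
    forall q, Pdiff E.2 (k%:Z - 1) (k%:Z - 3) q ->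
      \int[mu2]_(x in E.2) (\sum_(i < 2) (u i x - p i x) * (perp x i * q x)) = 0.

Definition Uh_loc (k : nat) E v : Prop :=
  [/\ H1 E.2 v,
      exists2 p, Pn k%:Z p &
        forall phi, Cc1 E.2 phi ->
          - (\int[mu2]_(x in E.2)
               (\sum_(j < 2) wpartial E.2 j v x * pder j phi x))
          = \int[mu2]_(x in E.2) (p x * phi x) &
      C0_poly_trace E k v].

Definition Vsca_loc (k : nat) E v : Prop :=
  Uh_loc k E v /\
  exists p, is_Pinabla E k%:Z v p /\
    forall q, Pdiff E.2 k%:Z (k%:Z - 2) q ->
      \int[mu2]_(x in E.2) ((v x - p x) * q x) = 0.

Definition Vvec A (k : nat) (T : seq polygon) u : Prop :=
  (forall i, H10 A (u i)) /\ forall E, E \in T -> Vvec_loc k E u.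

Definition Vsca A (k : nat) (T : seq polygon) v : Prop :=
  H10 A v /\ forall E, E \in T -> Vsca_loc k E v.

Definition Qh A (k : nat) (T : seq polygon) (q : R * R -> R) : Prop :=
  L20 A q /\ forall E, E \in T -> inPn E.2 (k%:Z - 1) q.

Definition bform A u (q : R * R -> R) : R :=
  - (\int[mu2]_(x in A) (q x * divg A u x)).

Definition Zh A (k : nat) (T : seq polygon) u : Prop :=
  Vvec A k T u /\ forall q, Qh A k T q -> bform A u q = 0.

Definition W1broken A (T : seq polygon) (q : R) v : Prop :=
  Lp A 2 v /\ forall E, E \in T -> W1 E.2 q v.

(* The seminorm of W^1_q(E) is (sum_al ||D^al v||_{0,q,E}^q)^(1/q), |al| = 1,
   componentwise for vector fields. *)
Definition semiW1 (T : seq polygon) (q : R) v : R :=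
  (\sum_(E <- T) \sum_(j < 2) normL E.2 q (wpartial E.2 j v) `^ q) `^ q^-1.

Definition semiW1v (T : seq polygon) (q : R) u : R :=
  (\sum_(E <- T) \sum_(i < 2) \sum_(j < 2)
      normL E.2 q (wpartial E.2 j (u i)) `^ q) `^ q^-1.

Definition stabV_form (k : nat) E (S : vfield -> vfield -> R) : Prop :=
  [/\ forall u w, Vvec_loc k E u -> Vvec_loc k E w -> S u w = S w u,
      forall (c : R) u u' w,
        Vvec_loc k E u -> Vvec_loc k E u' -> Vvec_loc k E w ->
        S (fun i x => c * u i x + u' i x) w = c * S u w + S u' w &
      (* S is a form on classes of almost everywhere equal functions *)
      forall u u' w,
        Vvec_loc k E u -> Vvec_loc k E u' -> Vvec_loc k E w ->
        (forall i, ae_eq mu2 E.2 (u i) (u' i)) -> S u w = S u' w].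

Definition stabT_form (k : nat) E (S : (R * R -> R) -> (R * R -> R) -> R) :
    Prop :=
  [/\ forall v g, Vsca_loc k E v -> Vsca_loc k E g -> S v g = S g v,
      forall (c : R) v v' g,
        Vsca_loc k E v -> Vsca_loc k E v' -> Vsca_loc k E g ->
        S (fun x => c * v x + v' x) g = c * S v g + S v' g &
      forall v v' g,
        Vsca_loc k E v -> Vsca_loc k E v' -> Vsca_loc k E g ->
        ae_eq mu2 E.2 v v' -> S v g = S v' g].

Definition kerPi0 (k : nat) E v : Prop :=
  ae_eq mu2 E.2 (Pi0 E.2 k%:Z v) (cst 0).

Definition stabV_bounds (k : nat) (c C : R) E (S : vfield -> vfield -> R) :
    Prop :=
  forall u, Vvec_loc k E u -> (forall i, kerPi0 k E (u i)) ->
    c * semiH1v E.2 u ^+ 2 <= S u u <= C * semiH1v E.2 u ^+ 2.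

Definition stabT_bounds (k : nat) (c C : R) E
    (S : (R * R -> R) -> (R * R -> R) -> R) : Prop :=
  forall v, Vsca_loc k E v -> kerPi0 k E v ->
    c * semiH1 E.2 v ^+ 2 <= S v v <= C * semiH1 E.2 v ^+ 2.

Section Forms.
Variable k : nat.
Let Pk E := Pi0 E.2 k%:Z.
Let PG E v (j : 'I_2) := Pi0 E.2 (k%:Z - 1) (wpartial E.2 j v).

(* Pi0 E.2 0 v is a constant function; the evaluation point is immaterial. *)
Definition mean_value E v : R := Pi0 E.2 0 v (centroid E.2).

Definition ah (nu : R -> R) (SV : polygon -> vfield -> vfield -> R)
    (T : seq polygon) (X : R * R -> R) u w : R :=
  \sum_(E <- T)
    ((\int[mu2]_(x in E.2) (nu (Pk E X x) *
       \sum_(i < 2) \sum_(j < 2) PG E (u i) j x * PG E (w i) j x))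
     + nu (mean_value E X) *
       SV E (fun i => u i \- Pk E (u i)) (fun i => w i \- Pk E (w i))).

Definition aTh (kappa : R -> R)
    (ST : polygon -> (R * R -> R) -> (R * R -> R) -> R)
    (T : seq polygon) (X Q S : R * R -> R) : R :=
  \sum_(E <- T)
    ((\int[mu2]_(x in E.2) (kappa (Pk E X x) *
       \sum_(j < 2) PG E Q j x * PG E S j x))
     + kappa (mean_value E X) * ST E (Q \- Pk E Q) (S \- Pk E S)).

Definition cNh (T : seq polygon) z u w : R :=
  \sum_(E <- T) \int[mu2]_(x in E.2)
    (\sum_(i < 2) (\sum_(j < 2) PG E (u i) j x * Pk E (z j) x) * Pk E (w i) x).

Definition cNskew (T : seq polygon) z u w : R :=
  2^-1 * (cNh T z u w - cNh T z w u).

Definition cFh (r : R) (T : seq polygon) z u w : R :=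
  \sum_(E <- T) \int[mu2]_(x in E.2)
    (Num.sqrt (\sum_(i < 2) Pk E (z i) x ^+ 2) `^ (r - 2) *
     \sum_(i < 2) Pk E (u i) x * Pk E (w i) x).

Definition cTh (T : seq polygon) u (Q S : R * R -> R) : R :=
  \sum_(E <- T) \int[mu2]_(x in E.2)
    ((\sum_(j < 2) Pk E (u j) x * PG E Q j x) * Pk E S x).

Definition cTskew (T : seq polygon) u (Q S : R * R -> R) : R :=
  2^-1 * (cTh T u Q S - cTh T u S Q).

Definition dh (T : seq polygon) u w : R :=
  \sum_(E <- T) \int[mu2]_(x in E.2)
    (\sum_(i < 2) Pk E (u i) x * Pk E (w i) x).

Definition data_h (T : seq polygon) g : R * R -> R :=
  fun x => \sum_(E <- T) \1_(E.2) x * Pk E g x.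

End Forms.

Definition is_discrete_solution A (k : nat) (r : R) (nu kappa : R -> R)
    (SV : polygon -> vfield -> vfield -> R)
    (ST : polygon -> (R * R -> R) -> (R * R -> R) -> R)
    (f : vfield) g (T : seq polygon)
    (u : vfield) (p th : R * R -> R) : Prop :=
  [/\ Vvec A k T u, Qh A k T p, Vsca A k T th &
    forall w q S, Vvec A k T w -> Qh A k T q -> Vsca A k T S ->
      [/\ ah k nu SV T th u w + cNskew k T u u w + cFh k r T u u w
            + dh k T u w + bform A w p
            = \int[mu2]_(x in A) (\sum_(i < 2) data_h k T (f i) x * w i x),
          bform A u q = 0 &
          aTh k kappa ST T th th S + cTskew k T u th S
            = \int[mu2]_(x in A) (data_h k T g x * S x)]].

End Plane.

Notation polygon R := (seq (R * R) * set (R * R))%type.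

(* Main.v *)
Require Import Defs.
From HB Require Import structures.
From mathcomp Require Import all_boot all_order all_algebra.
From mathcomp Require Import all_classical all_reals all_analysis.
From mathcomp Require Import measurable_realfun.
From mathcomp Require Import zify ring lra.
Set Implicit Arguments.
Unset Strict Implicit.
Unset Printing Implicit Defensive.
Import Order.TTheory GRing.Theory Num.Theory.
Import numFieldNormedType.Exports.
Local Open Scope classical_set_scope.
Local Open Scope ring_scope.

(** The difference [e] of the velocities and the difference [d] of the
    temperatures of two solutions are used as test functions. Write [|.|] for the
    H^1 seminorm.

    Testing the heat equation of the given solution with its own temperature [th]
    kills the skew-symmetric convection, so that coercivity, Cauchy-Schwarz and
    the Poincare inequality give [beta kappa_low |th| <= CP ||g_h||]. In the
    momentum equation tested with [u] the Forchheimer and drag terms are moreover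
    nonnegative and the pressure term vanishes, whence
    [alpha nu_low |u| <= CP ||f_h||].

    Subtract the heat equations of the two solutions and test with [d]. The
    convection of [d] by the other velocity vanishes, the convection of [th] by
    [e] is at most [CT_hat |e| |d| |th|], and the change of the coefficient costs
    at most [CT kappa_lip |d|^2] times the broken seminorm of [th]. Since the
    latter is absorbed by coercivity, [|d|] is bounded by a multiple of [|e|].
    Subtract the momentum equations and test with [e]. Likewise the convection
    contributes at most [CN |e|^2 |u|], the change of the viscosity at most
    [CV nu_lip |d| |e|] times the broken seminorm of [u]; the drag has a good
    sign, the Forchheimer term is monotone ([forchheimer_monotone]), and both
    pressures drop out because [e] is discretely divergence free. Inserting the
    bounds for [|d|], [|u|] and [|th|] gives [|e|^2 <= theta |e|^2], where
    [theta < 1] is the left-hand side of the smallness condition; hence [e = 0]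
    and [d = 0] ([smallness_absorption]). The momentum equations then reduce to
    [bform w (p' - p) = 0] for all [w], and the inf-sup condition gives [p' = p]
    ([infsup_eq0]).

    This argument rests on three facts about the discrete spaces and forms, which
    take up most of the file. The spaces are vector spaces, so that [e] and [d]
    are admissible test functions: for the H^1_0 constraint, the traces and the
    weak equations in the definition of the local spaces this is an approximation
    or integration argument ([H10_lin], [has_trace_lin], [Vvec_loc_lin],
    [Vsca_loc_lin]). The forms are linear and insensitive to changes on null
    sets: weak derivatives are unique and hence linear almost everywhere by the
    fundamental lemma of the calculus of variations ([fundamental_lemma],
    [wpartial_lin]), and so are the projections, whose existence is Gram-Schmidt
    ([span_projection], [Pi0_lin]). Finally, the stabilizations are linear on the
    local spaces only, so that their arguments [v - Pi0 v] must lie there, i.e.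
    the local spaces must contain the polynomials; for the velocities this is a
    polynomial Helmholtz decomposition ([Pn_helmholtz], [Wh_loc_Pn]). *)

(** * Square integrable functions *)

(** Every discrete space is closed under these combinations, and every operator
    and form respects them; the one-parameter shape lets a single lemma cover
    sums, differences and multiples. *)
Definition lin {X : Type} {R : realType} (c : R) (f g : X -> R) : X -> R :=
  fun x => c * f x + g x.

Section SquareIntegrable.
Context d (X : measurableType d) (R : realType).
Variable mu : {measure set X -> \bar R}.
Implicit Types (D : set X) (f g h : X -> R).

Definition intg D f := mu.-integrable D (EFin \o f).

Definition sqint D f :=
  measurable_fun D f /\ intg D (fun x => f x ^+ 2).

Definition nrm D f : R := Num.sqrt (\int[mu]_(x in D) (f x ^+ 2)).

Lemma intg_meas D f : intg D f -> measurable_fun D f.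
Proof. by move=> /measurable_int/measurable_EFinP. Qed.

Lemma intg_lin D c f g : measurable D -> intg D f -> intg D g ->
  intg D (lin c f g).
Proof.
move=> mD If Ig; rewrite /intg.
have -> : EFin \o lin c f g
    = (fun x => (c%:E * (EFin \o f) x)%E) \+ (EFin \o g) by [].
by apply: integrableD => //; apply: integrableZl.
Qed.

Lemma intg_eq D f g : measurable D -> {in D, f =1 g} -> intg D f -> intg D g.
Proof.
by move=> mD fg; apply: eq_integrable => // x xD /=; rewrite fg.
Qed.

Lemma intg_le D f g : measurable D -> measurable_fun D f ->
  (forall x, D x -> `|f x| <= g x) -> intg D g -> intg D f.
Proof.
move=> mD mf fg; apply: le_integrable => //; first exact/measurable_EFinP.
by move=> x Dx /=; rewrite lee_fin (le_trans (fg x Dx))// ler_norm.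
Qed.

(** Almost everywhere equality does not give measurability, since the measure
    need not be complete; hence the measurability hypothesis on [f]. *)
Lemma intg_ae D f g : measurable D -> measurable_fun D f ->
  ae_eq mu D f g -> intg D g -> intg D f.
Proof.
move=> mD mf fg Ig; apply/integrableP; split; first exact/measurable_EFinP.
case/integrableP: (Ig) => mg; apply: le_lt_trans.
rewrite le_eqVlt; apply/orP; left; apply/eqP; apply: ae_eq_integral => //.
- by apply: measurableT_comp => //; apply/measurable_EFinP.
- exact: measurableT_comp.
- by apply: filterS fg => x fg Dx /=; rewrite fg.
Qed.

Lemma Rint_ae D f g : measurable D -> measurable_fun D f ->
  measurable_fun D g -> ae_eq mu D f g ->
  \int[mu]_(x in D) f x = \int[mu]_(x in D) g x.
Proof.
move=> mD mf mg fg; rewrite /Rintegral; congr fine; apply: ae_eq_integral => //.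
- exact/measurable_EFinP.
- exact/measurable_EFinP.
- by apply: filterS fg => x fg Dx /=; rewrite fg.
Qed.

Lemma Rint_lin D c f g : measurable D -> intg D f -> intg D g ->
  \int[mu]_(x in D) (c * f x + g x)
  = c * (\int[mu]_(x in D) f x) + \int[mu]_(x in D) g x.
Proof.
move=> mD If Ig; rewrite RintegralD//; last exact: (integrableZl mD c If).
by rewrite RintegralZl.
Qed.

Lemma Rint_lin_ae D c F f g : measurable D -> measurable_fun D F ->
  intg D f -> intg D g -> ae_eq mu D F (lin c f g) ->
  \int[mu]_(x in D) F x
  = c * (\int[mu]_(x in D) f x) + \int[mu]_(x in D) g x.
Proof.
move=> mD mF If Ig FE; rewrite -Rint_lin//; apply: Rint_ae => //.
exact: intg_meas (intg_lin _ mD If Ig).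
Qed.

Lemma Rint0_ae D f : measurable D -> measurable_fun D f ->
  ae_eq mu D f (cst 0) -> \int[mu]_(x in D) f x = 0.
Proof.
move=> mD mf f0; rewrite (@Rint_ae _ _ (cst 0))// Rintegral_cst//.
by rewrite mul0r.
Qed.

Lemma intg_sum D n (F : 'I_n -> X -> R) : measurable D ->
  (forall i, intg D (F i)) -> intg D (fun x => \sum_(i < n) F i x).
Proof.
move=> mD; elim: n F => [|n IH] F IF.
  by under [fun x => _]funext => x do rewrite big_ord0; exact: integrable0.
rewrite (_ : (fun x => _) = lin 1 (F ord0)
    (fun x => \sum_(i < n) F (lift ord0 i) x)).
  by apply: intg_lin => //; exact: (IH (fun i => F (lift ord0 i))).
by apply/funext => x; rewrite /lin mul1r big_ord_recl.
Qed.

Lemma Rint_sum D n (F : 'I_n -> X -> R) : measurable D ->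
  (forall i, intg D (F i)) ->
  \int[mu]_(x in D) (\sum_(i < n) F i x) = \sum_(i < n) \int[mu]_(x in D) F i x.
Proof.
move=> mD; elim: n F => [|n IH] F IF.
  rewrite big_ord0; under eq_Rintegral do rewrite big_ord0.
  by rewrite Rintegral_cst// mul0r.
under eq_Rintegral do rewrite big_ord_recl.
rewrite RintegralD//; [|exact: IF|
  exact: (intg_sum mD (fun i => IF (lift ord0 i)))].
by rewrite big_ord_recl (IH (fun i => F (lift ord0 i))).
Qed.

Lemma sqint_mul D f g : measurable D -> sqint D f -> sqint D g ->
  intg D (fun x => f x * g x).
Proof.
move=> mD [mf If] [mg Ig].
apply: (@intg_le _ _ (lin 1 (fun x => f x ^+ 2) (fun x => g x ^+ 2))) => //.
- exact: measurable_funM.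
- move=> x _; rewrite /lin mul1r normrM -(real_normK (num_real (f x))).
  rewrite -(real_normK (num_real (g x))).
  have := sqr_ge0 (`|f x| - `|g x|).
  have : 0 <= `|f x| * `|g x| by rewrite mulr_ge0.
  by nra.
- exact: intg_lin.
Qed.

Lemma measurable_lin D c f g : measurable_fun D f -> measurable_fun D g ->
  measurable_fun D (lin c f g).
Proof.
move=> mf mg; apply: measurable_funD => //.
by apply: measurable_funM => //; exact: measurable_cst.
Qed.

Lemma sqint_lin D c f g : measurable D -> sqint D f -> sqint D g ->
  sqint D (lin c f g).
Proof.
move=> mD sf sg; have Ifg := sqint_mul mD sf sg.
have [[mf If] [mg Ig]] := (sf, sg).
split; first exact: measurable_lin.
apply: (@intg_eq _ (lin (c ^+ 2) (fun x => f x ^+ 2)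
   (lin (c * 2) (fun x => f x * g x) (fun x => g x ^+ 2)))) => //.
  by move=> x _; rewrite /lin; ring.
by do 2 apply: intg_lin => //.
Qed.

Lemma sqint0 D : measurable D -> sqint D (cst 0).
Proof.
move=> mD; split; first exact: measurable_cst.
apply: (@intg_eq _ (cst 0)) => // [x _|]; first by rewrite expr0n.
exact: integrable0.
Qed.

Lemma sqint_sum D n (F : 'I_n -> X -> R) : measurable D ->
  (forall i, sqint D (F i)) -> sqint D (fun x => \sum_(i < n) F i x).
Proof.
move=> mD; elim: n F => [|n IH] F SF.
  by under [fun x => _]funext => x do rewrite big_ord0; exact: sqint0.
rewrite (_ : (fun x => _) = lin 1 (F ord0)
    (fun x => \sum_(i < n) F (lift ord0 i) x)).
  by apply: sqint_lin => //; exact: (IH (fun i => F (lift ord0 i))).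
by apply/funext => x; rewrite /lin mul1r big_ord_recl.
Qed.

Lemma sqint_eq D f g : measurable D -> {in D, f =1 g} -> sqint D f ->
  sqint D g.
Proof.
move=> mD fg [mf If]; split; first exact: (eq_measurable_fun f).
by apply: intg_eq If => // x xD; rewrite fg.
Qed.

Lemma sqint_sub D f g : measurable D -> sqint D f -> sqint D g ->
  sqint D (fun x => f x - g x).
Proof.
move=> mD sf sg; have := sqint_lin (-1) mD sg sf.
by apply: sqint_eq => // x _; rewrite /lin mulN1r addrC.
Qed.

Lemma sqint_ae D f g : measurable D -> measurable_fun D f ->
  ae_eq mu D f g -> sqint D g -> sqint D f.
Proof.
move=> mD mf fg [mg Ig]; split => //; apply: intg_ae Ig => //.
  exact: measurable_funX.
by apply: filterS fg => x fg Dx; rewrite fg.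
Qed.

Lemma nrm_ge0 D f : 0 <= nrm D f.
Proof. exact: sqrtr_ge0. Qed.

Lemma nrm_sqr D f : nrm D f ^+ 2 = \int[mu]_(x in D) (f x ^+ 2).
Proof. by rewrite sqr_sqrtr// Rintegral_ge0// => x _; rewrite sqr_ge0. Qed.

Lemma nrm_ae D f g : measurable D -> measurable_fun D f ->
  measurable_fun D g -> ae_eq mu D f g -> nrm D f = nrm D g.
Proof.
move=> mD mf mg fg; rewrite /nrm; congr Num.sqrt; apply: Rint_ae => //.
- exact: measurable_funX.
- exact: measurable_funX.
- by apply: filterS fg => x fg Dx; rewrite fg.
Qed.

(** The quadratic [t |-> nrm (t f + g) ^ 2] is nonnegative, in particular at its
    minimum. *)
Lemma cauchy_schwarz D f g : measurable D -> sqint D f -> sqint D g ->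
  `|\int[mu]_(x in D) (f x * g x)| <= nrm D f * nrm D g.
Proof.
move=> mD sf sg; have Ifg := sqint_mul mD sf sg.
have [[mf If] [mg Ig]] := (sf, sg).
set a := nrm D f; set b := nrm D g; set s := Rintegral _ _ _.
have q t : 0 <= t ^+ 2 * a ^+ 2 + 2 * t * s + b ^+ 2.
  have : 0 <= \int[mu]_(x in D) (lin t f g x ^+ 2).
    by apply: Rintegral_ge0 => x _; rewrite sqr_ge0.
  under eq_Rintegral => x _.
    rewrite (_ : _ ^+ 2 = t ^+ 2 * f x ^+ 2
      + lin (2 * t) (fun x => f x * g x) (fun x => g x ^+ 2) x); last first.
      by rewrite /lin; ring.
    over.
  rewrite Rint_lin//; last exact: intg_lin.
  by rewrite Rint_lin// !nrm_sqr addrA.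
have a0 : 0 <= a by exact: nrm_ge0.
have b0 : 0 <= b by exact: nrm_ge0.
rewrite -(@ler_pXn2r _ 2%N)// ?nnegrE ?mulr_ge0// real_normK ?num_real//.
have [a00|an0] := eqVneq a 0.
  (* the quadratic degenerates to an affine function of t *)
  have := q (- (b ^+ 2 + 1) / (2 * s)).
  have [->|s0] := eqVneq s 0; first by rewrite expr0n/= exprn_ge0// mulr_ge0.
  rewrite a00; move=> H; exfalso; move: H.
  have -> : 2 * (- (b ^+ 2 + 1) / (2 * s)) * s = - (b ^+ 2 + 1) by field.
  by lra.
have := q (- s / a ^+ 2).
have -> : (- s / a ^+ 2) ^+ 2 * a ^+ 2 + 2 * (- s / a ^+ 2) * s + b ^+ 2
   = (a ^+ 2 * b ^+ 2 - s ^+ 2) / a ^+ 2 by field.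
rewrite pmulr_lge0 ?invr_gt0 ?exprn_gt0// ?lt0r ?an0 ?nrm_ge0//.
by rewrite subr_ge0 exprMn.
Qed.

Lemma nrm_lin D c f g : measurable D -> sqint D f -> sqint D g ->
  nrm D (lin c f g) <= `|c| * nrm D f + nrm D g.
Proof.
move=> mD sf sg; have Ifg := sqint_mul mD sf sg.
have [[mf If] [mg Ig]] := (sf, sg).
have r0 : 0 <= `|c| * nrm D f + nrm D g.
  by rewrite addr_ge0 ?mulr_ge0 ?nrm_ge0.
rewrite -(@ler_pXn2r _ 2%N)// ?nnegrE ?nrm_ge0// nrm_sqr.
under eq_Rintegral => x _.
  rewrite (_ : _ ^+ 2 = c ^+ 2 * f x ^+ 2
    + lin (c * 2) (fun x => f x * g x) (fun x => g x ^+ 2) x); last first.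
    by rewrite /lin; ring.
  over.
rewrite Rint_lin//; last exact: intg_lin.
rewrite Rint_lin// -!nrm_sqr sqrrD exprMn real_normK ?num_real// -addrA lerD2l.
rewrite lerD2r -[leRHS]mulr_natl.
have := ler_wpM2l (normr_ge0 c) (cauchy_schwarz mD sf sg).
rewrite -normrM => H; have := le_trans (ler_norm _) H; lra.
Qed.

Lemma nrm0_ae D f : measurable D -> sqint D f -> nrm D f = 0 ->
  ae_eq mu D f (cst 0).
Proof.
move=> mD [mf If] n0.
have := nrm_sqr D f; rewrite n0 expr0n/= => /esym I0.
have : (\int[mu]_(x in D) `|(f x ^+ 2)%:E| = 0)%E.
  under eq_integral => x _ do rewrite gee0_abs ?lee_fin ?sqr_ge0//.
  by rewrite -[LHS]fineK ?integrable_fin_num//; congr EFin.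
move/ae_eq_integral_abs => /(_ mD (measurable_int _ If)).
by apply: filterS => x H /H /= [] /eqP; rewrite sqrf_eq0 => /eqP.
Qed.

Lemma nrm_ae0 D f : measurable D -> measurable_fun D f ->
  ae_eq mu D f (cst 0) -> nrm D f = 0.
Proof.
move=> mD mf f0; rewrite /nrm Rint0_ae ?sqrtr0//; first exact: measurable_funX.
by apply: filterS f0 => x H /H ->; rewrite expr0n.
Qed.

(** [Lfun] consists of functions on the whole space; a function on [D] enters
    through its extension by zero. *)
Lemma Lfun2P D f : measurable D ->
  (f \_ D \in Lfun mu 2%:E) <-> sqint D f.
Proof.
move=> mD.
have sqE : (fun x => (f \_ D) x ^+ 2) = (fun x => f x ^+ 2) \_ D.
  by apply/funext => x; rewrite !patchE; case: ifP => // _; rewrite expr0n.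
have IE : intg D (fun x => f x ^+ 2) <->
    intg setT (fun x => (f \_ D) x ^+ 2).
  rewrite sqE /intg -restrict_EFin.
  have := integrable_restrict mu mD measurableT (EFin \o (fun x => f x ^+ 2)).
  by rewrite setTI.
have mE : measurable_fun setT (f \_ D) <-> measurable_fun D f.
  exact: iff_sym (measurable_restrictT _ mD).
split=> [lf|[mf If]].
  have If := Lfun2_integrable_sqr lf.
  by split; [apply/mE; move: lf => /andP[]; rewrite inE|apply/IE].
apply/andP; split; rewrite inE/=; first exact/mE.
move/IE : If => If; rewrite /finite_norm unlock /= poweR_lty//.
under eq_integral => x _ do rewrite powR_mulrn// real_normK ?num_real//.
exact: integrable_lty.
Qed.

Lemma fine_Lnorm2 D f : measurable D ->
  fine 'N[mu]_2%:E [EFin \o (f \_ D)] = nrm D f.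
Proof.
move=> mD; rewrite unlock /= /nrm Rintegral_mkcond.
under eq_integral => x _ do rewrite powR_mulrn// real_normK ?num_real//.
under [in RHS]eq_Rintegral => x _.
  rewrite (_ : _ x = (f \_ D) x ^+ 2); last first.
    by rewrite !patchE; case: ifP => // _; rewrite expr0n.
  over.
rewrite /Rintegral; have : (0 <= \int[mu]_x ((f \_ D) x ^+ 2)%:E)%E.
  by apply: integral_ge0 => x _; rewrite lee_fin sqr_ge0.
case: (\int[mu]_x _)%E => [s| |]//= s0; first by rewrite powR12_sqrt.
by rewrite invr_eq0 pnatr_eq0/= sqrtr0.
Qed.

Lemma ae_fin (I : finType) (P : I -> X -> Prop) :
  (forall i, \forall x \ae mu, P i x) -> \forall x \ae mu, forall i, P i x.
Proof. exact: filter_forall. Qed.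

End SquareIntegrable.

(** * Measure and topology in the plane *)

(** The measurable structure over which the Lebesgue measure of the plane is
    defined; it has to be named, since [R * R] also carries another one. *)
Local Notation plane R := (measurableTypeR R * measurableTypeR R)%type.
Local Notation pmeasurable R := (@measurable _ (plane R)).
Local Notation pmeasurable_fun R := (@measurable_fun _ _ (plane R) R).

Section PlaneMeasure.
Context (R : realType).
Local Notation leb := (@lebesgue_measure R).
Local Notation mu := (@mu2 R).
Implicit Types (A U : set (plane R)) (f g : plane R -> R).

Definition box (a b : R * R) : set (R * R) :=
  `[a.1, b.1]%classic `*` `[a.2, b.2]%classic.

Lemma boxP a b x : box a b x <-> (a.1 <= x.1 <= b.1) /\ (a.2 <= x.2 <= b.2).
Proof. by rewrite /box/= !in_itv/=. Qed.

Definition obox (a b : R * R) : set (R * R) :=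
  `]a.1, b.1[%classic `*` `]a.2, b.2[%classic.

Lemma oboxP a b x : obox a b x <-> (a.1 < x.1 < b.1) /\ (a.2 < x.2 < b.2).
Proof. by rewrite /obox/= !in_itv/=. Qed.

Lemma obox_sub a b : obox a b `<=` box a b.
Proof.
move=> x /oboxP[/andP[h1 h2] /andP[h3 h4]].
by apply/boxP; rewrite !ltW.
Qed.

Lemma measurable_obox a b : pmeasurable R (obox a b).
Proof. exact: measurableX. Qed.

Lemma measurable_box a b : pmeasurable R (box a b).
Proof. exact: measurableX. Qed.

Lemma compact_box a b : compact (box a b).
Proof. by apply: compact_setX; exact: segment_compact. Qed.

Lemma mu2_box a b : (mu (box a b) < +oo)%E.
Proof.
rewrite /mu2 product_measure1E//= !lebesgue_measure_itv/=.
by do 2 case: ifP => _; rewrite ?mule0 ?mul0e ?ltry.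
Qed.

(** Squares with rational centre and half side [1 / n.+1]. *)
Definition rlow (i : rat * rat * nat) : R * R :=
  (ratr i.1.1 - i.2.+1%:R^-1, ratr i.1.2 - i.2.+1%:R^-1).

Definition rhigh (i : rat * rat * nat) : R * R :=
  (ratr i.1.1 + i.2.+1%:R^-1, ratr i.1.2 + i.2.+1%:R^-1).

Definition rsquare i := box (rlow i) (rhigh i).

Definition osquare i := obox (rlow i) (rhigh i).

Lemma osquare_sub i : osquare i `<=` rsquare i.
Proof. exact: obox_sub. Qed.

(** An open set is the countable union of the open rational squares whose
    closure it contains. *)
Lemma open_rsquares U : open U ->
  U = \bigcup_(i in [set: rat * rat * nat])
        (if `[< rsquare i `<=` U >] then osquare i else set0).
Proof.
move=> oU; apply/seteqP; split=> [x Ux|x [i _]]; last first.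
  by case: ifPn => // /asboolP + /osquare_sub; apply.
have [e e0 eU] : exists2 e : R, 0 < e & ball x e `<=` U.
  by have /nbhs_ballP[e e0 eU] := open_nbhs_nbhs (conj oU Ux); exists e.
have [n ne] : exists n, n.+1%:R^-1 < e / 2.
  have e2 : 0 < e / 2 by rewrite divr_gt0.
  have [n _ /(_ n)/= H] := near_infty_natSinv_lt (PosNum e2).
  by exists n; exact: H.
have n0 : 0 < n.+1%:R^-1 :> R by rewrite invr_gt0.
have rat_near (y : R) : exists q : rat,
    ratr q - n.+1%:R^-1 < y < ratr q + n.+1%:R^-1.
  have [q] : exists q, ratr q \in `]y - n.+1%:R^-1, y + n.+1%:R^-1[.
    have yn : y - n.+1%:R^-1 < y + n.+1%:R^-1.
      by rewrite ltrD2l (lt_trans _ n0)// oppr_lt0.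
    exact: rat_in_itvoo yn.
  rewrite in_itv/= ltrBlDr => /andP[q1 q2].
  by exists q; rewrite ltrBlDr q2 q1.
have [q1 h1] := rat_near x.1; have [q2 h2] := rat_near x.2.
exists (q1, q2, n) => //; case: ifPn => [_|/asboolPn[]].
  exact/oboxP.
rewrite /rsquare /rlow /rhigh /=; move: (_^-1) ne n0 h1 h2 => s ne n0 h1 h2.
move=> y /boxP/= [k1 k2]; apply: eU; split; rewrite /ball/= ltr_norml; lra.
Qed.

Lemma open_measurable2 U : open U -> measurable U.
Proof.
move=> oU; rewrite (open_rsquares oU).
apply: countable_bigcupT_measurable => // i.
by case: ifP => _ //; exact: measurable_obox.
Qed.

Lemma continuous_measurable2 A f : measurable A -> continuous f ->
  pmeasurable_fun R A f.
Proof.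
move=> mA cf; apply: (measurable_funS measurableT) => //.
apply: (measurability (@RGenOpens.G R)); first exact: RGenOpens.measurableE.
move=> _ [_ [a [b ->]] <-]; rewrite setTI; apply: open_measurable2.
by apply: open_comp => // x _; exact: cf.
Qed.

Lemma bounded_box A : bounded_set A ->
  exists M : R, 0 <= M /\ A `<=` box (- M, - M) (M, M).
Proof.
move=> [M [_ AM]]; exists (`|M| + 1); split; first by rewrite addr_ge0.
have M1 : M < `|M| + 1 by rewrite (le_lt_trans (ler_norm M))// ltrDl.
move=> x /(AM _ M1); rewrite /= prod_normE ge_max => /andP[h1 h2].
by apply/boxP; rewrite -!ler_norml.
Qed.

Lemma mu2_bounded A : measurable A -> bounded_set A -> (mu A < +oo)%E.
Proof.
move=> mA /bounded_box[M [_ AM]]; apply: le_lt_trans (mu2_box (-M,-M) (M,M)).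
by apply: le_measure => //; rewrite inE//; exact: measurable_box.
Qed.

(** Bounded measurable functions on a set, the class in which the polynomial
    integrands of the discrete forms live. *)
Definition bddm A f :=
  pmeasurable_fun R A f /\ exists M : R, forall x, A x -> `|f x| <= M.

Lemma bddm_sub A U f : measurable A -> U `<=` A -> bddm A f -> bddm U f.
Proof.
move=> mA UA [mf [M fM]]; split; first exact: measurable_funS mf.
by exists M => x /UA; exact: fM.
Qed.

Lemma bddm_cst A c : bddm A (cst c).
Proof. by split; [exact: measurable_cst|exists `|c|]. Qed.

Lemma bddmD A f g : bddm A f -> bddm A g -> bddm A (fun x => f x + g x).
Proof.
move=> [mf [M fM]] [mg [N gN]]; split; first exact: measurable_funD.
by exists (M + N) => x Ax; rewrite (le_trans (ler_normD _ _))// lerD ?fM ?gN.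
Qed.

Lemma bddmM A f g : bddm A f -> bddm A g -> bddm A (fun x => f x * g x).
Proof.
move=> [mf [M fM]] [mg [N gN]]; split; first exact: measurable_funM.
by exists (M * N) => x Ax; rewrite normrM ler_pM ?fM ?gN.
Qed.

Lemma bddmX A f n : bddm A f -> bddm A (fun x => f x ^+ n).
Proof.
move=> bf; elim: n => [|n IH].
  by under [fun x => _]funext => x do rewrite expr0; exact: bddm_cst.
by under [fun x => _]funext => x do rewrite exprS; exact: bddmM.
Qed.

Lemma bddm_sum A (n : nat) (F : 'I_n -> R * R -> R) :
  (forall i, bddm A (F i)) -> bddm A (fun x => \sum_(i < n) F i x).
Proof.
elim: n F => [|n IH] F bF.
  by under [fun x => _]funext => x do rewrite big_ord0; exact: bddm_cst.
under [fun x => _]funext => x do rewrite big_ord_recl.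
apply: bddmD; [exact: bF|exact: (IH (fun i => F (lift ord0 i)))].
Qed.

Lemma bddm_lin A c f g : bddm A f -> bddm A g -> bddm A (lin c f g).
Proof. by move=> bf bg; apply: bddmD => //; apply: bddmM => //; exact: bddm_cst. Qed.

Lemma cont_bounded_box f (a b : R * R) : continuous f ->
  exists2 M : R, 0 <= M & forall x, box a b x -> `|f x| <= M.
Proof.
move=> cf.
have : compact (f @` box a b).
  apply: continuous_compact; last exact: compact_box.
  exact: continuous_subspaceT.
move=> /compact_bounded[N [_ fN]]; exists (`|N| + 1); first by rewrite addr_ge0.
move=> x xab; apply: (fN (`|N| + 1)); last by exists x.
by rewrite (le_lt_trans (ler_norm N))// ltrDl.
Qed.

Lemma bddm_cont A f : measurable A -> bounded_set A -> continuous f ->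
  bddm A f.
Proof.
move=> mA bA cf; split; first exact: continuous_measurable2.
have [M [_ AM]] := bounded_box bA.
have [N _ fN] := cont_bounded_box (-M, -M) (M, M) cf.
by exists N => x /AM; exact: fN.
Qed.

(** For a coefficient evaluated at a discrete temperature. *)
Lemma bddm_comp A f (phi : R -> R) (M : R) : measurable_fun setT phi ->
  (forall t, `|phi t| <= M) -> bddm A f -> bddm A (phi \o f).
Proof.
move=> mphi bphi [mf _]; split; first exact: measurableT_comp.
by exists M => x _; exact: bphi.
Qed.

Lemma bddm_intg A f : measurable A -> bounded_set A -> bddm A f ->
  intg mu A f.
Proof.
move=> mA bA [mf [M fM]]; apply: measurable_bounded_integrable => //.
  exact: mu2_bounded.
exists M; split; first exact: num_real.
by move=> N MN x Ax; apply: le_trans (fM x Ax) _; exact: ltW.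
Qed.

Lemma bddm_sqint A f : measurable A -> bounded_set A -> bddm A f ->
  sqint mu A f.
Proof.
move=> mA bA bf; split; first by case: bf.
by apply: bddm_intg => //; exact: bddmX.
Qed.

Lemma sqint_intg A f : measurable A -> bounded_set A -> sqint mu A f ->
  intg mu A f.
Proof.
move=> mA bA sf.
apply: (@intg_eq _ _ _ _ A (fun x => f x * cst 1 x)) => //.
  by move=> x _ /=; rewrite mulr1.
by apply: sqint_mul => //; apply: bddm_sqint => //; exact: bddm_cst.
Qed.

Lemma sqint_bddmM A f g : measurable A -> bounded_set A ->
  sqint mu A f -> bddm A g -> intg mu A (fun x => f x * g x).
Proof. by move=> mA bA sf bg; apply: sqint_mul => //; exact: bddm_sqint. Qed.

Lemma Lp2P A f : measurable A -> Lp A 2 f <-> sqint mu A f.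
Proof. exact: Lfun2P. Qed.

Lemma normLE A f : measurable A -> normL A 2 f = nrm mu A f.
Proof. exact: fine_Lnorm2. Qed.

End PlaneMeasure.

(** * Continuously differentiable functions *)

Section Calculus.
Context (R : realType).
Local Notation mu := (@mu2 R).
Implicit Types (f g : R * R -> R) (x a b : R * R).

Lemma ord2P (i : 'I_2) : i = ord0 \/ i = ord_max.
Proof. by case: i => [[|[|//]]] ?; [left|right]; exact: val_inj. Qed.

Lemma is_derive_horizontal f x d :
  is_derive x (dir R ord0) f d <-> is_derive x.1 1 (fun t => f (t, x.2)) d.
Proof.
have E : (fun h : R => h^-1 *: ((f \o shift x) (h *: dir R ord0) - f x)) =
    (fun h : R => h^-1 *: (((fun t => f (t, x.2)) \o shift x.1) (h *: 1)
                           - f (x.1, x.2))).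
  apply/funext => h; rewrite /= /dir/=; case: x => x1 x2 /=.
  rewrite (_ : h *: (1, 0) + (x1, x2) = (h *: 1 + x1, x2))//.
  by congr pair; rewrite /= scaler0 add0r.
have dE : derivable f x (dir R ord0) = derivable (fun t : R => f (t, x.2)) x.1 1.
  exact: (congr1 (fun F : R -> R => cvg (F @ 0^')) E).
have DE : 'D_(dir R ord0) f x = 'D_1 (fun t : R => f (t, x.2)) x.1.
  exact: (congr1 (fun F : R -> R => lim (F @ 0^')) E).
split=> -[H1 H2]; split.
- by move: H1; rewrite dE.
- by move: H2; rewrite DE.
- by move: H1; rewrite -dE.
- by move: H2; rewrite -DE.
Qed.

Lemma is_derive_vertical f x d :
  is_derive x (dir R ord_max) f d <-> is_derive x.2 1 (fun t => f (x.1, t)) d.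
Proof.
have E : (fun h : R => h^-1 *: ((f \o shift x) (h *: dir R ord_max) - f x)) =
    (fun h : R => h^-1 *: (((fun t => f (x.1, t)) \o shift x.2) (h *: 1)
                           - f (x.1, x.2))).
  apply/funext => h; rewrite /= /dir/=; case: x => x1 x2 /=.
  rewrite (_ : h *: (0, 1) + (x1, x2) = (x1, h *: 1 + x2))//.
  by congr pair; rewrite /= scaler0 add0r.
have dE : derivable f x (dir R ord_max) = derivable (fun t : R => f (x.1, t)) x.2 1.
  exact: (congr1 (fun F : R -> R => cvg (F @ 0^')) E).
have DE : 'D_(dir R ord_max) f x = 'D_1 (fun t : R => f (x.1, t)) x.2.
  exact: (congr1 (fun F : R -> R => lim (F @ 0^')) E).
split=> -[H1 H2]; split.
- by move: H1; rewrite dE.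
- by move: H2; rewrite DE.
- by move: H1; rewrite -dE.
- by move: H2; rewrite -DE.
Qed.

Lemma C1_is_derive f : C1 f ->
  forall j x, is_derive x (dir R j) f (pder j f x).
Proof. by move=> Cf j x; split => //; case: (Cf j). Qed.

(** All partial derivatives below are computed through this: both the regularity
    and the value follow from [is_derive]. *)
Lemma C1I f (D : 'I_2 -> R * R -> R) :
  (forall j x, is_derive x (dir R j) f (D j x)) ->
  (forall j, continuous (D j)) -> C1 f /\ forall j, pder j f = D j.
Proof.
move=> fD cD.
have E j : pder j f = D j.
  by apply/funext => x; rewrite /pder; apply: derive_val.
by split => // j; rewrite E; split.
Qed.

Lemma mean_value_bound (g dg : R -> R) (s t M : R) :
  (forall z, is_derive (z : R) 1 g (dg z)) ->
  (forall z, Num.min s t <= z <= Num.max s t -> `|dg z| <= M) ->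
  `|g t - g s| <= M * `|t - s|.
Proof.
move=> gD.
wlog st : s t / s <= t => [W|].
  have /orP[/W//|ts] := le_total s t.
  by rewrite minC maxC distrC (distrC t); exact: W.
rewrite min_l// max_r// => gM.
have [c|c cst ->] := MVT_segment st (fun z _ => gD z).
  apply: derivable_within_continuous => z _.
  by case: (gD z).
by rewrite normrM ler_wpM2r// gM.
Qed.

(** Continuity follows from a local Lipschitz bound: the segment between two
    points is replaced by a horizontal and a vertical one, and the mean value
    theorem is applied on both. *)
Lemma C1_continuous f : C1 f -> continuous f.
Proof.
move=> Cf x; have fD := C1_is_derive Cf.
set a := (x.1 - 1, x.2 - 1); set b := (x.1 + 1, x.2 + 1).
have [M M0 fM] := cont_bounded_box a b (Cf ord0).2.
have [N N0 fN] := cont_bounded_box a b (Cf ord_max).2.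
have lip y : `|y.1 - x.1| < 1 -> `|y.2 - x.2| < 1 ->
    `|f y - f x| <= M * `|y.1 - x.1| + N * `|y.2 - x.2|.
  rewrite !ltr_norml => /andP[y1 y1'] /andP[y2 y2'].
  have -> : f y - f x = (f (y.1, y.2) - f (x.1, y.2))
      + (f (x.1, y.2) - f (x.1, x.2)).
    by rewrite -!surjective_pairing addrA subrK.
  rewrite (le_trans (ler_normD _ _))// lerD//.
    apply: (mean_value_bound (g := fun z => f (z, y.2))
      (fun z => (is_derive_horizontal f (z, y.2) _).1 (fD ord0 (z, y.2)))).
    rewrite /= => z; rewrite ge_min le_max => /andP[z1 z2].
    apply/fM/boxP; rewrite /=; split; last by lra.
    by case/orP: z1; case/orP: z2; lra.
  apply: (mean_value_bound (g := fun z => f (x.1, z))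
    (fun z => (is_derive_vertical f (x.1, z) _).1 (fD ord_max (x.1, z)))).
  rewrite /= => z; rewrite ge_min le_max => /andP[z1 z2].
  apply/fN/boxP; rewrite /=; split; first by lra.
  by case/orP: z1; case/orP: z2; lra.
apply/cvgrPdist_lt => e e0.
pose s := Num.min 1 (e / (M + N + 1)).
have MN : 0 < M + N + 1 by rewrite ltr_wpDl// addr_ge0.
have s0 : 0 < s by rewrite lt_min ltr01 divr_gt0.
apply: filterS (nbhsx_ballx x s s0) => y [].
rewrite /ball/= distrC => y1; rewrite distrC => y2; rewrite distrC.
have [s1 se] : s <= 1 /\ s <= e / (M + N + 1) by rewrite /s !ge_min !lexx orbT.
apply: le_lt_trans (lip y (lt_le_trans y1 s1) (lt_le_trans y2 s1)) _.
apply: (@le_lt_trans _ _ ((M + N) * s)).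
  by rewrite mulrDl lerD// ler_wpM2l// ltW.
apply: (@lt_le_trans _ _ ((M + N + 1) * s)).
  by rewrite ltr_pM2r// ltrDl.
by rewrite mulrC -ler_pdivlMr.
Qed.

Lemma C1_lin c f g : C1 f -> C1 g ->
  C1 (lin c f g) /\ forall j, pder j (lin c f g) = lin c (pder j f) (pder j g).
Proof.
move=> Cf Cg; apply: C1I => [j x|j x].
  have -> : lin c f g = (c \*: f) + g by [].
  have := C1_is_derive Cf j x; have := C1_is_derive Cg j x => gD fD.
  by apply: is_deriveD; exact: is_deriveZ.
apply: cvgD; last exact: (Cg j).2.
by apply: cvgM; [exact: cvg_cst|exact: (Cf j).2].
Qed.

Lemma C1_mul f g : C1 f -> C1 g -> C1 (fun x => f x * g x) /\
  forall j, pder j (fun x => f x * g x)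
            = (fun x => f x * pder j g x + g x * pder j f x).
Proof.
move=> Cf Cg; apply: C1I => [j x|j x].
  have := C1_is_derive Cf j x; have := C1_is_derive Cg j x => gD fD.
  exact: is_deriveM.
by apply: cvgD; apply: cvgM;
  [exact: C1_continuous|exact: (Cg j).2|exact: C1_continuous|exact: (Cf j).2].
Qed.

Lemma C1_cst c : C1 (@cst (R * R) R c) /\ forall j, pder j (@cst (R * R) R c) = cst 0.
Proof.
by apply: (@C1I _ (fun=> cst 0)) => j x; exact: cvg_cst.
Qed.

(** A product of one-variable functions is the only source of test functions
    and of monomials. *)
Lemma C1_tensor (p q dp dq : R -> R) :
  (forall t, is_derive (t : R) 1 p (dp t)) -> (forall t, is_derive (t : R) 1 q (dq t)) ->
  continuous dp -> continuous dq ->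
  C1 (fun x => p x.1 * q x.2) /\
  forall j, pder j (fun x => p x.1 * q x.2)
    = (fun x => if j == ord0 then dp x.1 * q x.2 else p x.1 * dq x.2).
Proof.
move=> pD qD cdp cdq.
have cp : continuous p by move=> t; apply/differentiable_continuous/derivable1_diffP; case: (pD t).
have cq : continuous q by move=> t; apply/differentiable_continuous/derivable1_diffP; case: (qD t).
have comp1 (r : R -> R) : continuous r -> continuous (fun x : R * R => r x.1).
  by move=> cr x; apply: (@continuous_comp _ _ _ fst r); [exact: cvg_fst|exact: cr].
have comp2 (r : R -> R) : continuous r -> continuous (fun x : R * R => r x.2).
  by move=> cr x; apply: (@continuous_comp _ _ _ snd r); [exact: cvg_snd|exact: cr].
apply: C1I => [j x|j].
  have [->|->] := ord2P j.
    apply/is_derive_horizontal => /=.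
    have -> : (fun t => p t * q x.2) = (q x.2 \*: p).
      by apply/funext => t /=; rewrite mulrC.
    by rewrite mulrC; exact: is_deriveZ.
  apply/is_derive_vertical => /=.
  exact: (is_deriveZ (p x.1) (qD x.2)).
by case: (j == ord0) => x; apply: cvgM;
  [exact: comp1|exact: comp2|exact: comp1|exact: comp2].
Qed.

End Calculus.

(** * Test functions *)

Section TestFunctions.
Context (R : realType).
Local Notation leb := (@lebesgue_measure R).
Local Notation mu := (@mu2 R).
Implicit Types (A : set (plane R)) (f g phi : R * R -> R).

Local Notation supp phi := (closure [set x | phi x != 0]).

Lemma continuous_horizontal f (s : R) : continuous f ->
  continuous (fun t : R => f (t, s)).
Proof.
move=> cf t; have /cvg_comp : (fun t : R => (t, s)) @ t --> (t, s).
  by apply: (@cvg_pair _ _ _ (nbhs t) (nbhs t) (nbhs s)); [exact: cvg_id|exact: cvg_cst].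
by apply; exact: cf.
Qed.

Lemma continuous_vertical f (s : R) : continuous f ->
  continuous (fun t : R => f (s, t)).
Proof.
move=> cf t; have /cvg_comp : (fun t : R => (s, t)) @ t --> (s, t).
  by apply: (@cvg_pair _ _ _ (nbhs t) (nbhs s) (nbhs t)); [exact: cvg_cst|exact: cvg_id].
by apply; exact: cf.
Qed.

Lemma not_supp phi x : ~ supp phi x -> \forall y \near x, phi y = 0.
Proof.
move=> nx; apply: contrapT => H; apply: nx => U xU.
apply: contrapT => e; apply: H; apply: filterS xU => y Uy.
by apply: contrapT => /eqP py; apply: e; exists y.
Qed.

Lemma supp0 phi x : ~ supp phi x -> phi x = 0.
Proof. by move=> /not_supp/nbhs_singleton. Qed.

Lemma pder_supp0 phi j x : ~ supp phi x -> pder j phi x = 0.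
Proof.
move=> /not_supp nx; rewrite /pder (near_eq_derive (g := cst 0)) ?derive_cst//.
Qed.

Lemma Cc1_lin A c f g : Cc1 A f -> Cc1 A g -> Cc1 A (lin c f g).
Proof.
move=> [Cf Kf fA] [Cg Kg gA].
have sub : supp (lin c f g) `<=` supp f `|` supp g.
  rewrite -closureU; apply: closureS => x /=; rewrite /lin.
  have [f0|] := eqVneq (f x) 0; last by left.
  have [g0|] := eqVneq (g x) 0; last by right.
  by rewrite f0 g0 mulr0 addr0 eqxx.
split; first exact: (C1_lin c Cf Cg).1.
- apply: subclosed_compact sub; first exact: closed_closure.
  exact: compactU.
- by move=> x /sub [/fA|/gA].
Qed.

Lemma Cc1_mull A f phi : C1 f -> Cc1 A phi -> Cc1 A (fun x => f x * phi x).
Proof.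
move=> Cf [Cp Kp pA].
have sub : supp (fun x => f x * phi x) `<=` supp phi.
  by apply: closureS => x /=; rewrite mulf_eq0 negb_or => /andP[].
split; first exact: (C1_mul Cf Cp).1.
- by apply: subclosed_compact Kp sub; exact: closed_closure.
- exact: subset_trans sub pA.
Qed.

Lemma integral_derive_compact (F dF : R -> R) (M : R) : 0 < M ->
  (forall t : R, is_derive t 1 F (dF t)) -> continuous dF ->
  (forall t, ~~ (- M <= t <= M) -> dF t = 0) -> F (- M) = 0 -> F M = 0 ->
  (\int[leb]_t (dF t)%:E = 0)%E.
Proof.
move=> M0 FD cdF out F1 F2.
have cF : continuous F.
  by move=> t; apply/differentiable_continuous/derivable1_diffP; case: (FD t).
have := @continuous_FTC2 R dF F (- M) M _ _ _ _.
rewrite F1 F2 subee// => <-.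
- rewrite [RHS]integral_mkcond; apply: eq_integral => t _.
  rewrite patchE; case: ifPn => //; rewrite notin_setE/= in_itv/= => /negP/out ->.
  by [].
- by rewrite gtrN.
- exact: continuous_subspaceT.
- split=> [t _||]; first by case: (FD t).
    by apply: cvg_at_right_filter; exact: cF.
  by apply: cvg_at_left_filter; exact: cF.
- by move=> t _; rewrite derive1E; apply: derive_val.
Qed.

Lemma Cc1_bddm A phi : measurable A -> Cc1 A phi -> bddm A phi.
Proof.
move=> mA [Cp Kp pA]; split.
  by apply: continuous_measurable2 => //; exact: C1_continuous.
have /bounded_box[M [_ KM]] := compact_bounded Kp.
have [N N0 pN] := cont_bounded_box (-M, -M) (M, M) (C1_continuous Cp).
exists N => x _; case: (pselect (supp phi x)) => [/KM/pN//|/supp0 ->].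
by rewrite normr0.
Qed.

Lemma Cc1_pder_bddm A phi j : measurable A -> Cc1 A phi -> bddm A (pder j phi).
Proof.
move=> mA [Cp Kp pA]; split.
  by apply: continuous_measurable2 => //; exact: (Cp j).2.
have /bounded_box[M [_ KM]] := compact_bounded Kp.
have [N N0 pN] := cont_bounded_box (-M, -M) (M, M) (Cp j).2.
exists N => x _; case: (pselect (supp phi x)) => [/KM/pN//|/pder_supp0 ->].
by rewrite normr0.
Qed.

(** The divergence theorem for compactly supported fields: Fubini and the
    fundamental theorem of calculus on every line. *)
Lemma integral_pder_Cc1 A phi j : Cc1 A phi ->
  \int[mu]_(x in A) (pder j phi x) = 0.
Proof.
move=> [Cp Kp pA]; have pD := C1_is_derive Cp.
have -> : \int[mu]_(x in A) pder j phi x = \int[mu]_x pder j phi x.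
  rewrite Rintegral_mkcond; apply: eq_Rintegral => x _; rewrite patchE.
  case: ifPn => //; rewrite notin_setE => nA; rewrite pder_supp0// => /pA.
  exact: nA.
have /bounded_box[M [M0 KM]] := compact_bounded Kp.
have M1 : 0 < M + 1 by rewrite ltr_wpDl.
have outK x : ~ box (-M, -M) (M, M) x -> ~ supp phi x by move=> + /KM.
have cd : continuous (pder j phi) := (Cp j).2.
have Ib : intg mu (box (-M,-M) (M,M)) (pder j phi).
  apply: bddm_intg; first exact: measurable_box.
    exact/compact_bounded/compact_box.
  apply: bddm_cont => //; first exact: measurable_box.
  exact/compact_bounded/compact_box.
have IT : mu.-integrable setT (EFin \o pder j phi).
  have := integrable_restrict mu (measurable_box (-M,-M) (M,M)) measurableT
    (EFin \o pder j phi).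
  rewrite setTI => /iffLR/(_ Ib); apply: eq_integrable => // x _.
  rewrite patchE; case: ifPn => //=; rewrite notin_setE => /outK/pder_supp0 ->.
  by [].
have edge s : ~~ (- M <= s <= M) -> forall t, phi (s, t) = 0 /\ phi (t, s) = 0.
  move=> /negP sM t; split; apply/supp0/outK => /boxP/=; tauto.
have dedge s : ~~ (- M <= s <= M) ->
    forall t, pder j phi (s, t) = 0 /\ pder j phi (t, s) = 0.
  move=> /negP sM t; split; apply/pder_supp0/outK => /boxP/=; tauto.
have Mout : ~~ (- M <= M + 1 <= M) by lra.
have MNout : ~~ (- M <= - (M + 1) <= M) by lra.
have sub t : ~~ (- (M + 1) <= t <= M + 1) -> ~~ (- M <= t <= M) by lra.
have c1 (s : R) : continuous (fun t : R => pder j phi (t, s)).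
  exact: continuous_horizontal.
have c2 (s : R) : continuous (fun t : R => pder j phi (s, t)).
  exact: continuous_vertical.
rewrite /Rintegral; suff -> : (\int[mu]_x (pder j phi x)%:E = 0)%E by [].
have [E|E] := ord2P j.
- rewrite -(integral21_prod_meas1 IT) integral0_eq// => t _.
  apply: (integral_derive_compact (F := fun s => phi (s, t)) M1) => //.
  + by move=> s; apply/(is_derive_horizontal phi (s, t)); rewrite E.
  + by move=> s /sub/dedge/(_ t)[].
  + by case: (edge _ MNout t).
  + by case: (edge _ Mout t).
- rewrite -(integral12_prod_meas1 IT) integral0_eq// => t _.
  apply: (integral_derive_compact (F := fun s => phi (t, s)) M1) => //.
  + by move=> s; apply/(is_derive_vertical phi (t, s)); rewrite E.
  + by move=> s /sub/dedge/(_ t)[].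
  + by case: (edge _ MNout t).
  + by case: (edge _ Mout t).
Qed.

Lemma integration_by_parts A f phi j : measurable A -> bounded_set A ->
  C1 f -> Cc1 A phi ->
  \int[mu]_(x in A) (f x * pder j phi x)
  = - \int[mu]_(x in A) (pder j f x * phi x).
Proof.
move=> mA bA Cf cp.
have bf : bddm A f by apply: bddm_cont => //; exact: C1_continuous.
have bdf : bddm A (pder j f) by apply: bddm_cont => //; exact: (Cf j).2.
have bp := Cc1_bddm mA cp; have bdp := Cc1_pder_bddm j mA cp.
have := integral_pder_Cc1 j (Cc1_mull Cf cp).
have [Cp _ _] := cp; rewrite (C1_mul Cf Cp).2.
rewrite RintegralD//; try by apply: bddm_intg => //; exact: bddmM.
move=> /eqP; rewrite addr_eq0 => /eqP ->.
by under eq_Rintegral do rewrite mulrC.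
Qed.

End TestFunctions.

(** * The fundamental lemma of the calculus of variations *)

Section PiLambda.
Context d (X : measurableType d) (R : realType).
Variable mu : {measure set X -> \bar R}.

(** An integral that vanishes over the preimages of a pi-system vanishes over
    the preimages of the generated sigma-algebra. Used with the two projections
    of the plane, and with the identity. *)
Lemma integral_preimage0 d' (Y : measurableType d') (f : X -> Y)
    (G : set (set Y)) (B : set X) (g : X -> R) :
  measurable_fun setT f -> setI_closed G -> measurable = <<s G >> ->
  measurable B -> intg mu B g -> (\int[mu]_(x in B) (g x)%:E = 0)%E ->
  (forall S, G S -> \int[mu]_(x in B `&` f @^-1` S) (g x)%:E = 0)%E ->
  forall S, measurable S -> (\int[mu]_(x in B `&` f @^-1` S) (g x)%:E = 0)%E.
Proof.
move=> mf GI GE mB Ig B0 G0.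
pose H S := measurable S /\ (\int[mu]_(x in B `&` f @^-1` S) (g x)%:E = 0)%E.
have mp S : measurable S -> measurable (B `&` f @^-1` S).
  by move=> mS; apply: measurableI => //; rewrite -[_ @^-1` _]setTI; exact: mf.
have Is S : measurable S -> mu.-integrable (B `&` f @^-1` S) (EFin \o g).
  by move=> mS; apply: integrableS Ig => //; exact: mp.
have dH : dynkin H.
  split.
  - by split => //; rewrite preimage_setT setIT.
  - move=> S [mS S0]; split; first exact: measurableC.
    have := B0; rewrite -[B in X in X = _](setUIDK B (f @^-1` S)).
    rewrite integral_setU.
    + by rewrite S0 add0e setDE.
    + exact: mp.
    + rewrite setDE preimage_setC; apply: mp; exact: measurableC.
    + by rewrite setUIDK; exact: measurable_int Ig.
    + by rewrite disj_set2E setDE setIACA setICr setI0.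
  - move=> F tF HF; split; first by apply: bigcup_measurable => k _; case: (HF k).
    rewrite preimage_bigcup setI_bigcupr integral_bigcup.
    + by apply: eseries0 => k _ _; case: (HF k).
    + apply/trivIsetP => m n _ _ mn; rewrite setIACA.
      have -> : f @^-1` F m `&` f @^-1` F n = f @^-1` (F m `&` F n) by [].
      by move/trivIsetP: tF => ->//; rewrite preimage_set0 setI0.
    + by move=> k; apply: mp; case: (HF k).
    + apply: integrableS Ig => //.
        by apply: bigcup_measurable => k _; apply: mp; case: (HF k).
      by move=> x [k _ []].
have /dynkin_lambda_system lH := dH.
move=> S mS; have : H S; last by case.
apply: (lambda_system_subset GI lH) => //; last by rewrite GE in mS.
move=> A GA; split; last exact: G0.
by rewrite GE; exact: sub_sigma_algebra.
Qed.

End PiLambda.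

Section Bump.
Context (R : realType).

(** The square of the positive part is continuously differentiable. *)
Definition pos2 (s : R) : R := Num.max s 0 ^+ 2.

Lemma is_derive_pos2 (s : R) : is_derive s 1 pos2 (2 * Num.max s 0).
Proof.
have [s0|s0|->] := ltrgtP s 0.
- rewrite mulr0; apply: (near_eq_is_derive (f := cst 0)).
  near=> t; rewrite /pos2 max_r ?expr0n//= ltW//.
  by near: t; exact: lt_nbhsl.
- have H : is_derive s 1 (fun t : R => t ^+ 2) (2 * s).
    have -> : 2 * s = s *: 1 + s *: 1 by rewrite -![_ *: _]/(_ * _); ring.
    exact: (@is_deriveM R R id id s 1 1 1 (is_derive_id s 1) (is_derive_id s 1)).
  apply: (near_eq_is_derive _ H).
  near=> t; rewrite /pos2 max_l// ltW//.
  by near: t; exact: lt_nbhsr.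
- rewrite mulr0.
  have H : (fun h : R => h^-1 *: ((pos2 \o shift 0) (h *: 1) - pos2 0)) @ 0^'
      --> (0 : R).
    apply: (@cvg_to_0_linear _ _ 1 1) => // r /andP[r0 _].
    rewrite /= /pos2 maxxx expr0n/= subr0 addr0 -[_ *: 1]/(_ * 1) mulr1.
    rewrite -[_ *: _]/(_ * _) normrM normfV normrX mul1r.
    have -> : `|Num.max r 0| = Num.max r 0.
      by rewrite ger0_norm// le_max lexx orbT.
    rewrite ler_pdivrMl// -expr2 ler_pXn2r// ?nnegrE ?le_max ?lexx ?orbT//.
    by rewrite ge_max ler_norm normr_ge0.
  by split; [apply/cvg_ex; exists 0|exact: cvg_lim].
Unshelve. all: by end_near. Qed.

Variables (a b : R).
Let w (t : R) : R := pos2 ((t - a) * (b - t)).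
Let dw (t : R) : R := 2 * Num.max ((t - a) * (b - t)) 0 * (a + b - 2 * t).

(** For [a < b], [w] is positive between [a] and [b] and zero elsewhere; hence
    these functions are supported there and increase with [n] to the indicator of
    the open interval. *)
Definition bump (n : nat) (t : R) : R := 1 - (1 + n%:R * w t)^-1.
Definition dbump (n : nat) (t : R) : R := n%:R * dw t / (1 + n%:R * w t) ^+ 2.

Let w_ge0 t : 0 <= w t. Proof. by rewrite sqr_ge0. Qed.

Let den_gt0 n t : 0 < 1 + n%:R * w t.
Proof. by rewrite ltr_wpDr// mulr_ge0. Qed.

Let is_derive_w (t : R) : is_derive t 1 w (dw t).
Proof.
have H : is_derive t 1 (fun t => (t - a) * (b - t)) (a + b - 2 * t).
  have -> : a + b - 2 * t = (t - a) *: (0 - 1) + (b - t) *: (1 - 0).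
    by rewrite -![_ *: _]/(_ * _); ring.
  have Ha := @is_deriveB R R R id (cst a) t 1 1 0 (is_derive_id t 1)
    (is_derive_cst a t 1).
  have Hb := @is_deriveB R R R (cst b) id t 1 0 1 (is_derive_cst b t 1)
    (is_derive_id t 1).
  exact: (is_deriveM Ha Hb).
exact: (is_derive1_comp (is_derive_pos2 _) H).
Qed.

Lemma is_derive_bump n (t : R) : is_derive t 1 (bump n) (dbump n t).
Proof.
have H : is_derive t 1 (fun t => 1 + n%:R * w t) (0 + n%:R *: dw t).
  have Hw := @is_deriveZ _ _ _ w n%:R t 1 (dw t) (is_derive_w t).
  exact: (@is_deriveD R R R (cst 1) (n%:R \*: w) t 1 0 _
    (is_derive_cst (1 : R) t 1) Hw).
have den0 : 1 + n%:R * w t != 0 by rewrite gt_eqF.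
have D := @is_deriveB R R R (cst 1) (fun t => (1 + n%:R * w t)^-1) t 1 0 _
  (is_derive_cst (1 : R) t 1)
  (@is_deriveV R (fun t => 1 + n%:R * w t) t _ 1 den0 H).
apply: (is_derive_eq D).
by rewrite -![_ *: _]/(_ * _) /dbump !add0r mulNr opprK mulrC.
Qed.

Let cont_poly : continuous (fun t : R => (t - a) * (b - t)).
Proof.
move=> t; apply: (@cvgM _ _ _ _ (fun t => t - a) (fun t => b - t)).
  by apply: cvgB; [exact: cvg_id|exact: cvg_cst].
by apply: cvgB; [exact: cvg_cst|exact: cvg_id].
Qed.

Let cont_w : continuous w.
Proof.
move=> t; apply/differentiable_continuous/derivable1_diffP.
by case: (is_derive_w t).
Qed.

Lemma continuous_dbump n : continuous (dbump n).
Proof.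
move=> t; apply: cvgM; last first.
  apply: cvgV; first by rewrite expf_neq0// gt_eqF.
  apply: (@continuous_comp _ _ _ (fun t => 1 + n%:R * w t) (fun s => s ^+ 2)).
    by apply: cvgD; [exact: cvg_cst|apply: cvgM; [exact: cvg_cst|exact: cont_w]].
  exact: exprn_continuous.
apply: cvgM; first exact: cvg_cst.
apply: cvgM.
  apply: cvgM; first exact: cvg_cst.
  apply: (@continuous_comp _ _ _ (fun t => (t - a) * (b - t))
            (fun s => Num.max s 0)); first exact: cont_poly.
  by apply: (@continuous_max R _ id (cst 0)); [exact: cvg_id|exact: cvg_cst].
apply: cvgB; first exact: cvg_cst.
by apply: cvgM; [exact: cvg_cst|exact: cvg_id].
Qed.

Lemma bump_01 n t : 0 <= bump n t <= 1.
Proof.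
rewrite subr_ge0 invf_le1// lerDl mulr_ge0//=.
by rewrite gerBl invr_ge0 ltW.
Qed.

Lemma bump_out n t : a < b -> ~~ (a < t < b) -> bump n t = 0.
Proof.
move=> ltab; rewrite negb_and -!leNgt => out.
have h0 : (t - a) * (b - t) <= 0 by case/orP: out => H; nra.
by rewrite /bump /w /pos2 max_r// expr0n mulr0 addr0 invr1 subrr.
Qed.

Lemma bump_cvg t : a < t < b -> bump n t @[n --> \oo] --> (1 : R).
Proof.
move=> /andP[at_ tb].
have w0 : 0 < w t.
  by rewrite exprn_gt0// lt_max mulr_gt0// subr_gt0.
rewrite -[X in _ --> X]subr0; apply: cvgB; first exact: cvg_cst.
apply/cvgrPdist_lt => e e0; near=> n.
rewrite sub0r normrN gtr0_norm ?invr_gt0// invf_plt ?posrE//.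
apply: (@lt_trans _ _ (n%:R * w t)); last by rewrite ltrDr.
rewrite -ltr_pdivrMr//.
by near: n; exact: nbhs_infty_gtr.
Unshelve. all: by end_near. Qed.

End Bump.

Section FundamentalLemma.
Context (R : realType).
Local Notation leb := (@lebesgue_measure R).
Local Notation mu := (@mu2 R).
Implicit Types (A : set (plane R)) (f g phi : R * R -> R).

Definition bump2 (a b : R * R) (n : nat) (x : R * R) : R :=
  bump a.1 b.1 n x.1 * bump a.2 b.2 n x.2.

Lemma bump2_out a b n x : a.1 < b.1 -> a.2 < b.2 -> ~ obox a b x ->
  bump2 a b n x = 0.
Proof.
move=> ab1 ab2 nx; rewrite /bump2.
have [h1|h1] := boolP (a.1 < x.1 < b.1); last by rewrite bump_out// mul0r.
have [h2|h2] := boolP (a.2 < x.2 < b.2); last by rewrite (bump_out _ ab2)// mulr0.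
by case: nx; apply/oboxP.
Qed.

Lemma bump2_01 a b n x : 0 <= bump2 a b n x <= 1.
Proof.
have /andP[h1 h2] := bump_01 a.1 b.1 n x.1.
have /andP[h3 h4] := bump_01 a.2 b.2 n x.2.
by rewrite /bump2 mulr_ge0//= mulr_ile1.
Qed.

Lemma bump2_Cc1 A a b n : a.1 < b.1 -> a.2 < b.2 -> box a b `<=` A ->
  Cc1 A (bump2 a b n).
Proof.
move=> ab1 ab2 abA.
have cb : closed (box a b).
  by apply: compact_closed; [exact: norm_hausdorff|exact: compact_box].
have sub : closure [set x | bump2 a b n x != 0] `<=` box a b.
  rewrite [X in _ `<=` X](closure_id _).1//.
  apply: closureS => x /=; apply: contra_neqP => nx.
  by apply: bump2_out => // /obox_sub.
split.
- exact: (C1_tensor (is_derive_bump a.1 b.1 n) (is_derive_bump a.2 b.2 n)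
    (continuous_dbump (n:=n)) (continuous_dbump (n:=n))).1.
- by apply: subclosed_compact sub; [exact: closed_closure|exact: compact_box].
- exact: subset_trans sub abA.
Qed.

Lemma compact_measurable2 (K : set (plane R)) : compact K -> pmeasurable R K.
Proof.
move=> cK; rewrite -(setCK K); apply: measurableC; apply: open_measurable2.
by apply: closed_openC; apply: compact_closed cK; exact: norm_hausdorff.
Qed.

Lemma L1loc_intg A g (K : set (plane R)) : L1loc A g -> compact K -> K `<=` A ->
  intg mu K g.
Proof.
move=> lg cK KA; have := lg _ cK KA; have mK := compact_measurable2 cK.
move=> /Lfun1_integrable; rewrite -restrict_EFin => H.
have := integrable_restrict mu mK measurableT (EFin \o g).
by rewrite setTI => /iffRL; apply.
Qed.

(** The products of two bumps increase to the indicator of the open box. *)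
Lemma integral_obox0 A g a b : measurable A -> L1loc A g ->
  (forall phi, Cc1 A phi -> \int[mu]_(x in A) (g x * phi x) = 0) ->
  box a b `<=` A -> (\int[mu]_(x in obox a b) (g x)%:E = 0)%E.
Proof.
move=> mA lg g0 abA.
have [ab1|ba1] := ltP a.1 b.1; last first.
  rewrite (_ : obox a b = set0) ?integral_set0//.
  by apply/seteqP; split=> // x /oboxP[/andP[h1 h2] _]; lra.
have [ab2|ba2] := ltP a.2 b.2; last first.
  rewrite (_ : obox a b = set0) ?integral_set0//.
  by apply/seteqP; split=> // x /oboxP[_ /andP[h1 h2]]; lra.
have mo : measurable (obox a b) := measurable_obox a b.
have mb : measurable (box a b) := measurable_box a b.
have oA : obox a b `<=` A := subset_trans (@obox_sub R a b) abA.
have Ig : intg mu (obox a b) g.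
  apply: integrableS (L1loc_intg lg (@compact_box R a b) abA) => //; exact: obox_sub.
pose f_ n x := (g x * bump2 a b n x)%:E.
have mf n : measurable_fun (obox a b) (f_ n).
  apply/measurable_EFinP; apply: measurable_funM; first exact: intg_meas Ig.
  by case: (bddm_sub mA oA (Cc1_bddm mA (bump2_Cc1 n ab1 ab2 abA))).
have fcvg : {ae mu, forall x, obox a b x -> f_ n x @[n --> \oo] --> (g x)%:E}.
  apply: aeW => x /oboxP[x1 x2]; apply: cvg_EFin; first exact: nearW.
  rewrite -[X in _ --> X]mulr1; apply: cvgM; first exact: cvg_cst.
  by rewrite -[X in _ --> X]mulr1; apply: cvgM; exact: bump_cvg.
have domx x n : (`|f_ n x| <= `|(g x)%:E|)%E.
  rewrite lee_fin normrM ler_piMr//.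
  by have /andP[h0 h1] := bump2_01 a b n x; rewrite ger0_norm.
have dom : {ae mu, forall x n, obox a b x -> (`|f_ n x| <= `|(g x)%:E|)%E}.
  by apply: aeW => x n _; exact: domx.
have [_ _ H] := @dominated_convergence _ _ _ mu _ mo f_ (EFin \o g)
  (abse \o (EFin \o g)) mf ((measurable_EFinP _ _).2 (intg_meas Ig)) fcvg
  (integrable_abse Ig) dom.
have z n : (\int[mu]_(x in obox a b) f_ n x = 0)%E.
  have Ifn : mu.-integrable (obox a b) (f_ n).
    apply: le_integrable (integrable_abse Ig); [by []|exact: mf|].
    by move=> x _; apply: le_trans (domx x n) _; rewrite /= normr_id.
  have -> : (\int[mu]_(x in obox a b) f_ n x
      = (\int[mu]_(x in obox a b) (g x * bump2 a b n x))%:E)%E.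
    by rewrite /Rintegral fineK//; exact: integrable_fin_num.
  congr EFin; rewrite -(g0 _ (bump2_Cc1 n ab1 ab2 abA)) Rintegral_mkcond.
  rewrite [RHS]Rintegral_mkcond; apply: eq_Rintegral => x _; rewrite !patchE.
  case: ifPn => xo; first by rewrite (mem_set (oA _ (set_mem xo))).
  case: ifP => // _; rewrite bump2_out ?mulr0//.
  by move: xo; rewrite notin_setE.
have : (fun n => \int[mu]_(x in obox a b) f_ n x)%E = cst 0%E.
  by apply/funext => n; exact: z.
move=> zE; rewrite zE in H; rewrite -[LHS](cvg_lim _ H); last exact: ereal_hausdorff.
by rewrite lim_cst//; exact: ereal_hausdorff.
Qed.

(** The integral of [g] vanishes over all open rectangles, then over all
    measurable ones, one factor at a time, and finally over all measurable
    subsets of the box. *)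
Lemma fundamental_lemma_obox A g a b : measurable A -> L1loc A g ->
  (forall phi, Cc1 A phi -> \int[mu]_(x in A) (g x * phi x) = 0) ->
  box a b `<=` A -> ae_eq mu (obox a b) g (cst 0).
Proof.
move=> mA lg g0 abA.
have mo : measurable (obox a b) := measurable_obox a b.
have Ig : intg mu (obox a b) g.
  by apply: integrableS (L1loc_intg lg (@compact_box R a b) abA) => //;
    [exact: measurable_box|exact: obox_sub].
pose G := @RGenOpens.G R.
have GI : setI_closed G.
  move=> _ _ [s [t ->]] [s' [t' ->]]; exists (Num.max s s'), (Num.min t t').
  apply/seteqP; split=> x; rewrite /= !in_itv/= gt_max lt_min.
    by move=> [/andP[-> ->] /andP[-> ->]].
  by move=> /andP[/andP[-> ->] /andP[-> ->]].
have GE : @measurable _ (measurableTypeR R) = <<s G >> := @RGenOpens.measurableE R.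
have rect (s t s' t' : R) : (\int[mu]_(x in obox a b `&` fst @^-1` `]s, t[ `&`
    snd @^-1` `]s', t'[) (g x)%:E = 0)%E.
  have -> : obox a b `&` fst @^-1` `]s, t[ `&` snd @^-1` `]s', t'[
      = obox (Num.max a.1 s, Num.max a.2 s') (Num.min b.1 t, Num.min b.2 t').
    apply/seteqP; split=> x; rewrite /obox /= !in_itv/= !gt_max !lt_min.
      by move=> [[[/andP[-> ->] /andP[-> ->]] /andP[-> ->]] /andP[-> ->]].
    by move=> [/andP[/andP[-> ->] /andP[-> ->]] /andP[/andP[-> ->] /andP[-> ->]]].
  apply: (integral_obox0 mA lg g0) => x /boxP/=.
  rewrite !ge_max !le_min => -[/andP[/andP[x1 _] /andP[x2 _]]].
  by move=> /andP[/andP[x3 _] /andP[x4 _]]; apply/abA/boxP; rewrite x1 x2 x3 x4.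
have o0 := integral_obox0 mA lg g0 abA.
have mfst S : @measurable _ (measurableTypeR R) S -> pmeasurable R (fst @^-1` S).
  by move=> mS; rewrite -[_ @^-1` _]setTI; exact: measurable_fst.
have msnd S : @measurable _ (measurableTypeR R) S -> pmeasurable R (snd @^-1` S).
  by move=> mS; rewrite -[_ @^-1` _]setTI; exact: measurable_snd.
have mI (s t : R) : @measurable _ (measurableTypeR R) `]s, t[%classic by [].
have IS S : pmeasurable R S -> intg mu (obox a b `&` S) g.
  by move=> mS; apply: integrableS Ig => //; exact: measurableI.
have step1 S : @measurable _ (measurableTypeR R) S ->
    (\int[mu]_(x in obox a b `&` fst @^-1` S) (g x)%:E = 0)%E.
  apply: (@integral_preimage0 _ (plane R) R mu _ (measurableTypeR R) fst G _ g
    (@measurable_fst _ _ _ _) GI GE) => //.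
  move=> _ [s [t ->]].
  have -> : obox a b `&` fst @^-1` `]s, t[
    = obox a b `&` fst @^-1` `]s, t[ `&` snd @^-1` `]a.2, b.2[.
    by apply/seteqP; split=> x [] => [[? ?] ?|[]].
  exact: rect.
have step2 S (s t : R) : @measurable _ (measurableTypeR R) S ->
    (\int[mu]_(x in obox a b `&` snd @^-1` `]s, t[ `&` fst @^-1` S) (g x)%:E = 0)%E.
  apply: (@integral_preimage0 _ (plane R) R mu _ (measurableTypeR R) fst G _ g
    (@measurable_fst _ _ _ _) GI GE) => //.
  - by apply: measurableI => //; exact: msnd.
  - by apply: IS; exact: msnd.
  - have -> : obox a b `&` snd @^-1` `]s, t[
    = obox a b `&` fst @^-1` `]a.1, b.1[ `&` snd @^-1` `]s, t[.
      by apply/seteqP; split=> x [] => [[? ?] ?|[]].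
    exact: rect.
  - by move=> _ [s' [t' ->]]; rewrite setIAC; exact: rect.
have step3 S S' : @measurable _ (measurableTypeR R) S ->
    @measurable _ (measurableTypeR R) S' ->
    (\int[mu]_(x in obox a b `&` (S `*` S')) (g x)%:E = 0)%E.
  move=> mS mS'.
  have -> : obox a b `&` (S `*` S') = obox a b `&` fst @^-1` S `&` snd @^-1` S'.
    by rewrite -setIA.
  apply: (@integral_preimage0 _ (plane R) R mu _ (measurableTypeR R) snd G _ g
    (@measurable_snd _ _ _ _) GI GE) mS' => //.
  - by apply: measurableI => //; exact: mfst.
  - by apply: IS; exact: mfst.
  - exact: step1.
  - by move=> _ [s' [t' ->]]; rewrite setIAC; exact: step2.
have all0 S : pmeasurable R S ->
    (\int[mu]_(x in obox a b `&` id @^-1` S) (g x)%:E = 0)%E.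
  apply: (@integral_preimage0 _ (plane R) R mu _ (plane R) id
    [set S1 `*` S2 | S1 in measurable & S2 in measurable]) => //.
  - move=> _ _ [A1 mA1 [B1 mB1 <-]] [A2 mA2 [B2 mB2 <-]].
    exists (A1 `&` A2); first exact: measurableI.
    exists (B1 `&` B2); first exact: measurableI.
    by rewrite setXI.
  - exact: measurable_prod_measurableType.
  - by move=> _ [S1 mS1 [S2 mS2 <-]]; exact: step3.
have Ee : ae_eq mu (obox a b) (EFin \o g) (cst 0%E).
  apply: integral_ae_eq => //.
  move=> E Eo mE; rewrite integral0 -(all0 E mE) preimage_id.
  by rewrite setIidr.
by apply: filterS Ee => x H /H [].
Qed.

Lemma fundamental_lemma A g : open A -> L1loc A g ->
  (forall phi, Cc1 A phi -> \int[mu]_(x in A) (g x * phi x) = 0) ->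
  ae_eq mu A g (cst 0).
Proof.
move=> oA lg g0; have mA := open_measurable2 oA.
pose P n x := forall i, unpickle n = Some i -> @rsquare R i `<=` A ->
  @osquare R i x -> g x = 0.
have /ae_foralln H : forall n, \forall x \ae mu, P n x.
  move=> n; rewrite /P; case: (unpickle n) => [i|]; last first.
    by apply: aeW => x i.
  case: (pselect (@rsquare R i `<=` A)) => iA; last first.
    by apply: aeW => x _ [<-].
  apply: filterS (fundamental_lemma_obox mA lg g0 iA) => x Hx _ [<-] _.
  exact: Hx.
apply: filterS H => x Hx Ax.
move: Ax; rewrite {1}(open_rsquares oA) => -[i _].
case: ifPn => // /asboolP iA ix.
by apply: (Hx (pickle i) i) => //; rewrite pickleK.
Qed.

End FundamentalLemma.

(** * Weak derivatives *)

Section WeakDerivatives.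
Context (R : realType).
Local Notation mu := (@mu2 R).
Variable A : set (plane R).
Hypotheses (oA : open A) (bA : bounded_set A).
Implicit Types (f g phi : R * R -> R).

Let mA : pmeasurable R A := open_measurable2 oA.

(** Local integrability gives measurability on compact subsets only; countably
    many squares cover [A]. *)
Lemma L1loc_meas g : L1loc A g -> pmeasurable_fun R A g.
Proof.
move=> lg; rewrite (open_rsquares oA).
pose F n : set (plane R) := if unpickle n is Some i then
  (if `[< @rsquare R i `<=` A >] then @osquare R i else set0) else set0.
have -> : \bigcup_(i in [set: rat * rat * nat])
   (if `[< @rsquare R i `<=` A >] then @osquare R i else set0) = \bigcup_n F n.
  apply/seteqP; split=> [x [i _ ix]|x [n _]].
    by exists (pickle i); [exact: I|rewrite /F pickleK].
  by rewrite /F; case: unpickle => // i ix; exists i.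
have mF n : pmeasurable R (F n).
  rewrite /F; case: unpickle => // i; case: ifP => // _.
  exact: measurable_obox.
apply/measurable_fun_bigcup => // n.
rewrite /F; case: unpickle => [i|]; last exact: measurable_fun_set0.
case: ifPn => [/asboolP iA|_]; last exact: measurable_fun_set0.
have := intg_meas (L1loc_intg lg (@compact_box R _ _) iA).
by apply: measurable_funS; [exact: measurable_box|exact: osquare_sub].
Qed.

Lemma L1loc_mul g phi : L1loc A g -> Cc1 A phi ->
  intg mu A (fun x => g x * phi x).
Proof.
move=> lg cp; have [Cp Kp pA] := cp.
set K := closure _ in Kp pA.
have mK := compact_measurable2 Kp; have Ig := L1loc_intg lg Kp pA.
have [mp [M pM]] := bddm_sub mA pA (Cc1_bddm mA cp).
have IK : intg mu K (fun x => g x * phi x).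
  have H : intg mu K (lin M (fun x => `|g x|) (cst 0)).
    by apply: intg_lin => //; [exact: integrable_norm|exact: integrable0].
  apply: (intg_le mK _ _ H).
    by apply: measurable_funM => //; exact: intg_meas Ig.
  by move=> x Kx; rewrite /lin addr0 normrM mulrC ler_wpM2r//; exact: pM.
have := integrable_restrict mu mK mA (EFin \o (fun x => g x * phi x)).
rewrite (setIidr pA) => /iffLR/(_ IK).
apply: eq_integrable => // x _; rewrite patchE; case: ifPn => //=.
by rewrite notin_setE => /supp0 ->; rewrite mulr0.
Qed.

Lemma L1loc_lin c f g : L1loc A f -> L1loc A g -> L1loc A (lin c f g).
Proof.
move=> lf lg K cK KA; have mK := compact_measurable2 cK.
have H := intg_lin c mK (L1loc_intg lf cK KA) (L1loc_intg lg cK KA).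
apply/Lfun1_integrable; rewrite -restrict_EFin.
have := integrable_restrict mu mK measurableT (EFin \o lin c f g).
by rewrite setTI => /iffLR; apply.
Qed.

Lemma sqint_L1loc f : sqint mu A f -> L1loc A f.
Proof.
move=> sf K cK KA; have mK := compact_measurable2 cK.
have If : intg mu K f.
  by apply: integrableS (sqint_intg mA bA sf).
apply/Lfun1_integrable; rewrite -restrict_EFin.
have := integrable_restrict mu mK measurableT (EFin \o f).
by rewrite setTI => /iffLR; apply.
Qed.

(** The difference of two weak derivatives annihilates all test functions. *)
Lemma is_wpartial_unique j f g h : is_wpartial A j f g ->
  is_wpartial A j f h -> ae_eq mu A g h.
Proof.
move=> [lg Hg] [lh Hh].
have l0 : L1loc A (lin (-1) h g) by exact: L1loc_lin.
have : ae_eq mu A (lin (-1) h g) (cst 0).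
  apply: fundamental_lemma => // phi cp.
  have -> : \int[mu]_(x in A) (lin (-1) h g x * phi x)
      = -1 * (\int[mu]_(x in A) (h x * phi x)) + \int[mu]_(x in A) (g x * phi x).
    rewrite -Rint_lin//; [|exact: L1loc_mul|exact: L1loc_mul].
    by apply: eq_Rintegral => x _; rewrite /lin mulrDl mulrA.
  have := Hg _ cp; rewrite Hh// => /oppr_inj ->.
  by rewrite mulN1r addNr.
by apply: filterS => x H /H; rewrite /lin /= => /eqP; rewrite mulN1r addrC subr_eq0 => /eqP.
Qed.

Lemma H1_sqint f : H1 A f -> sqint mu A f.
Proof. by case=> /(Lp2P _ mA). Qed.

Lemma H1_wpartial f j : H1 A f -> is_wpartial A j f (wpartial A j f).
Proof.
by case=> _ /(_ j)[g fg _]; apply: (@xgetPex _ (cst 0) [set g | is_wpartial A j f g]);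
  exists g.
Qed.

Lemma wpartial_ae f g j : H1 A f -> is_wpartial A j f g ->
  ae_eq mu A (wpartial A j f) g.
Proof. by move=> Hf; apply: is_wpartial_unique; exact: H1_wpartial. Qed.

Lemma wpartial_meas f j : H1 A f -> pmeasurable_fun R A (wpartial A j f).
Proof. by move=> /(H1_wpartial j)[] /L1loc_meas. Qed.

Lemma wpartial_sqint f j : H1 A f -> sqint mu A (wpartial A j f).
Proof.
move=> Hf; case: (Hf) => _ /(_ j)[g fg] /(Lp2P _ mA) sg.
apply: (sqint_ae mA _ _ sg); first exact: wpartial_meas.
exact: wpartial_ae.
Qed.

Lemma is_wpartial_lin j c f f' g g' : sqint mu A f -> sqint mu A f' ->
  is_wpartial A j f g -> is_wpartial A j f' g' ->
  is_wpartial A j (lin c f f') (lin c g g').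
Proof.
move=> sf sf' [lg Hg] [lg' Hg']; split; first exact: L1loc_lin.
move=> phi cp; have bp := Cc1_pder_bddm j mA cp.
under eq_Rintegral do rewrite /lin mulrDl -mulrA.
under [in RHS]eq_Rintegral do rewrite /lin mulrDl -mulrA.
rewrite !Rint_lin//; try exact: L1loc_mul; try exact: sqint_bddmM.
by rewrite Hg// Hg'// opprD mulrN.
Qed.

Lemma H1_lin c f g : H1 A f -> H1 A g -> H1 A (lin c f g).
Proof.
move=> Hf Hg; have [sf sg] := (H1_sqint Hf, H1_sqint Hg).
split=> [|j]; first by apply/(Lp2P _ mA); exact: sqint_lin.
exists (lin c (wpartial A j f) (wpartial A j g)).
  by apply: is_wpartial_lin => //; exact: H1_wpartial.
by apply/(Lp2P _ mA); apply: sqint_lin => //; exact: wpartial_sqint.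
Qed.

Lemma wpartial_lin c f g j : H1 A f -> H1 A g ->
  ae_eq mu A (wpartial A j (lin c f g)) (lin c (wpartial A j f) (wpartial A j g)).
Proof.
move=> Hf Hg; apply: wpartial_ae; first exact: H1_lin.
by apply: is_wpartial_lin; [exact: H1_sqint|exact: H1_sqint|
  exact: H1_wpartial|exact: H1_wpartial].
Qed.

Lemma wpartial_congr f g j : H1 A f -> H1 A g -> ae_eq mu A f g ->
  ae_eq mu A (wpartial A j f) (wpartial A j g).
Proof.
move=> Hf Hg fg; apply: wpartial_ae => //.
have [lg Dg] := H1_wpartial j Hg; split=> // phi cp; rewrite -Dg//.
have bp := Cc1_pder_bddm j mA cp.
apply: Rint_ae => //.
- exact: intg_meas (sqint_bddmM mA bA (H1_sqint Hf) bp).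
- exact: intg_meas (sqint_bddmM mA bA (H1_sqint Hg) bp).
- by apply: filterS fg => x fg Ax; rewrite fg.
Qed.

Lemma C1_is_wpartial f j : C1 f -> is_wpartial A j f (pder j f).
Proof.
move=> Cf; split; last by move=> phi cp; exact: integration_by_parts.
apply: sqint_L1loc; apply: bddm_sqint => //; apply: bddm_cont => //.
exact: (Cf j).2.
Qed.

Lemma C1_H1 f : C1 f -> H1 A f.
Proof.
move=> Cf; split=> [|j].
  apply/(Lp2P _ mA); apply: bddm_sqint => //; apply: bddm_cont => //.
  exact: C1_continuous.
exists (pder j f); first exact: C1_is_wpartial.
apply/(Lp2P _ mA); apply: bddm_sqint => //; apply: bddm_cont => //.
exact: (Cf j).2.
Qed.

Lemma C1_wpartial f j : C1 f -> ae_eq mu A (wpartial A j f) (pder j f).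
Proof. by move=> Cf; apply: wpartial_ae; [exact: C1_H1|exact: C1_is_wpartial]. Qed.

End WeakDerivatives.

(** * Polynomials *)

Section Polynomials.
Context (R : realType).
Implicit Types (p q : R * R -> R) (n m : int).

Definition mono (i j : nat) (x : R * R) : R := x.1 ^+ i * x.2 ^+ j.

Lemma lin_closed_sum (Q : (R * R -> R) -> Prop) (I : eqType) (r : seq I)
    (P : pred I) (F : I -> R * R -> R) : Q (cst 0) ->
  (forall c p q, Q p -> Q q -> Q (lin c p q)) ->
  (forall i, i \in r -> P i -> Q (F i)) -> Q (fun x => \sum_(i <- r | P i) F i x).
Proof.
move=> Q0 QL; elim: r => [|i r IH] QF.
  by under [fun x => _]funext => x do rewrite big_nil.
have IHr : Q (fun x => \sum_(i <- r | P i) F i x).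
  by apply: IH => j jr; apply: QF; rewrite inE jr orbT.
under [fun x => _]funext => x do rewrite big_cons.
have [Pi|//] := boolP (P i).
have -> : (fun x => F i x + \sum_(j <- r | P j) F j x)
    = lin 1 (F i) (fun x => \sum_(j <- r | P j) F j x).
  by apply/funext => x; rewrite /lin mul1r.
by apply: QL => //; apply: QF => //; rewrite inE eqxx.
Qed.

(** The induction principle through which all properties of [Pn] are proved. *)
Lemma Pn_ind n (Q : (R * R -> R) -> Prop) : Q (cst 0) ->
  (forall c p q, Q p -> Q q -> Q (lin c p q)) ->
  (forall i j, (i + j)%:Z <= n -> Q (mono i j)) -> forall p, Pn n p -> Q p.
Proof.
move=> Q0 QL Qm p [c ->].
apply: lin_closed_sum => // i _ _; apply: lin_closed_sum => // j _ /andP[_ ijn].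
rewrite (_ : (fun x => _) = lin (c i j) (mono i j) (cst 0)).
  by apply: QL => //; exact: Qm.
by apply/funext => x; rewrite /lin addr0.
Qed.

Lemma Pn0 n : Pn n (cst 0 : R * R -> R).
Proof.
exists (fun _ _ => 0); apply/funext => x.
by rewrite big1// => i _; rewrite big1// => j _; rewrite mul0r.
Qed.

Lemma polyspan_lin n m c p q : polyspan n m p -> polyspan n m q ->
  polyspan n m (lin c p q).
Proof.
move=> [a ->] [b ->]; exists (fun i j => c * a i j + b i j).
apply/funext => x; rewrite /lin mulr_sumr -big_split/=; apply: eq_bigr => i _.
rewrite mulr_sumr -big_split/=; apply: eq_bigr => j _.
by rewrite mulrDl !mulrA.
Qed.

Lemma Pn_lin n c p q : Pn n p -> Pn n q -> Pn n (lin c p q).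
Proof. exact: polyspan_lin. Qed.

Lemma Pn_mono n i j : (i + j)%:Z <= n -> Pn n (mono i j).
Proof.
move=> ijn; have iN : (i < `|n|.+1)%N by lia.
have jN : (j < `|n|.+1)%N by lia.
exists (fun i' j' => ((i' == i) && (j' == j))%:R); apply/funext => x.
rewrite (bigD1 (Ordinal iN))//= (bigD1 (Ordinal jN))/=; last by lia.
rewrite !eqxx mul1r big1 => [|j' /andP[_ nj]].
  rewrite addr0 [X in _ + X]big1 ?addr0// => i' ni.
  rewrite big1// => j' _; rewrite (_ : (i' == i :> nat) = false) ?mul0r//.
  by apply/negbTE.
by rewrite (_ : (j' == j :> nat) = false) ?andbF ?mul0r//; exact/negbTE.
Qed.

Lemma Pn_sub n m p : n <= m -> Pn n p -> Pn m p.
Proof.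
move=> nm; apply: Pn_ind; [exact: Pn0|exact: Pn_lin|].
by move=> i j ij; apply: Pn_mono; exact: le_trans nm.
Qed.

Lemma C1_mono i j : C1 (mono i j) /\
  pder ord0 (mono i j) = lin i%:R (mono i.-1 j) (cst 0) /\
  pder ord_max (mono i j) = lin j%:R (mono i j.-1) (cst 0).
Proof.
have dX k (t : R) : is_derive t 1 (fun s : R => s ^+ k) (k%:R * t ^+ k.-1).
  have -> : (fun s : R => s ^+ k) = (id : R -> R) ^+ k.
    by elim: k => [|k IH]; apply/funext => s //; rewrite !exprS {1}/GRing.mul /= -IH.
  have H := @is_deriveX R R id k t 1 1 (is_derive_id t 1).
  by apply: (is_derive_eq H); rewrite -[_ *: _]/(_ * _) mulr1.
have cX k : continuous (fun t : R => k%:R * t ^+ k.-1).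
  by move=> t; apply: cvgM; [exact: cvg_cst|exact: exprn_continuous].
have [Cm Dm] := C1_tensor (dX i) (dX j) (cX i) (cX j).
split => //; split; rewrite Dm; apply/funext => x; rewrite /= /lin /mono addr0.
  by rewrite mulrA.
by rewrite mulrCA.
Qed.

Lemma Pn_C1 n p : Pn n p -> C1 p.
Proof.
apply: Pn_ind => [|c f g Cf Cg|i j _].
- exact: (C1_cst 0).1.
- exact: (C1_lin c Cf Cg).1.
- exact: (C1_mono i j).1.
Qed.

Lemma Pn_pder n p j : Pn n p -> Pn (n - 1) (pder j p).
Proof.
move=> pn; suff: C1 p /\ Pn (n - 1) (pder j p) by case.
move: p pn; apply: (@Pn_ind n (fun p => C1 p /\ Pn (n - 1) (pder j p)))
  => [|c f g [Cf Df] [Cg Dg]|i k ikn].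
- by have [H ->] := C1_cst (0 : R); split=> //; exact: Pn0.
- by have [H ->] := C1_lin c Cf Cg; split=> //; exact: Pn_lin.
- have [Cm [D0 D1]] := C1_mono i k; split=> //.
  have [->|->] := ord2P j; rewrite ?D0 ?D1.
    case: i ikn {D0 D1 Cm} => [|i] ikn.
      rewrite (_ : lin _ _ _ = cst 0); first exact: Pn0.
      by apply/funext => x; rewrite /lin mul0r addr0.
    by apply: Pn_lin; [apply: Pn_mono; lia|exact: Pn0].
  case: k ikn {D0 D1 Cm} => [|k] ikn.
    rewrite (_ : lin _ _ _ = cst 0); first exact: Pn0.
    by apply/funext => x; rewrite /lin mul0r addr0.
  by apply: Pn_lin; [apply: Pn_mono; lia|exact: Pn0].
Qed.

Lemma Pn_continuous n p : Pn n p -> continuous p.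
Proof. by move=> /Pn_C1/C1_continuous. Qed.

(** Along a segment a monomial is a product of powers of two affine functions. *)
Lemma Pn_segment (k : nat) p e : Pn k%:Z p -> exists2 P : {poly R},
  (size P <= k.+1)%N & forall t, p (segpt e t) = P.[t].
Proof.
move: p; apply: (@Pn_ind k%:Z (fun p => exists2 P : {poly R}, (size P <= k.+1)%N
    & forall t, p (segpt e t) = P.[t]))
  => [|c f g [P sP fP] [Q sQ gQ]|i j ij].
- by exists 0; [rewrite size_poly0|move=> t; rewrite horner0].
- exists (c *: P + Q); last by move=> t; rewrite !hornerE -fP -gQ.
  rewrite (leq_trans (size_polyD _ _))// geq_max sQ andbT.
  exact: leq_trans (size_scale_leq _ _) sP.
- pose l (a b : R) : {poly R} := a%:P + b *: 'X.
  have sl a b : (size (l a b) <= 2)%N.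
    rewrite (leq_trans (size_polyD _ _))// geq_max (leq_trans (size_polyC_leq1 _))//.
    by rewrite (leq_trans (size_scale_leq _ _))// size_polyX.
  have sX a b (m : nat) : (size (l a b ^+ m)%R <= m.+1)%N.
    rewrite (leq_trans (size_poly_exp_leq _ _))// ltnS -[leqRHS]mul1n leq_mul2r.
    by have := sl a b; case: (size _) => [|[|[]]]//=; rewrite orbT.
  exists (l e.1.1 (e.2.1 - e.1.1) ^+ i * l e.1.2 (e.2.2 - e.1.2) ^+ j).
    rewrite (leq_trans (size_polyMleq _ _))//.
    have := sX e.1.1 (e.2.1 - e.1.1) i; have := sX e.1.2 (e.2.2 - e.1.2) j.
    by lia.
  by move=> t; rewrite /mono /segpt !hornerE/=; congr (_ ^+ _ * _ ^+ _);
    rewrite -[_ *: _]/(_ * _) mulrC.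
Qed.

(** The decomposition [F = grad q + x^perp s] of polynomial fields. For [F]
    homogeneous of degree [d], the identity
    [grad (x . F) = (d + 1) F + x^perp curl F] gives [q] and [s]; on a monomial
    field both are monomials. *)
Lemma Pn_helmholtz n (F1 F2 : R * R -> R) : Pn n F1 -> Pn n F2 ->
  exists q s, [/\ Pn (n + 1) q, Pn (n - 1) s,
    forall x, F1 x = pder ord0 q x + s x * x.2 &
    forall x, F2 x = pder ord_max q x - s x * x.1].
Proof.
pose ok (F1 F2 : R * R -> R) := exists q s, [/\ Pn (n + 1) q, Pn (n - 1) s,
    forall x, F1 x = pder ord0 q x + s x * x.2 &
    forall x, F2 x = pder ord_max q x - s x * x.1].
have ok0 : ok (cst 0) (cst 0).
  exists (cst 0), (cst 0); rewrite !(C1_cst _).2.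
  by split; [exact: Pn0|exact: Pn0|move=> x|move=> x]; rewrite /= mul0r ?addr0 ?subr0.
have okL c f1 f2 g1 g2 : ok f1 f2 -> ok g1 g2 -> ok (lin c f1 g1) (lin c f2 g2).
  move=> [q [s [Pq Ps H1 H2]]] [q' [s' [Pq' Ps' H1' H2']]].
  exists (lin c q q'), (lin c s s'); rewrite !(C1_lin c (Pn_C1 Pq) (Pn_C1 Pq')).2.
  by split; [exact: Pn_lin|exact: Pn_lin|move=> x|move=> x];
    rewrite /lin ?H1 ?H2 ?H1' ?H2'; ring.
have S0 (a b : nat) : (a + b).+1%:R != 0 :> R by rewrite pnatr_eq0.
have ok1 f : Pn n f -> ok f (cst 0).
  move: f; apply: (@Pn_ind n (fun f => ok f (cst 0))) => [//|c p q|i j ij].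
    move=> /(okL c) H /H; rewrite (_ : lin c (cst 0) (cst 0) = cst 0)//.
    by apply/funext => x; rewrite /lin mulr0 addr0.
  have [Cm [D0 D1]] := C1_mono i.+1 j.
  have [K0 K1] := C1_lin ((i + j).+1%:R^-1) Cm (C1_cst 0).1.
  exists (lin (i + j).+1%:R^-1 (mono i.+1 j) (cst 0)).
  exists (lin (j%:R / (i + j).+1%:R) (mono i j.-1) (cst 0)).
  rewrite !K1 D0 D1 !(C1_cst _).2 /lin /=; split.
  - by apply: Pn_lin; [apply: Pn_mono; lia|exact: Pn0].
  - case: j ij {D0 D1 Cm K0 K1} => [|j] ij.
      rewrite (_ : (fun x => _) = cst 0); first exact: Pn0.
      by apply/funext => x; rewrite !mul0r addr0.
    by apply: Pn_lin; [apply: Pn_mono; lia|exact: Pn0].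
  - move=> x; rewrite /mono !addr0.
    have := S0 i j; rewrite -natr1 natrD; case: j {ij D0 D1 Cm K0 K1} => [|j] h.
      by move: h; rewrite -natr1 /= => h; field.
    by move: h; rewrite -!natr1 /= exprS => h; field.
  - move=> x; rewrite /mono !addr0 /=.
    have := S0 i j; rewrite -natr1 natrD => h.
    by rewrite exprS; field.
have ok2 f : Pn n f -> ok (cst 0) f.
  move: f; apply: (@Pn_ind n (fun f => ok (cst 0) f)) => [//|c p q|i j ij].
    move=> /(okL c) H /H; rewrite (_ : lin c (cst 0) (cst 0) = cst 0)//.
    by apply/funext => x; rewrite /lin mulr0 addr0.
  have [Cm [D0 D1]] := C1_mono i j.+1.
  have [K0 K1] := C1_lin ((i + j).+1%:R^-1) Cm (C1_cst 0).1.
  exists (lin (i + j).+1%:R^-1 (mono i j.+1) (cst 0)).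
  exists (lin (- i%:R / (i + j).+1%:R) (mono i.-1 j) (cst 0)).
  rewrite !K1 D0 D1 !(C1_cst _).2 /lin /=; split.
  - by apply: Pn_lin; [apply: Pn_mono; lia|exact: Pn0].
  - case: i ij {D0 D1 Cm K0 K1} => [|i] ij.
      rewrite (_ : (fun x => _) = cst 0); first exact: Pn0.
      by apply/funext => x; rewrite oppr0 !mul0r addr0.
    by apply: Pn_lin; [apply: Pn_mono; lia|exact: Pn0].
  - move=> x; rewrite /mono !addr0 /=.
    have := S0 i j; rewrite -natr1 natrD => h.
    by rewrite exprS; field.
  - move=> x; rewrite /mono !addr0.
    have := S0 i j; rewrite -natr1 natrD; case: i {ij D0 D1 Cm K0 K1} => [|i] h.
      by move: h; rewrite -natr1 /= => h; field.
    by move: h; rewrite -!natr1 /= exprS => h; field.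
move=> /ok1 H1 /ok2 H2; have := okL 1 _ _ _ _ H1 H2.
have -> : lin 1 F1 (cst 0) = F1.
  by apply/funext => x; rewrite /lin mul1r addr0.
have -> // : lin 1 (cst 0) F2 = F2.
by apply/funext => x; rewrite /lin mulr0 add0r.
Qed.

End Polynomials.

(** * The orthogonal projections onto polynomials *)

Section Projection.
Context (R : realType).
Local Notation mu := (@mu2 R).
Variable A : set (plane R).
Hypotheses (oA : open A) (bA : bounded_set A).
Implicit Types (f g p q : R * R -> R) (n : int).

Let mA : pmeasurable R A := open_measurable2 oA.

Fixpoint span (L : seq (R * R -> R)) p : Prop :=
  if L is m :: L' then exists a q, span L' q /\ p = lin a m q else p = cst 0.

Lemma span_lin L c p q : span L p -> span L q -> span L (lin c p q).
Proof.
elim: L p q => [|m L IH] p q /=.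
  by move=> -> ->; apply/funext => x; rewrite /lin mulr0 addr0.
move=> [a [p' [Sp ->]]] [b [q' [Sq ->]]]; exists (c * a + b), (lin c p' q').
by split; [exact: IH|apply/funext => x; rewrite /lin; ring].
Qed.

Lemma span0 L : span L (cst 0).
Proof.
elim: L => //= m L IH; exists 0, (cst 0); split=> //.
by apply/funext => x; rewrite /lin mul0r addr0.
Qed.

Lemma span_mem (I : eqType) (F : I -> R * R -> R) (r : seq I) i :
  i \in r -> span (map F r) (F i).
Proof.
elim: r => //= j r IH; rewrite inE => /orP[/eqP ->|/IH H].
  by exists 1, (cst 0); split; [exact: span0|apply/funext => x; rewrite /lin mul1r addr0].
by exists 0, (F i); split=> //; apply/funext => x; rewrite /lin mul0r add0r.
Qed.

Lemma span_bddm (I : eqType) (F : I -> R * R -> R) (r : seq I) p :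
  (forall i, i \in r -> bddm A (F i)) -> span (map F r) p -> bddm A p.
Proof.
elim: r p => [|i r IH] p bF /=; first by move=> ->; exact: bddm_cst.
move=> [a [q [Sq ->]]]; apply: bddm_lin; first by apply: bF; rewrite inE eqxx.
by apply: IH Sq => j jr; apply: bF; rewrite inE jr orbT.
Qed.

(** Gram-Schmidt: [m'] is the component of the new generator orthogonal to the
    earlier ones. It may vanish almost everywhere, and then its coefficient,
    a quotient by zero, does not matter. *)
Lemma span_projection (I : eqType) (F : I -> R * R -> R) (r : seq I) f :
  (forall i, i \in r -> bddm A (F i)) -> sqint mu A f ->
  exists2 p, span (map F r) p &
    forall q, span (map F r) q -> \int[mu]_(x in A) ((f x - p x) * q x) = 0.
Proof.
elim: r f => [|i r IH] f bF sf /=.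
  exists (cst 0) => // q ->; rewrite -[RHS](Rint0_ae (mu := mu) mA (f := cst 0))//.
    by apply: eq_Rintegral => x _; rewrite mulr0.
  exact: aeW.
have bF' j : j \in r -> bddm A (F j) by move=> jr; apply: bF; rewrite inE jr orbT.
have sF : sqint mu A (F i) by apply: bddm_sqint => //; apply: bF; rewrite inE eqxx.
have sS q : span (map F r) q -> sqint mu A q.
  by move=> Sq; apply: bddm_sqint => //; exact: span_bddm Sq.
have [p0 Sp0 Hp0] := IH f bF' sf; have [m0 Sm0 Hm0] := IH (F i) bF' sF.
pose m' := lin (-1) m0 (F i).
have sm' : sqint mu A m' by apply: sqint_lin => //; exact: sS.
pose a := (\int[mu]_(x in A) (f x * m' x)) / nrm mu A m' ^+ 2.
have am' : \int[mu]_(x in A) (f x * m' x) = a * nrm mu A m' ^+ 2.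
  have [n0|n0] := eqVneq (nrm mu A m') 0; last by rewrite /a divfK// expf_neq0.
  rewrite n0 expr0n mulr0; apply/eqP; rewrite -normr_le0.
  by apply: le_trans (cauchy_schwarz mA sf sm') _; rewrite n0 mulr0.
exists (lin a m' p0).
  exists a, (lin (- a) m0 p0); split; first exact: span_lin.
  by apply/funext => x; rewrite /lin /m' /lin; ring.
move=> _ [b [q' [Sq' ->]]].
pose s := lin b m0 q'.
have Ss : span (map F r) s by exact: span_lin.
have sp0 := sS _ Sp0; have ss := sS _ Ss.
have sfp : sqint mu A (fun x => f x - p0 x).
  exact: sqint_sub.
have E1 : \int[mu]_(x in A) (m' x * s x) = 0.
  rewrite -[RHS](Hm0 _ Ss); apply: eq_Rintegral => x _.
  by rewrite /m' /lin mulN1r addrC.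
have E2 : \int[mu]_(x in A) (m' x * p0 x) = 0.
  rewrite -[RHS](Hm0 _ Sp0); apply: eq_Rintegral => x _.
  by rewrite /m' /lin mulN1r addrC.
have E3 : \int[mu]_(x in A) ((f x - p0 x) * s x) = 0 by exact: Hp0.
have E4 : \int[mu]_(x in A) (m' x * m' x) = nrm mu A m' ^+ 2.
  by rewrite nrm_sqr; apply: eq_Rintegral => x _; rewrite expr2.
have I1 := sqint_mul mA sf sm'; have I2 := sqint_mul mA sm' sm'.
have I3 := sqint_mul mA sm' sp0; have I4 := sqint_mul mA sfp ss.
have I5 := sqint_mul mA sm' ss.
transitivity (\int[mu]_(x in A) (b * (f x * m' x)
    + lin (- (a * b)) (fun x => m' x * m' x) (lin (- b) (fun x => m' x * p0 x)
      (lin (- a) (fun x => m' x * s x) (fun x => (f x - p0 x) * s x))) x)).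
  by apply: eq_Rintegral => x _; rewrite /s /m' /lin; ring.
rewrite Rint_lin//; last by do 3 apply: intg_lin => //.
rewrite Rint_lin//; last by do 2 apply: intg_lin => //.
rewrite Rint_lin//; last by apply: intg_lin.
rewrite Rint_lin// E1 E2 E3 E4 am'; ring.
Qed.

Definition Pn_index n : seq (nat * nat) :=
  [seq ij <- [seq (i, j) | i <- iota 0 `|n|.+1, j <- iota 0 `|n|.+1]
      | (ij.1 + ij.2)%:Z <= n].

Lemma Pn_span n p :
  Pn n p <-> span (map (fun ij => @mono R ij.1 ij.2) (Pn_index n)) p.
Proof.
split.
  move: p; apply: Pn_ind; [exact: span0|exact: span_lin|].
  move=> i j ij.
  apply: (@span_mem _ (fun ij => mono ij.1 ij.2) (Pn_index n) (i, j)).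
  rewrite mem_filter [X in X && _]ij andTb.
  by apply: allpairs_f; rewrite mem_iota; lia.
have : forall ij, ij \in Pn_index n -> (ij.1 + ij.2)%:Z <= n.
  by move=> ij; rewrite mem_filter => /andP[].
elim: (Pn_index n) p => [p _ /= ->|ij r IH p H]; first exact: Pn0.
move=> [a [q [Sq ->]]]; apply: Pn_lin.
  by apply: Pn_mono; apply: H; rewrite inE eqxx.
by apply: IH Sq => ij' h; apply: H; rewrite inE h orbT.
Qed.

Lemma Pn_bddm n p : Pn n p -> bddm A p.
Proof. by move=> /Pn_continuous; exact: bddm_cont. Qed.

Lemma Pn_sqint n p : Pn n p -> sqint mu A p.
Proof. by move=> /Pn_bddm; exact: bddm_sqint. Qed.

Lemma Pi0P n f : sqint mu A f -> Pn n (Pi0 A n f) /\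
  forall q, Pn n q -> \int[mu]_(x in A) ((f x - Pi0 A n f x) * q x) = 0.
Proof.
move=> sf; apply: (@xgetPex _ (cst 0) [set p | Pn n p /\ forall q, Pn n q ->
                        \int[mu]_(x in A) ((f x - p x) * q x) = 0]).
have [|p /Pn_span Pp Hp] := span_projection
    (F := fun ij => @mono R ij.1 ij.2) (r := Pn_index n) _ sf.
  move=> ij; rewrite mem_filter => /andP[h _]; apply: (@Pn_bddm n).
  exact: Pn_mono.
by exists p; split=> // q /Pn_span; exact: Hp.
Qed.

Lemma Pi0_Pn n f : Pn n (Pi0 A n f).
Proof.
rewrite /Pi0; case: xgetP => [p -> []//|_]; exact: Pn0.
Qed.

Lemma Pi0_bddm n f : bddm A (Pi0 A n f).
Proof. exact/Pn_bddm/Pi0_Pn. Qed.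

(** The difference [d] of two projections is orthogonal to all polynomials,
    hence to itself. *)
Lemma Pi0_unique n f p : sqint mu A f -> Pn n p ->
  (forall q, Pn n q -> \int[mu]_(x in A) ((f x - p x) * q x) = 0) ->
  ae_eq mu A (Pi0 A n f) p.
Proof.
move=> sf Pp Hp; have [PP HP] := Pi0P n sf.
pose d := lin (-1) p (Pi0 A n f).
have Pd : Pn n d by exact: Pn_lin.
have sp := Pn_sqint Pp; have sP := Pn_sqint PP; have sd := Pn_sqint Pd.
have : nrm mu A d ^+ 2 = 0.
  rewrite nrm_sqr.
  transitivity (\int[mu]_(x in A) (-1 * ((f x - Pi0 A n f x) * d x)
      + (f x - p x) * d x)).
    by apply: eq_Rintegral => x _; rewrite /d /lin; ring.
  rewrite Rint_lin//; try by apply: sqint_mul => //; exact: sqint_sub.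
  by rewrite HP// Hp// mulr0 addr0.
move/eqP; rewrite sqrf_eq0 => /eqP /(nrm0_ae mA sd).
by apply: filterS => x H /H; rewrite /d /lin /= mulN1r addrC => /eqP; rewrite subr_eq0 => /eqP.
Qed.

Lemma Pi0_lin n c f g : sqint mu A f -> sqint mu A g ->
  ae_eq mu A (Pi0 A n (lin c f g)) (lin c (Pi0 A n f) (Pi0 A n g)).
Proof.
move=> sf sg; have [Pf Hf] := Pi0P n sf; have [Pg Hg] := Pi0P n sg.
apply: Pi0_unique; [exact: sqint_lin|exact: Pn_lin|] => q Pq.
have sub h r : sqint mu A h -> Pn n r -> sqint mu A (fun x => h x - r x).
  by move=> sh Pr; apply: sqint_sub => //; exact: Pn_sqint Pr.
transitivity (\int[mu]_(x in A) (c * ((f x - Pi0 A n f x) * q x)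
    + (g x - Pi0 A n g x) * q x)).
  by apply: eq_Rintegral => x _; rewrite /lin; ring.
rewrite Rint_lin//; try by apply: sqint_mul => //;
  [exact: sub|exact: Pn_sqint Pq].
by rewrite Hf// Hg// mulr0 addr0.
Qed.

Lemma Pi0_congr n f g : sqint mu A f -> sqint mu A g -> ae_eq mu A f g ->
  ae_eq mu A (Pi0 A n f) (Pi0 A n g).
Proof.
move=> sf sg fg; have [Pg Hg] := Pi0P n sg.
apply: Pi0_unique => // q Pq; rewrite -(Hg _ Pq).
have mq := (Pn_bddm Pq).1; have mP := (Pn_bddm Pg).1.
apply: Rint_ae => //.
- apply: measurable_funM => //; apply: measurable_funB => //; exact: sf.1.
- apply: measurable_funM => //; apply: measurable_funB => //; exact: sg.1.
- by apply: filterS fg => x fg Ax; rewrite fg.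
Qed.

End Projection.

(** * Traces on the boundary of a polygon *)

Section Traces.
Context (R : realType).
Local Notation leb := (@lebesgue_measure R).
Local Notation mu := (@mu2 R).
Local Notation I01 := (`[0%R, 1%R]%classic : set (measurableTypeR R)).
Implicit Types (E : polygon R) (e : (R * R) * (R * R)).
Implicit Types (f g G p phi v : R * R -> R).

Let mI : @measurable _ (measurableTypeR R) I01 := measurable_itv _.

Definition edge_sqint G e := sqint leb I01 (G \o segpt e).

Lemma segpt_continuous e : continuous (segpt e).
Proof.
move=> t; apply: cvgD; first exact: cvg_cst.
by apply: cvgZr_tmp; exact: cvg_id.
Qed.

Lemma continuous_edge_sqint phi e : continuous phi -> edge_sqint phi e.
Proof.
move=> cp.
have cs : continuous (phi \o segpt e).
  by move=> t; apply: continuous_comp; [exact: segpt_continuous|exact: cp].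
split; first by apply: (measurable_funS measurableT) => //; exact: continuous_measurable_fun.
apply: continuous_compact_integrable; first exact: segment_compact.
apply: continuous_subspaceT => t.
by apply: (@continuous_comp _ _ _ (phi \o segpt e) (fun s => s ^+ 2));
  [exact: cs|exact: exprn_continuous].
Qed.

Lemma edge_sqint_lin c f g e : edge_sqint f e -> edge_sqint g e ->
  edge_sqint (lin c f g) e.
Proof. exact: sqint_lin. Qed.

Lemma sqint_intg01 (h : R -> R) : sqint leb I01 h -> intg leb I01 h.
Proof.
move=> sh; have s1 : sqint leb I01 (cst 1).
  split; first exact: measurable_cst.
  have I1 : intg leb I01 (cst 1).
    apply: continuous_compact_integrable; first exact: segment_compact.
    by apply: continuous_subspaceT => t; exact: cvg_cst.
  by apply: (intg_eq mI _ I1) => t _; rewrite /= expr1n.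
by apply: intg_eq (sqint_mul mI sh s1) => // x _ /=; rewrite mulr1.
Qed.

Lemma edist_ge0 (a b : R * R) : 0 <= Defs.edist a b.
Proof. exact: sqrtr_ge0. Qed.

Lemma bint_lin E c f g : (forall e, e \in edges E -> edge_sqint f e) ->
  (forall e, e \in edges E -> edge_sqint g e) ->
  bint E (lin c f g) = c * bint E f + bint E g.
Proof.
move=> sf sg; rewrite /bint mulr_sumr -big_split/= !big_seq.
apply: eq_bigr => e eE; rewrite /eint.
rewrite (_ : \int[leb]_(t in I01) lin c f g (segpt e t) =
  c * \int[leb]_(t in I01) f (segpt e t) + \int[leb]_(t in I01) g (segpt e t)).
  by rewrite mulrDr mulrCA.
by rewrite -Rint_lin//; apply: sqint_intg01; [exact: sf|exact: sg].
Qed.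

Lemma bint_sqr_lin E c f g : (forall e, e \in edges E -> edge_sqint f e) ->
  (forall e, e \in edges E -> edge_sqint g e) ->
  bint E (fun x => lin c f g x ^+ 2)
  <= (2 * c ^+ 2) * bint E (fun x => f x ^+ 2) + 2 * bint E (fun x => g x ^+ 2).
Proof.
move=> sf sg; rewrite /bint !mulr_sumr -big_split/= !big_seq.
apply: ler_sum => e eE; rewrite /eint.
have [[_ If] [_ Ig]] := (sf e eE, sg e eE).
have Il : intg leb I01 (fun t => lin c f g (segpt e t) ^+ 2).
  by case: (edge_sqint_lin c (sf e eE) (sg e eE)).
rewrite mulrCA [X in _ <= _ + X]mulrCA -[leRHS]mulrDr ler_wpM2l ?edist_ge0//.
have I2g : intg leb I01 (fun t => 2 * g (segpt e t) ^+ 2).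
  exact: (integrableZl mI 2 Ig).
rewrite -[X in _ <= _ + X]RintegralZl// -Rint_lin//.
apply: le_Rintegral => //; first exact: (intg_lin (2 * c ^+ 2) mI If I2g).
move=> t _; rewrite /lin.
have := sqr_ge0 (c * f (segpt e t) - g (segpt e t)); nra.
Qed.

Lemma has_trace_sqint E v g : has_trace E v g ->
  forall e, e \in edges E -> edge_sqint g e.
Proof. by move=> [_ H _] e /H /(Lfun2P _ _ mI). Qed.

Let budget1 (a s d y : R) : 0 <= s -> 0 < d -> y < d ->
  a * d + y < (a + 2 * s + 3) * d.
Proof.
move=> s0 d0 yd; have sd : 0 <= s * d by apply: mulr_ge0 => //; exact: ltW.
by lra.
Qed.

Let budget2 (a s d : R) : 0 <= a -> 0 < d ->
  2 * s * d + 2 * d < (a + 2 * s + 3) * d.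
Proof.
move=> a0 d0; have ad : 0 <= a * d by apply: mulr_ge0 => //; exact: ltW.
by lra.
Qed.

(** A combination of approximations of [v] and [v'] within [eps / K] is one of
    [lin c v v'] within [eps]: the norms take [(|c| + 1) eps / K], the boundary
    integral of a square takes [(2 c^2 + 2) eps / K]. *)
Lemma has_trace_lin E c v v' g g' : open E.2 -> bounded_set E.2 ->
  has_trace E v g -> has_trace E v' g' -> has_trace E (lin c v v') (lin c g g').
Proof.
move=> oE bE tv tv'; have mE := open_measurable2 oE.
have sg := has_trace_sqint tv; have sg' := has_trace_sqint tv'.
have [Hv _ Av] := tv; have [Hv' _ Av'] := tv'.
split; first exact: H1_lin.
  by move=> e eE; apply/(Lfun2P _ _ mI)/edge_sqint_lin; [exact: sg|exact: sg'].
move=> eps eps0; pose K := `|c| + 2 * c ^+ 2 + 3.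
have c2 : 0 <= c ^+ 2 := sqr_ge0 c; have ac : 0 <= `|c| by [].
have K0 : 0 < K by rewrite /K; lra.
have d0 : 0 < eps / K by rewrite divr_gt0.
set d := eps / K in d0; have dK : K * d = eps by rewrite /d mulrCA divff ?gt_eqF// mulr1.
have [phi Cp [n1 n2 n3]] := Av _ d0.
have [phi' Cp' [n1' n2' n3']] := Av' _ d0.
have [Cl Dl] := C1_lin c Cp Cp'.
exists (lin c phi phi') => //.
have sphi psi : continuous psi -> sqint mu E.2 psi.
  by move=> cp; apply: bddm_sqint => //; exact: bddm_cont.
have nl f f' h h' : sqint mu E.2 f -> sqint mu E.2 f' -> sqint mu E.2 h ->
    sqint mu E.2 h' -> nrm mu E.2 (f \- h) < d -> nrm mu E.2 (f' \- h') < d ->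
    nrm mu E.2 (lin c f f' \- lin c h h') < eps.
  move=> sf sf' sh sh' nf nf'.
  have -> : lin c f f' \- lin c h h' = lin c (f \- h) (f' \- h').
    by apply/funext => x; rewrite /lin /=; ring.
  apply: le_lt_trans (nrm_lin _ _ _ _) _ => //; try exact: sqint_sub.
  rewrite -dK; apply: (@le_lt_trans _ _ (`|c| * d + nrm mu E.2 (f' \- h'))).
    by rewrite lerD2r ler_wpM2l// ltW.
  exact: budget1.
split.
- rewrite normLE// in n1; rewrite normLE// in n1'; rewrite normLE//.
  exact: nl (H1_sqint oE Hv) (H1_sqint oE Hv') (sphi _ (C1_continuous Cp))
    (sphi _ (C1_continuous Cp')) n1 n1'.
- move=> j; have := n2 j; have := n2' j; rewrite !normLE// Dl => h' h.
  have wm := wpartial_meas oE j; have ws := wpartial_sqint oE j.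
  have sp := sphi _ (Cp j).2; have sp' := sphi _ (Cp' j).2.
  have m1 : pmeasurable_fun R E.2
      (wpartial E.2 j (lin c v v') \- lin c (pder j phi) (pder j phi')).
    apply: measurable_funB; first by apply: wm; exact: H1_lin.
    by apply: measurable_lin; [exact: sp.1|exact: sp'.1].
  have m2 : pmeasurable_fun R E.2 (lin c (wpartial E.2 j v) (wpartial E.2 j v')
      \- lin c (pder j phi) (pder j phi')).
    apply: measurable_funB.
      by apply: measurable_lin; [exact: wm|exact: wm].
    by apply: measurable_lin; [exact: sp.1|exact: sp'.1].
  have E1 : ae_eq mu E.2
      (wpartial E.2 j (lin c v v') \- lin c (pder j phi) (pder j phi'))
      (lin c (wpartial E.2 j v) (wpartial E.2 j v')
        \- lin c (pder j phi) (pder j phi')).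
    by apply: filterS (wpartial_lin oE bE c j Hv Hv') => x H Ex /=; rewrite H.
  rewrite (nrm_ae mE m1 m2 E1).
  exact: nl (ws _ Hv) (ws _ Hv') sp sp' h h'.
- have sub (f h : R * R -> R) e : edge_sqint f e -> edge_sqint h e ->
    edge_sqint (fun x => f x - h x) e by exact: sqint_sub.
  have -> : (fun x => (lin c phi phi' x - lin c g g' x) ^+ 2)
    = (fun x => lin c (fun x => phi x - g x) (fun x => phi' x - g' x) x ^+ 2).
    by apply/funext => x; rewrite /lin; congr (_ ^+ 2); ring.
  apply: le_lt_trans (bint_sqr_lin _ _ _) _.
  + move=> e eE; apply: sub; last exact: sg.
    by apply: continuous_edge_sqint; exact: C1_continuous.
  + move=> e eE; apply: sub; last exact: sg'.
    by apply: continuous_edge_sqint; exact: C1_continuous.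
  + rewrite -dK; apply: (@le_lt_trans _ _ ((2 * c ^+ 2) * d + 2 * d)).
      apply: lerD; first by apply: ler_wpM2l; [exact: mulr_ge0|exact: ltW].
      by apply: ler_wpM2l; [exact: ler0n|exact: ltW].
    exact: budget2.
Qed.

Lemma has_trace_C1 E p : open E.2 -> bounded_set E.2 -> C1 p ->
  has_trace E p p.
Proof.
move=> oE bE Cp; have mE := open_measurable2 oE.
split; first exact: C1_H1.
  move=> e _; apply/(Lfun2P _ _ mI).
  exact: continuous_edge_sqint (C1_continuous Cp).
move=> eps eps0; exists p => //; split.
- rewrite normLE// (_ : p \- p = cst 0); last by apply/funext => x /=; rewrite subrr.
  by rewrite nrm_ae0// ; exact: aeW.
- move=> j; rewrite normLE// nrm_ae0//.
    apply: measurable_funB; first by apply: wpartial_meas => //; exact: C1_H1.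
    by apply: continuous_measurable2 => //; exact: (Cp j).2.
  by apply: filterS (C1_wpartial oE bE j Cp) => x H Ex /=; rewrite H// subrr.
- rewrite /bint big1// => e _; rewrite /eint.
  under eq_Rintegral do rewrite subrr expr0n/=.
  by rewrite Rintegral_cst// mul0r mulr0.
Qed.

Lemma C0_poly_trace_lin E k c v v' : open E.2 -> bounded_set E.2 ->
  C0_poly_trace E k v -> C0_poly_trace E k v' -> C0_poly_trace E k (lin c v v').
Proof.
move=> oE bE [g [tg cg pg]] [g' [tg' cg' pg']]; exists (lin c g g'); split.
- exact: has_trace_lin.
- move=> x; apply: cvgD; last exact: cg'.
  by apply: cvgM; [exact: cvg_cst|exact: cg].
- move=> e eE; have [P sP gP] := pg e eE; have [Q sQ gQ] := pg' e eE.
  exists (c *: P + Q).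
    rewrite (leq_trans (size_polyD _ _))// geq_max sQ andbT.
    exact: leq_trans (size_scale_leq _ _) sP.
  by move=> t t01; rewrite !hornerE /lin gP// gQ.
Qed.

Lemma C0_poly_trace_Pn E (k : nat) p : open E.2 -> bounded_set E.2 ->
  Pn k%:Z p -> C0_poly_trace E k p.
Proof.
move=> oE bE Pp; have Cp := Pn_C1 Pp; exists p; split.
- exact: has_trace_C1.
- by apply: continuous_subspaceT; exact: C1_continuous.
- by move=> e _; have [P sP pP] := Pn_segment e Pp; exists P.
Qed.

End Traces.

(** * The local spaces *)

(* Otherwise unification unfolds integrals and the choice of derivatives. *)
Local Opaque Rintegral wpartial Pi0.

Definition linv {R : realType} (c : R) (u w : vfield R) : vfield R :=
  fun i => lin c (u i) (w i).

Section DomainFunctions.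
Context (R : realType).
Local Notation mu := (@mu2 R).
Variable A : set (plane R).
Hypotheses (oA : open A) (bA : bounded_set A).
Implicit Types (f g q : R * R -> R) (u w : vfield R).

Let mA : pmeasurable R A := open_measurable2 oA.

Lemma L20_lin c q q' : L20 A q -> L20 A q' -> L20 A (lin c q q').
Proof.
move=> [/(Lp2P _ mA) sq q0] [/(Lp2P _ mA) sq' q0']; split.
  by apply/(Lp2P _ mA); exact: sqint_lin.
by rewrite Rint_lin//; [rewrite q0 q0' mulr0 addr0|exact: sqint_intg|exact: sqint_intg].
Qed.

Lemma inPn_lin n c f g : inPn A n f -> inPn A n g -> inPn A n (lin c f g).
Proof.
move=> [p Pp fp] [q Pq gq]; exists (lin c p q); first exact: Pn_lin.
by apply: filterS2 fp gq => x H1 H2 Ax; rewrite /lin H1// H2.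
Qed.

Lemma divg_lin c u w : (forall i, H1 A (u i)) -> (forall i, H1 A (w i)) ->
  ae_eq mu A (divg A (linv c u w)) (lin c (divg A u) (divg A w)).
Proof.
move=> Hu Hw.
apply: filterS (ae_fin (fun i => wpartial_lin oA bA c i (Hu i) (Hw i))) => x H Ax.
rewrite /divg /lin mulr_sumr -big_split/=; apply: eq_bigr => i _.
by rewrite /linv H.
Qed.

End DomainFunctions.

Section LocalSpaces.
Context (R : realType).
Local Notation mu := (@mu2 R).
Variable E : polygon R.
Hypotheses (oE : open E.2) (bE : bounded_set E.2).
Implicit Types (f g p q v : R * R -> R) (u w : vfield R).

Let mE : pmeasurable R E.2 := open_measurable2 oE.

Lemma lin_sumD n (c : R) (a b : 'I_n -> R) (s s' : R) :
  \sum_(i < n) (c * a i + b i) + (c * s + s')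
  = c * (\sum_(i < n) a i + s) + (\sum_(i < n) b i + s').
Proof. by rewrite big_split/= -mulr_sumr; ring. Qed.

Lemma intg_grad v (G : 'I_2 -> R * R -> R) : H1 E.2 v ->
  (forall j, bddm E.2 (G j)) ->
  intg mu E.2 (fun x => \sum_(j < 2) wpartial E.2 j v x * G j x).
Proof.
move=> Hv bG; apply: intg_sum => // j; apply: sqint_bddmM => //.
exact: wpartial_sqint.
Qed.

Lemma Rint_grad_lin c v v' (G : 'I_2 -> R * R -> R) : H1 E.2 v -> H1 E.2 v' ->
  (forall j, bddm E.2 (G j)) ->
  \int[mu]_(x in E.2) (\sum_(j < 2) wpartial E.2 j (lin c v v') x * G j x)
  = c * \int[mu]_(x in E.2) (\sum_(j < 2) wpartial E.2 j v x * G j x)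
    + \int[mu]_(x in E.2) (\sum_(j < 2) wpartial E.2 j v' x * G j x).
Proof.
move=> Hv Hv' bG; apply: Rint_lin_ae => //; try exact: intg_grad.
  exact: (intg_meas (intg_grad (H1_lin oE bE c Hv Hv') bG)).
apply: filterS (ae_fin (fun j => wpartial_lin oE bE c j Hv Hv')) => x H Ex.
rewrite /lin mulr_sumr -big_split/=; apply: eq_bigr => j _.
by rewrite H// /lin mulrDl mulrA.
Qed.

Lemma is_Pinabla_lin n c v v' p p' : is_Pinabla E n v p -> is_Pinabla E n v' p' ->
  is_Pinabla E n (lin c v v') (lin c p p').
Proof.
move=> [Pp Hp [g tg bg]] [Pp' Hp' [g' tg' bg']].
have [[Hv _ _] [Hv' _ _]] := (tg, tg').
split; first exact: Pn_lin.
  move=> q Pq; have := Hp q Pq; have := Hp' q Pq.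
  have bq j : bddm E.2 (pder j q) := Pn_bddm oE bE (Pn_pder j Pq).
  have split_p r z : H1 E.2 z -> Pn n r ->
      \int[mu]_(x in E.2) (\sum_(j < 2) pder j q x * (wpartial E.2 j z x - pder j r x))
      = \int[mu]_(x in E.2) (\sum_(j < 2) wpartial E.2 j z x * pder j q x)
        - \int[mu]_(x in E.2) (\sum_(j < 2) pder j r x * pder j q x).
    move=> Hz Pr; rewrite -RintegralB//; last 2 first.
    - exact: intg_grad.
    - apply: bddm_intg => //; apply: bddm_sum => j; apply: bddmM => //.
      exact: Pn_bddm (Pn_pder j Pr).
    apply: eq_Rintegral => x _; rewrite -sumrB; apply: eq_bigr => j _; ring.
  rewrite (split_p _ _ Hv Pp) (split_p _ _ Hv' Pp').
  rewrite (split_p _ _ (H1_lin oE bE c Hv Hv') (Pn_lin c Pp Pp')).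
  rewrite (Rint_grad_lin c Hv Hv' bq).
  have -> : \int[mu]_(x in E.2) (\sum_(j < 2) pder j (lin c p p') x * pder j q x)
      = c * \int[mu]_(x in E.2) (\sum_(j < 2) pder j p x * pder j q x)
        + \int[mu]_(x in E.2) (\sum_(j < 2) pder j p' x * pder j q x).
    have Ir r : Pn n r -> intg mu E.2 (fun x => \sum_(j < 2) pder j r x * pder j q x).
      move=> Pr; apply: bddm_intg => //; apply: bddm_sum => j; apply: bddmM => //.
      exact: Pn_bddm (Pn_pder j Pr).
    rewrite -Rint_lin//; [|exact: Ir|exact: Ir].
    apply: eq_Rintegral => x _; rewrite mulr_sumr -big_split/=.
    apply: eq_bigr => j _; rewrite (C1_lin c (Pn_C1 Pp) (Pn_C1 Pp')).2 /lin; ring.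
  by move=> /subr0_eq -> /subr0_eq ->; exact: subrr.
exists (lin c g g'); first exact: has_trace_lin.
have -> : lin c g g' \- lin c p p' = lin c (g \- p) (g' \- p').
  by apply/funext => x; rewrite /lin /=; ring.
have sub r s e : edge_sqint r e -> edge_sqint s e -> edge_sqint (r \- s) e.
  by apply: sqint_sub; exact: measurable_itv.
rewrite bint_lin ?bg ?bg' ?mulr0 ?addr0// => e eE; apply: sub.
- exact: has_trace_sqint tg _ eE.
- exact: continuous_edge_sqint (Pn_continuous Pp).
- exact: has_trace_sqint tg' _ eE.
- exact: continuous_edge_sqint (Pn_continuous Pp').
Qed.

Lemma is_Pinabla_Pn n p : Pn n p -> is_Pinabla E n p p.
Proof.
move=> Pp; have Cp := Pn_C1 Pp; split=> //.
  move=> q Pq; apply: Rint0_ae => //.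
    apply: (@intg_meas _ _ _ mu); apply: intg_sum => // j.
    apply: sqint_mul => //.
      exact: bddm_sqint (Pn_bddm oE bE (Pn_pder j Pq)).
    apply: sqint_sub => //; first exact: wpartial_sqint (C1_H1 oE bE Cp).
    exact: bddm_sqint (Pn_bddm oE bE (Pn_pder j Pp)).
  apply: filterS (ae_fin (fun j => C1_wpartial oE bE j Cp)) => x H Ex.
  by rewrite big1// => j _; rewrite H// subrr mulr0.
exists p; first exact: has_trace_C1.
rewrite /bint big1// => e _; rewrite /eint.
under eq_Rintegral do rewrite /= subrr.
by rewrite Rintegral_cst// mul0r mulr0.
Qed.

Lemma perp_continuous i : continuous (fun x : R * R => perp x i).
Proof.
rewrite /perp; case: (i == ord0) => x; first exact: cvg_snd.
by apply: cvgN; exact: cvg_fst.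
Qed.

Lemma bddm_perp i : bddm E.2 (fun x : R * R => perp x i).
Proof. by apply: bddm_cont => //; exact: perp_continuous. Qed.

Lemma Wh_loc_lin k c u u' : Wh_loc k E u -> Wh_loc k E u' -> Wh_loc k E (linv c u u').
Proof.
move=> [Hu [q [s [Lq Ps Hs]]] du tu] [Hu' [q' [s' [Lq' Ps' Hs']]] du' tu'].
split.
- by move=> i; exact: H1_lin.
- exists (lin c q q'), (lin c s s'); split; [exact: (L20_lin oE bE)|exact: Pn_lin|].
  move=> w cw; have := Hs w cw; have := Hs' w cw.
  have bw i : bddm E.2 (w i) := Cc1_bddm mE (cw i).
  have bdw i j : bddm E.2 (pder j (w i)) := Cc1_pder_bddm j mE (cw i).
  have [/(Lp2P _ mE) sq _] := Lq; have [/(Lp2P _ mE) sq' _] := Lq'.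
  have bdiv : bddm E.2 (fun x => \sum_(i < 2) pder i (w i) x) by exact: bddm_sum.
  have bperp (r : R * R -> R) : Pn (k%:Z - 1) r ->
      bddm E.2 (fun x => \sum_(i < 2) r x * perp x i * w i x).
    move=> Pr; apply: bddm_sum => i; apply: bddmM => //; apply: bddmM.
      exact: Pn_bddm Pr.
    exact: bddm_perp.
  have Egrad z : (forall i, H1 E.2 (z i)) ->
    \int[mu]_(x in E.2)
      (\sum_(i < 2) \sum_(j < 2) wpartial E.2 j (z i) x * pder j (w i) x)
    = \sum_(i < 2) \int[mu]_(x in E.2)
        (\sum_(j < 2) wpartial E.2 j (z i) x * pder j (w i) x).
    by move=> Hz; apply: Rint_sum => // i; apply: intg_grad.
  rewrite !Egrad//; last by move=> i; exact: H1_lin.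
  under [X in _ -> _ -> X + _ = _]eq_bigr do rewrite Rint_grad_lin//.
  have -> : \int[mu]_(x in E.2) (lin c q q' x * \sum_(i < 2) pder i (w i) x)
    = c * \int[mu]_(x in E.2) (q x * \sum_(i < 2) pder i (w i) x)
      + \int[mu]_(x in E.2) (q' x * \sum_(i < 2) pder i (w i) x).
    rewrite -Rint_lin//; [|exact: sqint_bddmM|exact: sqint_bddmM].
    by apply: eq_Rintegral => x _; rewrite /lin; ring.
  have -> : \int[mu]_(x in E.2) (\sum_(i < 2) lin c s s' x * perp x i * w i x)
    = c * \int[mu]_(x in E.2) (\sum_(i < 2) s x * perp x i * w i x)
      + \int[mu]_(x in E.2) (\sum_(i < 2) s' x * perp x i * w i x).
    rewrite -Rint_lin//; try by apply: bddm_intg => //; exact: bperp.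
    apply: eq_Rintegral => x _; rewrite mulr_sumr -big_split/=.
    by apply: eq_bigr => i _; rewrite /lin; ring.
  move=> H' H; rewrite lin_sumD.
  exact: (congr2 (fun s t => c * s + t) H H').
- have [p Pp dp] := inPn_lin c du du'; exists p => //.
  exact: ae_eq_trans (divg_lin oE bE c Hu Hu') dp.
- by move=> i; exact: C0_poly_trace_lin.
Qed.

Lemma polyspan_Pn lo hi p : polyspan lo hi p -> Pn hi p.
Proof.
move=> [c ->].
exists (fun i j => if lo < (i + j)%:Z then c i j else 0); apply/funext => x.
apply: eq_bigr => i _; rewrite big_mkcond/= [RHS]big_mkcond/=.
apply: eq_bigr => j _; case: ifPn => [/andP[-> ->]//|].
rewrite negb_and; case: ifP => [_|//]; rewrite orbF => /negbTE ->.
by rewrite mul0r.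
Qed.

Lemma Pdiff_continuous (n m : int) q : Pdiff E.2 n m q -> continuous q.
Proof.
move=> [p /polyspan_Pn/Pn_continuous cp ->] x.
have : (fun x : R * R => (diameter E.2)^-1 *: (x - centroid E.2)) @ x
    --> (diameter E.2)^-1 *: (x - centroid E.2).
  by apply: cvgZl_tmp; apply: cvgB; [exact: cvg_id|exact: cvg_cst].
by move=> /cvg_comp; apply; exact: cp.
Qed.

Lemma Vvec_loc_H1 k u : Vvec_loc k E u -> forall i, H1 E.2 (u i).
Proof. by move=> [[]]. Qed.

Lemma Vsca_loc_H1 k v : Vsca_loc k E v -> H1 E.2 v.
Proof. by move=> [[]]. Qed.

Lemma Vvec_loc_lin k c u u' : Vvec_loc k E u -> Vvec_loc k E u' ->
  Vvec_loc k E (linv c u u').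
Proof.
move=> [Wu [p [pu Hp]]] [Wu' [p' [pu' Hp']]]; split; first exact: Wh_loc_lin.
exists (linv c p p'); split; first by move=> i; exact: is_Pinabla_lin.
move=> q Pq; have cq := Pdiff_continuous Pq.
have I z r : (forall i, H1 E.2 (z i)) -> (forall i, is_Pinabla E k%:Z (z i) (r i)) ->
    intg mu E.2 (fun x => \sum_(i < 2) (z i x - r i x) * (perp x i * q x)).
  move=> Hz Pr; apply: intg_sum => // i; apply: sqint_bddmM => //.
    apply: sqint_sub => //; first exact: H1_sqint.
    by have [Pri _ _] := Pr i; exact: Pn_sqint Pri.
  by apply: bddmM; [exact: bddm_perp|exact: bddm_cont].
have Hu i : H1 E.2 (u i) by case: Wu.
have Hu' i : H1 E.2 (u' i) by case: Wu'.
transitivity (\int[mu]_(x in E.2)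
  (c * (\sum_(i < 2) (u i x - p i x) * (perp x i * q x))
   + \sum_(i < 2) (u' i x - p' i x) * (perp x i * q x))).
  apply: eq_Rintegral => x _; rewrite mulr_sumr -big_split/=.
  by apply: eq_bigr => i _; rewrite /linv /lin; ring.
rewrite (Rint_lin c mE (I _ _ Hu pu) (I _ _ Hu' pu')).
by rewrite (Hp q Pq) (Hp' q Pq) mulr0 addr0.
Qed.

Lemma Uh_loc_lin k c v v' : Uh_loc k E v -> Uh_loc k E v' -> Uh_loc k E (lin c v v').
Proof.
move=> [Hv [p Pp Dp] tv] [Hv' [p' Pp' Dp'] tv']; split.
- exact: H1_lin.
- exists (lin c p p'); first exact: Pn_lin.
  move=> phi cp; have bp := Cc1_bddm mE cp.
  have bdp j := Cc1_pder_bddm j mE cp.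
  have Ip r : Pn k%:Z r -> intg mu E.2 (fun x => r x * phi x).
    by move=> Pr; apply: bddm_intg => //; apply: bddmM => //; exact: Pn_bddm Pr.
  rewrite (Rint_grad_lin c Hv Hv' bdp).
  transitivity (c * (\int[mu]_(x in E.2) (p x * phi x))
     + \int[mu]_(x in E.2) (p' x * phi x)); last first.
    rewrite -(Rint_lin c mE (Ip _ Pp) (Ip _ Pp')).
    by apply: eq_Rintegral => x _; rewrite /lin mulrDl mulrA.
  by rewrite -(Dp phi cp) -(Dp' phi cp) opprD mulrN.
- exact: C0_poly_trace_lin.
Qed.

Lemma Vsca_loc_lin k c v v' : Vsca_loc k E v -> Vsca_loc k E v' ->
  Vsca_loc k E (lin c v v').
Proof.
move=> [Uv [p [pv Hp]]] [Uv' [p' [pv' Hp']]]; split; first exact: Uh_loc_lin.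
exists (lin c p p'); split; first exact: is_Pinabla_lin.
move=> q Pq; have cq := Pdiff_continuous Pq.
have I z r : H1 E.2 z -> is_Pinabla E k%:Z z r ->
    intg mu E.2 (fun x => (z x - r x) * q x).
  move=> Hz [Pr _ _]; apply: sqint_bddmM => //; last exact: bddm_cont.
  by apply: sqint_sub => //; [exact: H1_sqint|exact: Pn_sqint Pr].
have Hv : H1 E.2 v by case: Uv.
have Hv' : H1 E.2 v' by case: Uv'.
transitivity (\int[mu]_(x in E.2) (c * ((v x - p x) * q x) + (v' x - p' x) * q x)).
  by apply: eq_Rintegral => x _; rewrite /lin; ring.
rewrite (Rint_lin c mE (I _ _ Hv pv) (I _ _ Hv' pv')).
by rewrite (Hp q Pq) (Hp' q Pq) mulr0 addr0.
Qed.

(** The equations that define the local spaces involve the weak Laplacian; for a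
    polynomial it is a polynomial. *)
Lemma weak_laplacian n p phi : Pn n p -> Cc1 E.2 phi ->
  \int[mu]_(x in E.2) (\sum_(j < 2) wpartial E.2 j p x * pder j phi x)
  = - \int[mu]_(x in E.2) ((\sum_(j < 2) pder j (pder j p) x) * phi x).
Proof.
move=> Pp cp; have Cp := Pn_C1 Pp; have bphi := Cc1_bddm mE cp.
have bdp j := Cc1_pder_bddm j mE cp.
have Cd j : C1 (pder j p) := Pn_C1 (Pn_pder j Pp).
have bd j : bddm E.2 (pder j p) := Pn_bddm oE bE (Pn_pder j Pp).
have bdd j : bddm E.2 (pder j (pder j p)) :=
  Pn_bddm oE bE (Pn_pder j (Pn_pder j Pp)).
transitivity (\int[mu]_(x in E.2) (\sum_(j < 2) pder j p x * pder j phi x)).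
  apply: Rint_ae => //.
  - exact: intg_meas (intg_grad (C1_H1 oE bE Cp) bdp).
  - by apply: (proj1 (_ : bddm E.2 _)); apply: bddm_sum => j; exact: bddmM.
  - apply: filterS (ae_fin (fun j => C1_wpartial oE bE j Cp)) => x H Ex.
    by apply: eq_bigr => j _; rewrite H.
rewrite Rint_sum//; last by move=> j; apply: bddm_intg => //; exact: bddmM.
under eq_bigr => j _ do rewrite (integration_by_parts j mE bE (Cd j) cp).
rewrite sumrN -Rint_sum//; last by move=> j; apply: bddm_intg => //; exact: bddmM.
by congr (- _); apply: eq_Rintegral => x _; rewrite mulr_suml.
Qed.

Lemma Pn_laplacian n p : Pn n p ->
  Pn (n - 2) (fun x => \sum_(j < 2) pder j (pder j p) x).
Proof.
move=> Pp; apply: lin_closed_sum; [exact: Pn0|exact: Pn_lin|] => j _ _.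
have -> : n - 2 = n - 1 - 1 by rewrite -addrA.
by do 2 apply: Pn_pder.
Qed.

(** Subtracting the mean value; on a null set [E] the integral of [q] is
    zero and so is the quotient. *)
Lemma mean_free_potential q : C1 q ->
  exists q', [/\ L20 E.2 q', C1 q' & forall j, pder j q' = pder j q].
Proof.
move=> Cq; pose I1 := \int[mu]_(x in E.2) (cst 1 x : R).
pose I := \int[mu]_(x in E.2) q x.
have bq : bddm E.2 q by apply: bddm_cont => //; exact: C1_continuous.
have sq := bddm_sqint mE bE bq.
have b1 : bddm E.2 (cst 1) := bddm_cst _ _.
have s1 := bddm_sqint mE bE b1.
have [Cc Dc] := C1_cst (1 : R).
have [Cl Dl] := C1_lin (- (I / I1)) Cc Cq.
exists (lin (- (I / I1)) (cst 1) q); split => //; last first.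
  by move=> j; rewrite Dl Dc; apply/funext => x; rewrite /lin mulr0 add0r.
split; first by apply/(Lp2P _ mE); exact: sqint_lin.
rewrite (Rint_lin _ mE (sqint_intg mE bE s1) (sqint_intg mE bE sq)).
rewrite -/I1 -/I mulNr addrC.
have [I10|I1n] := eqVneq I1 0; last by rewrite divfK// subrr.
rewrite I10 mulr0 subr0.
have n0 : nrm mu E.2 (cst 1) = 0.
  apply/eqP; rewrite -sqrf_eq0 nrm_sqr; apply/eqP; rewrite -[RHS]I10.
  by apply: eq_Rintegral => x _; rewrite expr1n.
have := cauchy_schwarz mE sq s1; rewrite n0 mulr0 normr_le0 => /eqP H.
rewrite /I -[RHS]H; apply: eq_Rintegral => x _; by rewrite mulr1.
Qed.

(** The pressure and the rotational term of the local Stokes problem solved by a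
    polynomial field [p] are read off from the decomposition of [- Delta p]. *)
Lemma Wh_loc_Pn (k : nat) (p : vfield R) : (forall i, Pn k%:Z (p i)) -> Wh_loc k E p.
Proof.
move=> Pp; have Cp i := Pn_C1 (Pp i); split.
- by move=> i; exact: C1_H1.
- pose F i := lin (-1) (fun x => \sum_(j < 2) pder j (pder j (p i)) x) (cst 0).
  have PF i : Pn (k%:Z - 2) (F i) by apply: Pn_lin; [exact: Pn_laplacian|exact: Pn0].
  have [q [s [Pq Ps H1 H2]]] := Pn_helmholtz (PF ord0) (PF ord_max).
  have [q' [Lq' Cq' Dq']] := mean_free_potential (Pn_C1 Pq).
  have Fi i x : - (\sum_(j < 2) pder j (pder j (p i)) x)
      = pder i q' x + s x * perp x i.
    have -> : - (\sum_(j < 2) pder j (pder j (p i)) x) = F i x.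
      by rewrite /F /lin mulN1r addr0.
    rewrite Dq' /perp; have [->|->] := ord2P i; first exact: H1.
    by rewrite H2 /= mulrN.
  exists q', s; split => //; first by apply: Pn_sub Ps; lia.
  move=> w cw.
  have bw i : bddm E.2 (w i) := Cc1_bddm mE (cw i).
  have bdw i j : bddm E.2 (pder j (w i)) := Cc1_pder_bddm j mE (cw i).
  have bq' : bddm E.2 q' by apply: bddm_cont => //; exact: C1_continuous.
  have bdq' i : bddm E.2 (pder i q') by apply: bddm_cont => //; exact: (Cq' i).2.
  have bs : bddm E.2 s := Pn_bddm oE bE Ps.
  rewrite Rint_sum//; last by move=> i; apply: intg_grad => //; exact: C1_H1.
  transitivity (\sum_(i < 2) \int[mu]_(x in E.2) (s x * perp x i * w i x)); last first.
    rewrite Rint_sum// => i; apply: bddm_intg => //; apply: bddmM => //.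
    by apply: bddmM => //; exact: bddm_perp.
  have -> : \int[mu]_(x in E.2) (q' x * \sum_(i < 2) pder i (w i) x)
      = \sum_(i < 2) - \int[mu]_(x in E.2) (pder i q' x * w i x).
    under eq_bigr => i _ do rewrite -(integration_by_parts i mE bE Cq' (cw i)).
    rewrite -Rint_sum//; last by move=> i; apply: bddm_intg => //; exact: bddmM.
    by apply: eq_Rintegral => x _; rewrite mulr_sumr.
  rewrite -big_split/=; apply: eq_bigr => i _.
  rewrite (weak_laplacian (Pp i) (cw i)).
  have bL : bddm E.2 (fun x => \sum_(j < 2) pder j (pder j (p i)) x).
    by apply: bddm_sum => j; exact: Pn_bddm (Pn_pder j (Pn_pder j (Pp i))).
  have I1 : intg mu E.2 (fun x => (\sum_(j < 2) pder j (pder j (p i)) x) * w i x).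
    by apply: bddm_intg => //; exact: bddmM.
  have I2 : intg mu E.2 (fun x => pder i q' x * w i x).
    by apply: bddm_intg => //; exact: bddmM.
  rewrite -opprD -RintegralD// -mulN1r -RintegralZl//; last first.
    apply: bddm_intg => //; apply: bddmD; exact: bddmM.
  apply: eq_Rintegral => x _; rewrite mulN1r -mulrDl -mulNr opprD Fi.
  by rewrite addrAC subrr add0r.
- exists (fun x => \sum_(i < 2) pder i (p i) x).
    apply: lin_closed_sum; [exact: Pn0|exact: Pn_lin|] => i _ _.
    exact: Pn_pder.
  apply: filterS (ae_fin (fun i => C1_wpartial oE bE i (Cp i))) => x H Ex.
  by apply: eq_bigr => i _; rewrite H.
- by move=> i; exact: C0_poly_trace_Pn.
Qed.

Lemma Vvec_loc_Pn (k : nat) (p : vfield R) : (forall i, Pn k%:Z (p i)) -> Vvec_loc k E p.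
Proof.
move=> Pp; split; first exact: Wh_loc_Pn.
exists p; split; first by move=> i; exact: is_Pinabla_Pn.
move=> q Pq; transitivity (\int[mu]_(x in E.2) (cst 0 x : R)).
  by apply: eq_Rintegral => x _; rewrite big1// => i _; rewrite subrr mul0r.
by rewrite Rintegral_cst// mul0r.
Qed.

Lemma Vsca_loc_Pn (k : nat) p : Pn k%:Z p -> Vsca_loc k E p.
Proof.
move=> Pp; have Cp := Pn_C1 Pp; split.
  split; [exact: C1_H1| |exact: C0_poly_trace_Pn].
  exists (fun x => \sum_(j < 2) pder j (pder j p) x).
    by apply: (@Pn_sub _ (k%:Z - 2)); [lia|exact: Pn_laplacian].
  by move=> phi cp; rewrite (weak_laplacian Pp cp) opprK.
exists p; split; first exact: is_Pinabla_Pn.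
move=> q Pq; transitivity (\int[mu]_(x in E.2) (cst 0 x : R)).
  by apply: eq_Rintegral => x _; rewrite subrr mul0r.
by rewrite Rintegral_cst// mul0r.
Qed.

(** The local spaces contain the polynomials, hence the arguments of the
    stabilizations. *)
Lemma Vvec_loc_subPi0 k u : Vvec_loc k E u ->
  Vvec_loc k E (fun i => u i \- Pi0 E.2 k%:Z (u i)).
Proof.
move=> Vu; have VP : Vvec_loc k E (fun i => Pi0 E.2 k%:Z (u i)).
  by apply: Vvec_loc_Pn => i; exact: Pi0_Pn.
rewrite (_ : (fun i => _) = linv (-1) (fun i => Pi0 E.2 k%:Z (u i)) u).
  exact: Vvec_loc_lin.
by apply/funext => i; apply/funext => x; rewrite /linv /lin /= mulN1r addrC.
Qed.

Lemma Vsca_loc_subPi0 k v : Vsca_loc k E v -> Vsca_loc k E (v \- Pi0 E.2 k%:Z v).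
Proof.
move=> Vv; have VP : Vsca_loc k E (Pi0 E.2 k%:Z v).
  by apply: Vsca_loc_Pn; exact: Pi0_Pn.
rewrite (_ : v \- _ = lin (-1) (Pi0 E.2 k%:Z v) v); first exact: Vsca_loc_lin.
by apply/funext => x; rewrite /lin /= mulN1r addrC.
Qed.

End LocalSpaces.

(** * The discrete forms on one element *)

Lemma sum_linl (R : comPzRingType) n (c : R) (a a' a'' b : 'I_n -> R) :
  (forall i, a'' i = c * a i + a' i) ->
  \sum_(i < n) a'' i * b i
  = c * (\sum_(i < n) a i * b i) + \sum_(i < n) a' i * b i.
Proof.
move=> H; rewrite mulr_sumr -big_split/=; apply: eq_bigr => i _.
by rewrite H mulrDl mulrA.
Qed.

Lemma sum_linr (R : comPzRingType) n (c : R) (a b b' b'' : 'I_n -> R) :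
  (forall i, b'' i = c * b i + b' i) ->
  \sum_(i < n) a i * b'' i
  = c * (\sum_(i < n) a i * b i) + \sum_(i < n) a i * b' i.
Proof.
move=> H; rewrite mulr_sumr -big_split/=; apply: eq_bigr => i _.
by rewrite H mulrDr mulrCA.
Qed.

Lemma powRS_mono (R : realType) (s a b : R) : 0 <= s -> 0 <= a -> 0 <= b ->
  0 <= (a `^ s * a - b `^ s * b) * (a - b).
Proof.
move=> s0; wlog ab : a b / a <= b => [W a0 b0|a0 b0].
  have [ab|/ltW ba] := leP a b; first exact: W.
  by rewrite -mulrNN !opprB; exact: W.
rewrite -mulrNN !opprB mulr_ge0 ?subr_ge0//.
by rewrite ler_pM ?powR_ge0// ge0_ler_powR ?nnegrE.
Qed.

Definition eucl (R : realType) (c : 'I_2 -> R) : R :=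
  Num.sqrt (\sum_(i < 2) c i ^+ 2).

Lemma eucl_ge0 (R : realType) (c : 'I_2 -> R) : 0 <= eucl c.
Proof. exact: sqrtr_ge0. Qed.

Lemma eucl_sqr (R : realType) (c : 'I_2 -> R) :
  eucl c ^+ 2 = \sum_(i < 2) c i ^+ 2.
Proof. by rewrite sqr_sqrtr// sumr_ge0// => i _; exact: sqr_ge0. Qed.

Lemma dot_le_eucl (R : realType) (a b : 'I_2 -> R) :
  \sum_(i < 2) a i * b i <= eucl a * eucl b.
Proof.
apply: le_trans (ler_norm _) _.
rewrite -(ler_pXn2r (n := 2))// ?nnegrE ?mulr_ge0 ?eucl_ge0//.
rewrite real_normK ?num_real// exprMn !eucl_sqr.
rewrite !big_ord_recl !big_ord0 !addr0.
have := sqr_ge0 (a ord0 * b (lift ord0 ord0) - a (lift ord0 ord0) * b ord0).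
move: (a _) (a _) (b _) (b _) => a0 a1 b0 b1; lra.
Qed.

(** With [a . b <= |a| |b|] the claim reduces to the monotonicity of
    [t |-> t ^ (s + 1)]. *)
Lemma forchheimer_monotone (R : realType) (s : R) (a b : 'I_2 -> R) : 0 <= s ->
  0 <= eucl a `^ s * (\sum_(i < 2) a i * (a i - b i))
       - eucl b `^ s * (\sum_(i < 2) b i * (a i - b i)).
Proof.
move=> s0; have := dot_le_eucl a b; set d := \sum_(i < 2) a i * b i => dN.
have -> : \sum_(i < 2) a i * (a i - b i) = eucl a ^+ 2 - d.
  by rewrite eucl_sqr -sumrB; apply: eq_bigr => i _; ring.
have -> : \sum_(i < 2) b i * (a i - b i) = d - eucl b ^+ 2.
  by rewrite eucl_sqr -sumrB; apply: eq_bigr => i _; ring.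
have := powRS_mono s0 (eucl_ge0 a) (eucl_ge0 b).
have := powR_ge0 (eucl a) s; have := powR_ge0 (eucl b) s.
move: (eucl a) (eucl b) (_ `^ _) (_ `^ _) d dN => x y p q d dN.
nra.
Qed.

Lemma bddm_eucl_powR (R : realType) (A : set (plane R)) (c : 'I_2 -> R * R -> R)
  (s : R) : 0 <= s -> (forall i, bddm A (c i)) ->
  bddm A (fun x => eucl (c ^~ x) `^ s).
Proof.
move=> s0 bc; have [mS [M SM]] : bddm A (fun x => \sum_(i < 2) c i x ^+ 2).
  by apply: bddm_sum => i; exact: bddmX.
split.
  apply: (measurableT_comp (measurable_powR s)).
  apply: measurableT_comp mS; apply: continuous_measurable_fun.
  exact: sqrt_continuous.
exists (Num.sqrt M `^ s) => x Ax; rewrite ger0_norm ?powR_ge0//.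
rewrite ge0_ler_powR ?nnegrE ?sqrtr_ge0// ler_wsqrtr//.
exact: le_trans (ler_norm _) (SM x Ax).
Qed.

Section ElementForms.
Context (R : realType).
Local Notation mu := (@mu2 R).
Variables (k : nat) (E : polygon R).
Hypotheses (oE : open E.2) (bE : bounded_set E.2).
Implicit Types (v X : R * R -> R) (u w z : vfield R).

Let mE : pmeasurable R E.2 := open_measurable2 oE.

Local Notation P v := (Pi0 E.2 k%:Z v).
Local Notation G v j := (Pi0 E.2 (k%:Z - 1) (wpartial E.2 j v)).

(** The operators are linear only almost everywhere; relating three functions
    in place of applying the operators to a sum makes invariance under almost
    everywhere equality the case [c = 0]. *)
Lemma Pi0_lin_ae c v v' v'' : H1 E.2 v -> H1 E.2 v' -> H1 E.2 v'' ->
  ae_eq mu E.2 v'' (lin c v v') -> ae_eq mu E.2 (P v'') (lin c (P v) (P v')).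
Proof.
move=> Hv Hv' Hv'' H.
have sv := H1_sqint oE Hv; have sv' := H1_sqint oE Hv'.
have sv'' := H1_sqint oE Hv''.
apply: ae_eq_trans (Pi0_lin oE bE _ c sv sv').
exact: (Pi0_congr oE bE _ sv'' (sqint_lin c mE sv sv') H).
Qed.

Lemma Pi0_grad_lin_ae c v v' v'' j : H1 E.2 v -> H1 E.2 v' -> H1 E.2 v'' ->
  ae_eq mu E.2 v'' (lin c v v') ->
  ae_eq mu E.2 (G v'' j) (lin c (G v j) (G v' j)).
Proof.
move=> Hv Hv' Hv'' H.
have sv := wpartial_sqint oE j Hv; have sv' := wpartial_sqint oE j Hv'.
have sv'' := wpartial_sqint oE j Hv''.
apply: ae_eq_trans (Pi0_lin oE bE _ c sv sv').
apply: (Pi0_congr oE bE _ sv'' (sqint_lin c mE sv sv')).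
apply: ae_eq_trans (wpartial_lin oE bE c j Hv Hv').
exact: (wpartial_congr oE bE j Hv'' (H1_lin oE bE c Hv Hv') H).
Qed.

Definition ae_lin c v v' v'' :=
  [/\ H1 E.2 v, H1 E.2 v', H1 E.2 v'' & ae_eq mu E.2 v'' (lin c v v')].

Definition ae_linv c u u' u'' := forall i, ae_lin c (u i) (u' i) (u'' i).

Lemma ae_lin_proj c v v' v'' : ae_lin c v v' v'' ->
  ae_eq mu E.2 (P v'') (lin c (P v) (P v')).
Proof. by move=> [Hv Hv' Hv'' H]; exact: Pi0_lin_ae. Qed.

Lemma ae_lin_grad c v v' v'' j : ae_lin c v v' v'' ->
  ae_eq mu E.2 (G v'' j) (lin c (G v j) (G v' j)).
Proof. by move=> [Hv Hv' Hv'' H]; exact: Pi0_grad_lin_ae. Qed.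

Let bP v : bddm E.2 (P v) := Pi0_bddm oE bE _ v.
Let bG v j : bddm E.2 (G v j) := Pi0_bddm oE bE _ (wpartial E.2 j v).

(** The integrands of all forms are bounded, and linear almost everywhere. *)
Lemma Rint_bddm_lin c F F' F'' : bddm E.2 F -> bddm E.2 F' -> bddm E.2 F'' ->
  ae_eq mu E.2 F'' (lin c F F') ->
  \int[mu]_(x in E.2) F'' x
  = c * \int[mu]_(x in E.2) F x + \int[mu]_(x in E.2) F' x.
Proof.
move=> b b' b'' H; apply: Rint_lin_ae H => //; first exact: b''.1.
  exact: bddm_intg.
exact: bddm_intg.
Qed.

Lemma Rint_ge0_ae (f g : R * R -> R) : pmeasurable_fun R E.2 f ->
  pmeasurable_fun R E.2 g -> ae_eq mu E.2 f g -> (forall x, 0 <= g x) ->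
  0 <= \int[mu]_(x in E.2) f x.
Proof.
move=> mf mg fg g0; rewrite (Rint_ae mE mf mg fg).
by apply: Rintegral_ge0 => x _.
Qed.

Definition conv_int z u w : R := \int[mu]_(x in E.2)
  (\sum_(i < 2) (\sum_(j < 2) G (u i) j x * P (z j) x) * P (w i) x).

Definition heat_conv_int u v s : R := \int[mu]_(x in E.2)
  ((\sum_(j < 2) P (u j) x * G v j x) * P s x).

Definition drag_int u w : R :=
  \int[mu]_(x in E.2) (\sum_(i < 2) P (u i) x * P (w i) x).

Definition forch_int (r : R) z u w : R := \int[mu]_(x in E.2)
  (Num.sqrt (\sum_(i < 2) P (z i) x ^+ 2) `^ (r - 2) *
     \sum_(i < 2) P (u i) x * P (w i) x).

Definition visc_int (nu : R -> R) X u w : R := \int[mu]_(x in E.2)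
  (nu (P X x) * \sum_(i < 2) \sum_(j < 2) G (u i) j x * G (w i) j x).

Definition diff_int (kappa : R -> R) X v s : R := \int[mu]_(x in E.2)
  (kappa (P X x) * \sum_(j < 2) G v j x * G s j x).

Lemma bddm_conv z u w : bddm E.2
  (fun x => \sum_(i < 2) (\sum_(j < 2) G (u i) j x * P (z j) x) * P (w i) x).
Proof.
apply: bddm_sum => i; apply: bddmM => //; apply: bddm_sum => j.
exact: bddmM.
Qed.

Lemma conv_int_lin1 c z z' z'' u w : ae_linv c z z' z'' ->
  conv_int z'' u w = c * conv_int z u w + conv_int z' u w.
Proof.
move=> H; apply: Rint_bddm_lin; try exact: bddm_conv.
apply: filterS (ae_fin (fun i => ae_lin_proj (H i))) => x He Ex.
rewrite /lin; apply: sum_linl => i; apply: sum_linr => j; exact: He.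
Qed.

Lemma conv_int_lin2 c z u u' u'' w : ae_linv c u u' u'' ->
  conv_int z u'' w = c * conv_int z u w + conv_int z u' w.
Proof.
move=> H; apply: Rint_bddm_lin; try exact: bddm_conv.
apply: filterS (ae_fin (fun i => ae_fin (fun j => ae_lin_grad j (H i)))) => x He Ex.
rewrite /lin; apply: sum_linl => i; apply: sum_linl => j; exact: He.
Qed.

Lemma conv_int_lin3 c z u w w' w'' : ae_linv c w w' w'' ->
  conv_int z u w'' = c * conv_int z u w + conv_int z u w'.
Proof.
move=> H; apply: Rint_bddm_lin; try exact: bddm_conv.
apply: filterS (ae_fin (fun i => ae_lin_proj (H i))) => x He Ex.
rewrite /lin; apply: sum_linr => i; exact: He.
Qed.

Lemma bddm_heat_conv u v s : bddm E.2
  (fun x => (\sum_(j < 2) P (u j) x * G v j x) * P s x).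
Proof.
by apply: bddmM => //; apply: bddm_sum => j; exact: bddmM.
Qed.

Lemma heat_conv_int_lin1 c u u' u'' v s : ae_linv c u u' u'' ->
  heat_conv_int u'' v s = c * heat_conv_int u v s + heat_conv_int u' v s.
Proof.
move=> H; apply: Rint_bddm_lin; try exact: bddm_heat_conv.
apply: filterS (ae_fin (fun i => ae_lin_proj (H i))) => x He Ex.
rewrite /lin mulrA -mulrDl; congr (_ * _); apply: sum_linl => j; exact: He.
Qed.

Lemma heat_conv_int_lin2 c u v v' v'' s : ae_lin c v v' v'' ->
  heat_conv_int u v'' s = c * heat_conv_int u v s + heat_conv_int u v' s.
Proof.
move=> H; apply: Rint_bddm_lin; try exact: bddm_heat_conv.
apply: filterS (ae_fin (fun j => ae_lin_grad j H)) => x He Ex.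
rewrite /lin mulrA -mulrDl; congr (_ * _); apply: sum_linr => j; exact: He.
Qed.

Lemma heat_conv_int_lin3 c u v s s' s'' : ae_lin c s s' s'' ->
  heat_conv_int u v s'' = c * heat_conv_int u v s + heat_conv_int u v s'.
Proof.
move=> H; apply: Rint_bddm_lin; try exact: bddm_heat_conv.
apply: filterS (ae_lin_proj H) => x He Ex.
rewrite /lin mulrCA -mulrDr; congr (_ * _); exact: He.
Qed.

Lemma bddm_drag u w : bddm E.2 (fun x => \sum_(i < 2) P (u i) x * P (w i) x).
Proof. by apply: bddm_sum => i; exact: bddmM. Qed.

Lemma drag_int_lin1 c u u' u'' w : ae_linv c u u' u'' ->
  drag_int u'' w = c * drag_int u w + drag_int u' w.
Proof.
move=> H; apply: Rint_bddm_lin; try exact: bddm_drag.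
apply: filterS (ae_fin (fun i => ae_lin_proj (H i))) => x He Ex.
rewrite /lin; apply: sum_linl => i; exact: He.
Qed.

Lemma drag_int_ge0 u : 0 <= drag_int u u.
Proof.
apply: Rintegral_ge0 => x _; apply: sumr_ge0 => i _.
by rewrite -expr2 sqr_ge0.
Qed.

Lemma bddm_forch (r : R) z u w : 2 <= r -> bddm E.2 (fun x =>
  Num.sqrt (\sum_(i < 2) P (z i) x ^+ 2) `^ (r - 2) *
     \sum_(i < 2) P (u i) x * P (w i) x).
Proof.
move=> r2; apply: bddmM; last exact: bddm_drag.
apply: (bddm_eucl_powR (c := fun i => P (z i))); first by rewrite subr_ge0.
by move=> i; exact: bP.
Qed.

Lemma forch_int_congr (r : R) u u' w : 2 <= r -> ae_linv 0 u u u' ->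
  forch_int r u' u' w = forch_int r u u w.
Proof.
move=> r2 H; apply: Rint_ae => //; [exact: (bddm_forch _ _ _ r2).1..|].
apply: filterS (ae_fin (fun i => ae_lin_proj (H i))) => x He Ex.
have {}He i : P (u' i) x = P (u i) x by rewrite (He i Ex) /lin mul0r add0r.
apply: (congr2 (fun s t => Num.sqrt s `^ (r - 2) * t)); apply: eq_bigr => i _.
  exact: (congr1 (fun t => t ^+ 2) (He i)).
exact: (congr1 (fun t => t * P (w i) x) (He i)).
Qed.

Lemma forch_int_ge0 (r : R) u : 0 <= forch_int r u u u.
Proof.
apply: Rintegral_ge0 => x _; apply: mulr_ge0; first exact: powR_ge0.
by apply: sumr_ge0 => i _; rewrite -expr2 sqr_ge0.
Qed.

Lemma forch_int_mono (r : R) u u' e : 2 <= r -> ae_linv (-1) u u' e ->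
  forch_int r u u e <= forch_int r u' u' e.
Proof.
move=> r2 H; have s0 : 0 <= r - 2 by rewrite subr_ge0.
have bF y := bddm_forch y y e r2.
have IF y := bddm_intg mE bE (bF y).
rewrite -subr_ge0 -(RintegralB mE (IF u') (IF u)).
pose N y x := eucl (fun i => P (y i) x) `^ (r - 2).
apply: (Rint_ge0_ae (g := fun x =>
    N u' x * (\sum_(i < 2) P (u' i) x * (P (u' i) x - P (u i) x))
    - N u x * (\sum_(i < 2) P (u i) x * (P (u' i) x - P (u i) x)))); last first.
- by move=> x; exact: forchheimer_monotone.
- apply: filterS (ae_fin (fun i => ae_lin_proj (H i))) => x He Ex.
  have {}He i : P (e i) x = P (u' i) x - P (u i) x.
    by rewrite (He i Ex) /lin mulN1r addrC.
  apply: (congr2 (fun s t => N u' x * s - N u x * t)); apply: eq_bigr => i _.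
    exact: (congr1 (fun t => P (u' i) x * t) (He i)).
  exact: (congr1 (fun t => P (u i) x * t) (He i)).
- have b y : bddm E.2 (fun x =>
      N y x * (\sum_(i < 2) P (y i) x * (P (u' i) x - P (u i) x))).
    apply: bddmM; first by apply: (bddm_eucl_powR (c := fun i => P (y i))).
    apply: bddm_sum => i; apply: bddmM => //.
    rewrite (_ : (fun x => _) = lin (-1) (P (u i)) (P (u' i))).
      exact: bddm_lin.
    by apply/funext => x; rewrite /lin mulN1r addrC.
  exact: measurable_funB (b u').1 (b u).1.
- exact: measurable_funB (bF u').1 (bF u).1.
Qed.

Lemma lipschitz_measurable (phi : R -> R) L :
  (forall s t, `|phi s - phi t| <= L * `|s - t|) -> measurable_fun setT phi.
Proof.
move=> lip; apply: continuous_measurable_fun => s.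
apply/cvgrPdist_le => e e0; have L0 : 0 < `|L| + 1 by rewrite ltr_wpDl.
near=> t; apply: le_trans (lip s t) _.
apply: (@le_trans _ _ ((`|L| + 1) * `|s - t|)).
  by rewrite ler_wpM2r// (le_trans (ler_norm L))// lerDl.
rewrite mulrC -ler_pdivlMr//; near: t.
by apply: cvgr_dist_le; [exact: cvg_id|rewrite divr_gt0].
Unshelve. all: by end_near. Qed.

Lemma visc_int_lin (nu : R -> R) (M : R) c X u u' u'' w :
  measurable_fun setT nu -> (forall t, `|nu t| <= M) -> ae_linv c u u' u'' ->
  visc_int nu X u'' w = c * visc_int nu X u w + visc_int nu X u' w.
Proof.
move=> mnu bnu H.
have b y : bddm E.2 (fun x => nu (P X x) *
    \sum_(i < 2) \sum_(j < 2) G (y i) j x * G (w i) j x).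
  apply: bddmM; first exact: (bddm_comp mnu bnu (bP X)).
  by apply: bddm_sum => i; apply: bddm_sum => j; exact: bddmM.
apply: Rint_bddm_lin => //.
apply: filterS (ae_fin (fun i => ae_fin (fun j => ae_lin_grad j (H i)))) => x He Ex.
rewrite /lin mulrCA -mulrDr; congr (_ * _).
rewrite mulr_sumr -big_split/=; apply: eq_bigr => i _.
by apply: sum_linl => j; exact: He.
Qed.

Lemma diff_int_lin (kappa : R -> R) (M : R) c X v v' v'' s :
  measurable_fun setT kappa -> (forall t, `|kappa t| <= M) ->
  ae_lin c v v' v'' ->
  diff_int kappa X v'' s = c * diff_int kappa X v s + diff_int kappa X v' s.
Proof.
move=> mk bk H.
have b y : bddm E.2 (fun x => kappa (P X x) * \sum_(j < 2) G y j x * G s j x).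
  apply: bddmM; first exact: (bddm_comp mk bk (bP X)).
  by apply: bddm_sum => j; exact: bddmM.
apply: Rint_bddm_lin => //; apply: filterS (ae_fin (fun j => ae_lin_grad j H)) => x He Ex.
rewrite /lin mulrCA -mulrDr; congr (_ * _); apply: sum_linl => j; exact: He.
Qed.

Lemma stabV_lin SV c u u' u'' w : stabV_form k E SV ->
  Vvec_loc k E u -> Vvec_loc k E u' -> Vvec_loc k E u'' -> Vvec_loc k E w ->
  ae_linv c u u' u'' ->
  let Q y := fun i => y i \- P (y i) in
  SV (Q u'') (Q w) = c * SV (Q u) (Q w) + SV (Q u') (Q w).
Proof.
move=> [_ SVl SVae] Vu Vu' Vu'' Vw H Q.
have VQ y : Vvec_loc k E y -> Vvec_loc k E (Q y) by exact: Vvec_loc_subPi0.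
rewrite -SVl; [|exact: VQ..]; apply: SVae; [exact: VQ| |exact: VQ|].
  exact: (Vvec_loc_lin oE bE c (VQ _ Vu) (VQ _ Vu')).
move=> i; have [_ _ _ ui] := H i.
apply: filterS2 ui (ae_lin_proj (H i)) => x h1 h2 Ex.
by rewrite /Q /= h1// h2// /lin; ring.
Qed.

Lemma stabT_lin ST c v v' v'' s : stabT_form k E ST ->
  Vsca_loc k E v -> Vsca_loc k E v' -> Vsca_loc k E v'' -> Vsca_loc k E s ->
  ae_lin c v v' v'' ->
  let Q y := y \- P y in
  ST (Q v'') (Q s) = c * ST (Q v) (Q s) + ST (Q v') (Q s).
Proof.
move=> [_ STl STae] Vv Vv' Vv'' Vs H Q.
have VQ y : Vsca_loc k E y -> Vsca_loc k E (Q y) by exact: Vsca_loc_subPi0.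
rewrite -STl; [|exact: VQ..]; apply: STae; [exact: VQ| |exact: VQ|].
  exact: (Vsca_loc_lin oE bE c (VQ _ Vv) (VQ _ Vv')).
have [_ _ _ vi] := H.
apply: filterS2 vi (ae_lin_proj H) => x h1 h2 Ex.
by rewrite /Q /= h1// h2// /lin; ring.
Qed.

End ElementForms.

(** * The discrete spaces and forms on the domain *)

Section Global.
Context (R : realType).
Local Notation mu := (@mu2 R).
Variables (Omega : set (plane R)) (k : nat) (T : seq (polygon R)).
Hypotheses (oO : open Omega) (bO : bounded_set Omega).
Hypothesis hT : forall E, E \in T ->
  [/\ open E.2, bounded_set E.2 & E.2 `<=` Omega].
Implicit Types (v s X q : R * R -> R) (u w z : vfield R).

Let mO : pmeasurable R Omega := open_measurable2 oO.

Lemma H10_lin c v v' : H10 Omega v -> H10 Omega v' -> H10 Omega (lin c v v').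
Proof.
move=> [Hv av] [Hv' av']; split; first exact: H1_lin.
move=> e e0; have c2 : 0 < `|c| + 2 by rewrite ltr_wpDl.
pose d := e / (`|c| + 2).
have d0 : 0 < d by rewrite divr_gt0.
have [phi cp [p1 p2]] := av _ d0; have [phi' cp' [p1' p2']] := av' _ d0.
exists (lin c phi phi'); first exact: Cc1_lin.
have sphi f : Cc1 Omega f -> sqint mu Omega f.
  by move=> cf; apply: (bddm_sqint mO bO); exact: Cc1_bddm.
have sdphi j f : Cc1 Omega f -> sqint mu Omega (pder j f).
  by move=> cf; apply: (bddm_sqint mO bO); exact: Cc1_pder_bddm.
have small f g : sqint mu Omega f -> sqint mu Omega g ->
    nrm mu Omega f < d -> nrm mu Omega g < d -> nrm mu Omega (lin c f g) < e.
  move=> sf sg fd gd; apply: le_lt_trans (nrm_lin c mO sf sg) _.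
  have -> : e = `|c| * d + (d + d).
    by rewrite /d; field; apply: lt0r_neq0.
  apply: ler_ltD; first by apply: ler_wpM2l => //; exact: ltW.
  by apply: lt_trans gd _; rewrite ltrDl.
rewrite !normLE// in p1 p1' *; split.
  rewrite (_ : _ \- _ = lin c (v \- phi) (v' \- phi')); last first.
    by apply/funext => x; rewrite /lin /=; ring.
  by apply: small p1 p1'; apply: (sqint_sub mO);
    [exact: H1_sqint|exact: sphi|exact: H1_sqint|exact: sphi].
move=> j; have := p2 j; have := p2' j; rewrite !normLE// => q2' q2.
have sw := wpartial_sqint oO j Hv; have sw' := wpartial_sqint oO j Hv'.
have sd := sdphi j _ cp; have sd' := sdphi j _ cp'.
have s1 := sqint_sub mO sw sd; have s2 := sqint_sub mO sw' sd'.
apply: le_lt_trans (small _ _ s1 s2 q2 q2'); rewrite le_eqVlt; apply/orP; left.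
apply/eqP; apply: (nrm_ae mO).
- have := H1_lin oO bO c Hv Hv' => /(wpartial_meas oO j) m.
  exact: measurable_funB m (sdphi j _ (Cc1_lin c cp cp')).1.
- exact: (sqint_lin c mO s1 s2).1.
- apply: filterS (wpartial_lin oO bO c j Hv Hv') => x H Ox.
  have [Cp _ _] := cp; have [Cp' _ _] := cp'.
  by rewrite /= H// (C1_lin c Cp Cp').2 /lin /=; ring.
Qed.

Lemma Vvec_lin c u u' : Vvec Omega k T u -> Vvec Omega k T u' ->
  Vvec Omega k T (linv c u u').
Proof.
move=> [Hu Vu] [Hu' Vu']; split; first by move=> i; exact: H10_lin.
move=> E ET; have [oE bE _] := hT ET.
exact: (Vvec_loc_lin oE bE c (Vu E ET) (Vu' E ET)).
Qed.

Lemma Vsca_lin c v v' : Vsca Omega k T v -> Vsca Omega k T v' ->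
  Vsca Omega k T (lin c v v').
Proof.
move=> [Hv Vv] [Hv' Vv']; split; first exact: H10_lin.
move=> E ET; have [oE bE _] := hT ET.
exact: (Vsca_loc_lin oE bE c (Vv E ET) (Vv' E ET)).
Qed.

Lemma Qh_lin c q q' : Qh Omega k T q -> Qh Omega k T q' ->
  Qh Omega k T (lin c q q').
Proof.
move=> [Lq Pq] [Lq' Pq']; split; first exact: L20_lin.
by move=> E ET; apply: inPn_lin; [exact: Pq|exact: Pq'].
Qed.

(** As on one element, the relation makes invariance under almost everywhere
    equality the case [c = 0] of linearity. *)
Definition sca_lin c v v' v'' :=
  [/\ Vsca Omega k T v, Vsca Omega k T v', Vsca Omega k T v'' &
      ae_eq mu Omega v'' (lin c v v')].

Definition vec_lin c u u' u'' :=
  [/\ Vvec Omega k T u, Vvec Omega k T u', Vvec Omega k T u'' &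
      forall i, ae_eq mu Omega (u'' i) (lin c (u i) (u' i))].

Lemma sca_lin_loc c v v' v'' E : E \in T -> sca_lin c v v' v'' ->
  ae_lin E c v v' v''.
Proof.
move=> ET [[_ V] [_ V'] [_ V''] H]; have [_ _ EO] := hT ET.
split; [exact: Vsca_loc_H1 (V _ ET)|exact: Vsca_loc_H1 (V' _ ET)
  |exact: Vsca_loc_H1 (V'' _ ET)|].
by apply: filterS H => x H /EO; exact: H.
Qed.

Lemma vec_lin_loc c u u' u'' E : E \in T -> vec_lin c u u' u'' ->
  ae_linv E c u u' u''.
Proof.
move=> ET [[_ V] [_ V'] [_ V''] H] i; have [_ _ EO] := hT ET.
split; [exact: Vvec_loc_H1 (V _ ET) i|exact: Vvec_loc_H1 (V' _ ET) i
  |exact: Vvec_loc_H1 (V'' _ ET) i|].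
by apply: filterS (H i) => x Hx /EO; exact: Hx.
Qed.

Lemma sum_lin_seq (I : eqType) (r : seq I) (c : R) (F F' F'' : I -> R) :
  (forall i, i \in r -> F'' i = c * F i + F' i) ->
  \sum_(i <- r) F'' i = c * (\sum_(i <- r) F i) + \sum_(i <- r) F' i.
Proof.
by move=> H; rewrite mulr_sumr -big_split/= big_seq [RHS]big_seq; apply: eq_bigr.
Qed.

Lemma sum_le_seq (I : eqType) (r : seq I) (F G : I -> R) :
  (forall i, i \in r -> F i <= G i) -> \sum_(i <- r) F i <= \sum_(i <- r) G i.
Proof. by move=> H; rewrite big_seq [leRHS]big_seq; exact: ler_sum. Qed.

Lemma lin_stab (c n a a' a'' s s' s'' : R) : a'' = c * a + a' ->
  s'' = c * s + s' -> a'' + n * s'' = c * (a + n * s) + (a' + n * s').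
Proof. by move=> -> ->; ring. Qed.

Lemma ah_lin (nu : R -> R) (M : R) SV c X u u' u'' w :
  measurable_fun setT nu -> (forall t, `|nu t| <= M) ->
  (forall E, E \in T -> stabV_form k E (SV E)) ->
  vec_lin c u u' u'' -> Vvec Omega k T w ->
  ah k nu SV T X u'' w = c * ah k nu SV T X u w + ah k nu SV T X u' w.
Proof.
move=> mn bn hS H [_ Vw]; apply: sum_lin_seq => E ET.
have [oE bE _] := hT ET; have HE := vec_lin_loc ET H.
have [[_ V] [_ V'] [_ V''] _] := H.
have h1 := visc_int_lin k oE bE X w mn bn HE.
have h2 := stabV_lin oE bE (hS E ET) (V E ET) (V' E ET) (V'' E ET) (Vw E ET) HE.
exact: lin_stab h1 h2.
Qed.

Lemma aTh_lin (kappa : R -> R) (M : R) ST c X v v' v'' s :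
  measurable_fun setT kappa -> (forall t, `|kappa t| <= M) ->
  (forall E, E \in T -> stabT_form k E (ST E)) ->
  sca_lin c v v' v'' -> Vsca Omega k T s ->
  aTh k kappa ST T X v'' s = c * aTh k kappa ST T X v s + aTh k kappa ST T X v' s.
Proof.
move=> mn bn hS H [_ Vs]; apply: sum_lin_seq => E ET.
have [oE bE _] := hT ET; have HE := sca_lin_loc ET H.
have [[_ V] [_ V'] [_ V''] _] := H.
have h1 := diff_int_lin k oE bE X s mn bn HE.
have h2 := stabT_lin oE bE (hS E ET) (V E ET) (V' E ET) (V'' E ET) (Vs E ET) HE.
exact: lin_stab h1 h2.
Qed.

Lemma cNh_lin1 c z z' z'' u w : vec_lin c z z' z'' ->
  cNh k T z'' u w = c * cNh k T z u w + cNh k T z' u w.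
Proof.
move=> H; apply: sum_lin_seq => E ET; have [oE bE _] := hT ET.
exact: conv_int_lin1 (vec_lin_loc ET H).
Qed.

Lemma cNh_lin2 c z u u' u'' w : vec_lin c u u' u'' ->
  cNh k T z u'' w = c * cNh k T z u w + cNh k T z u' w.
Proof.
move=> H; apply: sum_lin_seq => E ET; have [oE bE _] := hT ET.
exact: conv_int_lin2 (vec_lin_loc ET H).
Qed.

Lemma cNh_lin3 c z u w w' w'' : vec_lin c w w' w'' ->
  cNh k T z u w'' = c * cNh k T z u w + cNh k T z u w'.
Proof.
move=> H; apply: sum_lin_seq => E ET; have [oE bE _] := hT ET.
exact: conv_int_lin3 (vec_lin_loc ET H).
Qed.

Lemma cTh_lin1 c u u' u'' v s : vec_lin c u u' u'' ->
  cTh k T u'' v s = c * cTh k T u v s + cTh k T u' v s.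
Proof.
move=> H; apply: sum_lin_seq => E ET; have [oE bE _] := hT ET.
exact: heat_conv_int_lin1 (vec_lin_loc ET H).
Qed.

Lemma cTh_lin2 c u v v' v'' s : sca_lin c v v' v'' ->
  cTh k T u v'' s = c * cTh k T u v s + cTh k T u v' s.
Proof.
move=> H; apply: sum_lin_seq => E ET; have [oE bE _] := hT ET.
exact: heat_conv_int_lin2 (sca_lin_loc ET H).
Qed.

Lemma cTh_lin3 c u v s s' s'' : sca_lin c s s' s'' ->
  cTh k T u v s'' = c * cTh k T u v s + cTh k T u v s'.
Proof.
move=> H; apply: sum_lin_seq => E ET; have [oE bE _] := hT ET.
exact: heat_conv_int_lin3 (sca_lin_loc ET H).
Qed.

Lemma lin_skew (c a a' a'' b b' b'' : R) : a'' = c * a + a' ->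
  b'' = c * b + b' ->
  2^-1 * (a'' - b'') = c * (2^-1 * (a - b)) + 2^-1 * (a' - b').
Proof. by move=> -> ->; ring. Qed.

Lemma cNskew_lin1 c z z' z'' u w : vec_lin c z z' z'' ->
  cNskew k T z'' u w = c * cNskew k T z u w + cNskew k T z' u w.
Proof. by move=> H; exact: lin_skew (cNh_lin1 _ _ H) (cNh_lin1 _ _ H). Qed.

Lemma cNskew_lin2 c z u u' u'' w : vec_lin c u u' u'' ->
  cNskew k T z u'' w = c * cNskew k T z u w + cNskew k T z u' w.
Proof. by move=> H; exact: lin_skew (cNh_lin2 _ _ H) (cNh_lin3 _ _ H). Qed.

Lemma cTskew_lin1 c u u' u'' v s : vec_lin c u u' u'' ->
  cTskew k T u'' v s = c * cTskew k T u v s + cTskew k T u' v s.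
Proof. by move=> H; exact: lin_skew (cTh_lin1 _ _ H) (cTh_lin1 _ _ H). Qed.

Lemma cTskew_lin2 c u v v' v'' s : sca_lin c v v' v'' ->
  cTskew k T u v'' s = c * cTskew k T u v s + cTskew k T u v' s.
Proof. by move=> H; exact: lin_skew (cTh_lin2 _ _ H) (cTh_lin3 _ _ H). Qed.

Lemma cNskewC z u w : cNskew k T z u w = - cNskew k T z w u.
Proof. by rewrite /cNskew -mulrN opprB. Qed.

Lemma cTskewC u v s : cTskew k T u v s = - cTskew k T u s v.
Proof. by rewrite /cTskew -mulrN opprB. Qed.

Lemma cNskew_diag z u : cNskew k T z u u = 0.
Proof. by rewrite /cNskew subrr mulr0. Qed.

Lemma cTskew_diag u v : cTskew k T u v v = 0.
Proof. by rewrite /cTskew subrr mulr0. Qed.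

Lemma dh_lin1 c u u' u'' w : vec_lin c u u' u'' ->
  dh k T u'' w = c * dh k T u w + dh k T u' w.
Proof.
move=> H; apply: sum_lin_seq => E ET; have [oE bE _] := hT ET.
exact: drag_int_lin1 (vec_lin_loc ET H).
Qed.

Lemma dh_ge0 u : 0 <= dh k T u u.
Proof. by apply: sumr_ge0 => E _; exact: drag_int_ge0. Qed.

Lemma cFh_ge0 (r : R) u : 0 <= cFh k r T u u u.
Proof. by apply: sumr_ge0 => E _; exact: forch_int_ge0. Qed.

Lemma cFh_mono (r : R) u u' e : 2 <= r -> vec_lin (-1) u u' e ->
  cFh k r T u u e <= cFh k r T u' u' e.
Proof.
move=> r2 H; apply: sum_le_seq => E ET.
have [oE bE _] := hT ET; exact: forch_int_mono (vec_lin_loc ET H).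
Qed.

(** Needed besides monotonicity: the form is not linear in its argument. *)
Lemma cFh_congr (r : R) u u' w : 2 <= r -> vec_lin 0 u u u' ->
  cFh k r T u' u' w = cFh k r T u u w.
Proof.
move=> r2 H; apply: eq_big_seq => E ET.
have [oE bE _] := hT ET; exact: forch_int_congr (vec_lin_loc ET H).
Qed.

Lemma Vvec_H1 u i : Vvec Omega k T u -> H1 Omega (u i).
Proof. by move=> [Hu _]; case: (Hu i). Qed.

Lemma divg_sqint u : Vvec Omega k T u -> sqint mu Omega (divg Omega u).
Proof.
move=> Vu; apply: (sqint_sum mO) => i.
by apply: wpartial_sqint => //; exact: Vvec_H1.
Qed.

Lemma Qh_sqint q : Qh Omega k T q -> sqint mu Omega q.
Proof. by move=> [[/(Lp2P _ mO)]]. Qed.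

Lemma bform_linu c u u' q : Vvec Omega k T u -> Vvec Omega k T u' ->
  Qh Omega k T q ->
  bform Omega (linv c u u') q = c * bform Omega u q + bform Omega u' q.
Proof.
move=> Vu Vu' Qq; have sq := Qh_sqint Qq.
have su := divg_sqint Vu; have su' := divg_sqint Vu'.
have sl := divg_sqint (Vvec_lin c Vu Vu').
rewrite /bform mulrN -opprD; congr (- _).
apply: (Rint_lin_ae mO) => //; [|exact: sqint_mul|exact: sqint_mul|].
  exact: measurable_funM sq.1 sl.1.
have := divg_lin oO bO c (fun i => Vvec_H1 i Vu) (fun i => Vvec_H1 i Vu').
by apply: filterS => x H Ox; rewrite H// /lin; ring.
Qed.

Lemma bform_linq c u q q' : Vvec Omega k T u -> Qh Omega k T q ->
  Qh Omega k T q' ->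
  bform Omega u (lin c q q') = c * bform Omega u q + bform Omega u q'.
Proof.
move=> Vu Qq Qq'; have su := divg_sqint Vu.
have sq := Qh_sqint Qq; have sq' := Qh_sqint Qq'.
rewrite /bform mulrN -opprD -(Rint_lin c mO (sqint_mul mO sq su) (sqint_mul mO sq' su)).
by congr (- _); apply: eq_Rintegral => x _; rewrite /lin; ring.
Qed.

Lemma data_sqint g : sqint mu Omega (data_h k T g).
Proof.
apply: (bddm_sqint mO bO); rewrite /data_h.
have : {subset T <= T} by [].
elim: {1 3}T => [_|E r IH rT].
  by under [fun x => _]funext => x do rewrite big_nil; exact: bddm_cst.
under [fun x => _]funext => x do rewrite big_cons.
apply: bddmD; last by apply: IH => F Fr; apply: rT; rewrite inE Fr orbT.
have [oE _ _] := hT (rT E (mem_head _ _)).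
apply: bddmM; last exact: (Pn_bddm oO bO (Pi0_Pn _ _ _)).
split; first exact: measurable_indic (open_measurable2 oE).
by exists 1 => x _; rewrite indicE; case: (_ \in _); rewrite ?normr1 ?normr0.
Qed.

Lemma normL_ge0 v : 0 <= normL Omega 2 v.
Proof. by rewrite normLE// nrm_ge0. Qed.

Lemma semiH1_ge0 v : 0 <= semiH1 Omega v.
Proof. exact: sqrtr_ge0. Qed.

Lemma semiH1v_ge0 u : 0 <= semiH1v Omega u.
Proof. exact: sqrtr_ge0. Qed.

Lemma normL_le_normH1 v : normL Omega 2 v <= normH1 Omega v.
Proof.
rewrite -[leLHS]ger0_norm ?normL_ge0// -sqrtr_sqr ler_wsqrtr// lerDl.
exact: sqr_ge0.
Qed.

Lemma normLv_le_normH1v u : normLv Omega u <= normH1v Omega u.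
Proof.
rewrite -[leLHS]ger0_norm ?sqrtr_ge0// -sqrtr_sqr ler_wsqrtr// lerDl.
exact: sqr_ge0.
Qed.

Lemma data_bound g v : sqint mu Omega v ->
  \int[mu]_(x in Omega) (data_h k T g x * v x)
  <= normL Omega 2 (data_h k T g) * normL Omega 2 v.
Proof.
move=> sv; rewrite !normLE//; apply: le_trans (ler_norm _) _.
exact: (cauchy_schwarz mO (data_sqint g) sv).
Qed.

Lemma datav_bound (f : vfield R) u : (forall i, sqint mu Omega (u i)) ->
  \int[mu]_(x in Omega) (\sum_(i < 2) data_h k T (f i) x * u i x)
  <= normLv Omega (fun i => data_h k T (f i)) * normLv Omega u.
Proof.
move=> su; rewrite Rint_sum//; last first.
  by move=> i; exact: (sqint_mul mO (data_sqint _) (su i)).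
apply: le_trans (dot_le_eucl _ _); apply: ler_sum => i _.
exact: data_bound.
Qed.

Lemma semiH1_eq0 (C : R) v : H10 Omega v ->
  normH1 Omega v <= C * semiH1 Omega v -> semiH1 Omega v = 0 ->
  ae_eq mu Omega v (cst 0).
Proof.
move=> [Hv _] Pv v0; apply: nrm0_ae => //; first exact: H1_sqint.
apply/eqP; rewrite eq_le nrm_ge0 andbT -normLE//.
by apply: le_trans (normL_le_normH1 v) _; rewrite v0 mulr0 in Pv.
Qed.

Lemma semiH1v_eq0 u : semiH1v Omega u = 0 -> forall i, semiH1 Omega (u i) = 0.
Proof.
move=> /eqP; rewrite sqrtr_eq0 => u0 i; apply/eqP; rewrite -sqrf_eq0.
rewrite eq_le sqr_ge0 andbT (le_trans _ u0)// (bigD1 i)//= lerDl.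
by apply: sumr_ge0 => j _; exact: sqr_ge0.
Qed.

(** All quotients in the supremum vanish, and the supremum of the empty set is
    zero by convention. *)
Lemma infsup_eq0 (b : R) q : 0 < b -> Qh Omega k T q ->
  b * normL Omega 2 q <=
    sup [set t | exists w, [/\ Vvec Omega k T w, semiH1v Omega w != 0 &
                            t = bform Omega w q / semiH1v Omega w]] ->
  (forall w, Vvec Omega k T w -> bform Omega w q = 0) ->
  ae_eq mu Omega q (cst 0).
Proof.
move=> b0 Qq + bq; set S := [set _ | _] => H.
have S0 : sup S <= 0.
  have [->|/set0P nS] := eqVneq S set0; first by rewrite sup0.
  by apply: ge_sup => // _ [v [Vv _ ->]]; rewrite bq// mul0r.
apply: nrm0_ae => //; first exact: Qh_sqint.
apply/eqP; rewrite eq_le nrm_ge0 andbT -normLE//.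
by rewrite -(pmulr_rle0 _ b0); exact: le_trans H S0.
Qed.

End Global.

(** * The energy estimates *)

Section EnergyEstimates.
Variable R : realFieldType.

(** The a priori bound: [X] is the power of the source, bounded by Cauchy-Schwarz
    and by the Poincare inequality [n <= C t]. *)
Lemma energy_bound (a C G n t X : R) : 0 <= a -> 0 <= C -> 0 <= G -> 0 <= t ->
  a * t ^+ 2 <= X -> X <= G * n -> n <= C * t -> a * t <= C * G.
Proof.
move=> a0 C0 G0 t0 aX XG nC; have [->|tn] := eqVneq t 0.
  by rewrite mulr0 mulr_ge0.
have tp : 0 < t by rewrite lt0r tn.
rewrite -(ler_pM2r tp); have := ler_wpM2l G0 nC.
by nra.
Qed.

(** The next three lemmas subtract the equations of the given solution (suffix
    [0] or [00]) from those of another one (suffix [p] or [pp]), tested with the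
    same function; in the third lemma primes mark the other solution. The
    letters [a], [c], [f], [d], [b] stand for the diffusion, convection,
    Forchheimer, drag and pressure forms; [as_] and [cps] are the values with
    the coefficient, resp. the transport field, of the other solution and the
    remaining argument of the given one; [ad], [ce], [dd] have the difference of
    the solutions as argument. The equation [0 = -1 * cps + cpp] is the
    vanishing of the skew-symmetric convection on the diagonal. *)
Lemma heat_difference (ad as_ a0 ap cpp cps c00 ce l : R) :
  ap + cpp = l -> a0 + c00 = l -> ad = -1 * as_ + ap -> 0 = -1 * cps + cpp ->
  ce = -1 * c00 + cps -> ad = (a0 - as_) - ce.
Proof. by lra. Qed.

Lemma momentum_difference
  (ad as_ a0 ap cpp cps c00 ce fp f0 dp d0 dd bp b0 l : R) :
  ap + cpp + fp + dp + bp = l -> a0 + c00 + f0 + d0 + b0 = l ->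
  ad = -1 * as_ + ap -> 0 = -1 * cps + cpp -> ce = -1 * c00 + cps ->
  f0 <= fp -> dd = -1 * d0 + dp -> 0 <= dd -> bp = 0 -> b0 = 0 ->
  ad <= (a0 - as_) - ce.
Proof. by lra. Qed.

Lemma pressure_difference (a a' c c' f f' d d' b b' l bd : R) :
  a' + c' + f' + d' + b' = l -> a + c + f + d + b = l ->
  a' = a -> c' = c -> f' = f -> d' = d -> bd = -1 * b + b' -> bd = 0.
Proof. by lra. Qed.

(** Here [x], [y] are the norms of the differences of the velocities and of the
    temperatures, [s], [t] those of the velocity and of the temperature of the
    given solution, [a], [b] the coercivity constants of the diffusion forms,
    [V] and [K] bound their variation with the temperature, and [M], [N] bound
    the convection. The heat equation gives [y <= M t x / (b - K)]; inserted in
    the momentum equation, it yields [x ^ 2 <= theta x ^ 2] with [theta < 1]. *)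
Lemma smallness_absorption (a b C F G K M N V s t x y : R) :
  0 < a -> 0 < b -> 0 <= M -> 0 <= N -> 0 <= V ->
  0 <= x -> 0 <= y -> 0 <= t -> K < b ->
  b * y ^+ 2 <= K * y ^+ 2 + M * x * y * t ->
  a * x ^+ 2 <= V * y * x + N * x ^+ 2 * s ->
  a * s <= C * F -> b * t <= C * G ->
  V * M * C * G / (a * b * (b - K)) + N * C / a ^+ 2 * F < 1 ->
  x = 0 /\ y = 0.
Proof.
move=> a0 b0 M0 N0 V0 x0 y0 t0 Kb heat mom sF tG.
set q1 := V * M * C * G / _; set q2 := N * C / _ * F => small.
have D0 : 0 < b - K by rewrite subr_gt0.
have yx : (b - K) * y <= M * x * t.
  have [y00|yn] := eqVneq y 0; first by rewrite y00 mulr0 !mulr_ge0.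
  have yp : 0 < y by rewrite lt0r yn.
  by rewrite -(ler_pM2r yp); move: heat; lra.
have Vy : V * y <= a * q1 * x.
  have -> : a * q1 * x = V * (M * C * G * x / (b * (b - K))).
    by rewrite /q1; field; rewrite !gt_eqF.
  apply: ler_wpM2l => //; rewrite ler_pdivlMr ?mulr_gt0//.
  have := ler_wpM2l (mulr_ge0 M0 x0) tG; have := ler_wpM2l (ltW b0) yx; lra.
have Ns : N * s <= a * q2.
  have -> : a * q2 = N * (C * F / a) by rewrite /q2; field; rewrite gt_eqF.
  by apply: ler_wpM2l => //; rewrite ler_pdivlMr// mulrC.
have x00 : x = 0.
  apply/eqP; rewrite -sqrf_eq0 eq_le sqr_ge0 andbT.
  have H : a * (1 - (q1 + q2)) * x ^+ 2 <= 0.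
    have h1 := ler_wpM2r x0 Vy; have h2 := ler_wpM2r (sqr_ge0 x) Ns; lra.
  have H0 : 0 < a * (1 - (q1 + q2)) by rewrite mulr_gt0// subr_gt0.
  by rewrite -(pmulr_rle0 _ H0).
split=> //; apply/eqP; rewrite eq_le y0 andbT -(pmulr_rle0 _ D0).
by rewrite x00 mulr0 mul0r in yx.
Qed.

End EnergyEstimates.

Theorem theorem7p4 (R : realType)
  (* domain and data *)
  (Omega : set (R * R)) (r : R) (f : vfield R) (g : R * R -> R)
  (hOmega : polygonal_domain Omega) (hLip : lipschitz_boundary Omega)
  (hr : 3 <= r <= 4)
  (hf : forall i, Lp Omega 2 (f i)) (hg : Lp Omega 2 g)
  (* Poincare constant *)
  (CP : R) (hCP0 : 0 < CP)
  (hCP : forall v, H10 Omega v -> normH1 Omega v <= CP * semiH1 Omega v)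
  (hCPv : forall v : vfield R, (forall i, H10 Omega (v i)) ->
     normH1v Omega v <= CP * semiH1v Omega v)
  (* the meshes T h, h in H, and the polynomial degree *)
  (H : set R) (T : R -> seq (polygon R)) (rho : R) (k : nat)
  (hrho : 0 < rho)
  (hH : forall h, H h -> 0 < h)
  (hT : forall h, H h -> is_decomposition Omega (T h))
  (hTh : forall h, H h -> h = meshsize (T h))
  (hTreg : forall h, H h -> forall E, E \in T h -> shape_regular rho E)
  (* the coefficients *)
  (kappa nu : R -> R)
  (kappa_low kappa_up kappa_lip nu_low nu_up nu_lip : R)
  (hk_low : 0 < kappa_low) (hk_up : 0 < kappa_up) (hk_lip : 0 < kappa_lip)
  (hn_low : 0 < nu_low) (hn_up : 0 < nu_up) (hn_lip : 0 < nu_lip)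
  (hkappa : forall t, kappa_low <= kappa t <= kappa_up)
  (hkappaL : forall t1 t2, `|kappa t1 - kappa t2| <= kappa_lip * `|t1 - t2|)
  (hnu : forall t, nu_low <= nu t <= nu_up)
  (hnuL : forall t1 t2, `|nu t1 - nu t2| <= nu_lip * `|t1 - t2|)
  (* the stabilizations *)
  (SV : polygon R -> vfield R -> vfield R -> R)
  (ST : polygon R -> (R * R -> R) -> (R * R -> R) -> R)
  (hSV : forall h, H h -> forall E, E \in T h -> stabV_form k E (SV E))
  (hST : forall h, H h -> forall E, E \in T h -> stabT_form k E (ST E))
  (hSVb : exists c C : R, [/\ 0 < c, 0 < C &
     forall h, H h -> forall E, E \in T h -> stabV_bounds k c C E (SV E)])
  (hSTb : exists c C : R, [/\ 0 < c, 0 < C &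
     forall h, H h -> forall E, E \in T h -> stabT_bounds k c C E (ST E)])
  (* coercivity, continuity and inf-sup constants *)
  (alpha beta CN CT_hat beta_is : R)
  (halpha : 0 < alpha) (hbeta : 0 < beta) (hCN : 0 < CN)
  (hCT_hat : 0 < CT_hat) (hbeta_is : 0 < beta_is)
  (h_ah : forall h, H h -> forall X v,
     Vsca Omega k (T h) X -> Vvec Omega k (T h) v ->
     alpha * nu_low * semiH1v Omega v ^+ 2 <= ah k nu SV (T h) X v v)
  (h_aTh : forall h, H h -> forall X S,
     Vsca Omega k (T h) X -> Vsca Omega k (T h) S ->
     beta * kappa_low * semiH1 Omega S ^+ 2 <= aTh k kappa ST (T h) X S S)
  (h_cN : forall h, H h -> forall z v w,
     Vvec Omega k (T h) z -> Vvec Omega k (T h) v -> Vvec Omega k (T h) w ->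
     cNskew k (T h) z v w
       <= CN * semiH1v Omega z * semiH1v Omega v * semiH1v Omega w)
  (h_cT : forall h, H h -> forall v Q S,
     Vvec Omega k (T h) v -> Vsca Omega k (T h) Q -> Vsca Omega k (T h) S ->
     cTskew k (T h) v Q S
       <= CT_hat * semiH1v Omega v * semiH1 Omega Q * semiH1 Omega S)
  (h_infsup : forall h, H h -> forall q, Qh Omega k (T h) q ->
     beta_is * normL Omega 2 q <=
       sup [set s | exists v, [/\ Vvec Omega k (T h) v, semiH1v Omega v != 0 &
                              s = bform Omega v q / semiH1v Omega v]])
  (* Lipschitz properties for the exponent q *)
  (q CV CT : R) (hq : 2 < q) (hCV : 0 < CV) (hCT : 0 < CT)
  (h_ahL : forall h, H h -> forall X S v w,
     Vsca Omega k (T h) X -> Vsca Omega k (T h) S ->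
     Vvec Omega k (T h) v -> (forall i, W1broken Omega (T h) q (v i)) ->
     Vvec Omega k (T h) w ->
     `|ah k nu SV (T h) X v w - ah k nu SV (T h) S v w| <=
       CV * nu_lip * semiH1 Omega (X \- S) * semiW1v (T h) q v
         * semiH1v Omega w)
  (h_aThL : forall h, H h -> forall X S Q P,
     Vsca Omega k (T h) X -> Vsca Omega k (T h) S ->
     Vsca Omega k (T h) Q -> W1broken Omega (T h) q Q ->
     Vsca Omega k (T h) P ->
     `|aTh k kappa ST (T h) X Q P - aTh k kappa ST (T h) S Q P| <=
       CT * kappa_lip * semiH1 Omega (X \- S) * semiW1 (T h) q Q
         * semiH1 Omega P)
  (* the solution *)
  (h : R) (hh : H h) (u : vfield R) (p th : R * R -> R)
  (hu : Zh Omega k (T h) u)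
  (hsol : is_discrete_solution Omega k r nu kappa SV ST f g (T h) u p th)
  (hu_q : forall i, W1broken Omega (T h) q (u i))
  (hth_q : W1broken Omega (T h) q th)
  (hsmall :
     (CV * nu_lip * CT_hat * CP * normL Omega 2 (data_h k (T h) g)
        * semiW1v (T h) q u)
       / (alpha * nu_low * beta * kappa_low
          * (beta * kappa_low - CT * kappa_lip * semiW1 (T h) q th))
     + CN * CP / (alpha ^+ 2 * nu_low ^+ 2)
         * normLv Omega (fun i => data_h k (T h) (f i))
     < 1)
  (hsmallT : CT * kappa_lip * semiW1 (T h) q th < beta * kappa_low) :
  forall (u' : vfield R) (p' th' : R * R -> R),
    is_discrete_solution Omega k r nu kappa SV ST f g (T h) u' p' th' ->
    [/\ forall i, ae_eq (@mu2 R) Omega (u' i) (u i),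
        ae_eq (@mu2 R) Omega p' p & ae_eq (@mu2 R) Omega th' th].
Proof.
move=> u' p' th' hsol'.
have [oO _ _ bO _] := hOmega.
have mO := open_measurable2 oO.
have hTE E : E \in T h -> [/\ open E.2, bounded_set E.2 & E.2 `<=` Omega].
  by move=> ET; have [_ /(_ E ET)[[_ _ [oE _ _ bE] _] EO] _ _] := hT h hh; split.
have [Vu Qp Vt sol] := hsol; have [Vu' Qp' Vt' sol'] := hsol'.
have r2 : 2 <= r by case/andP: hr => + _; lra.
have mnu := lipschitz_measurable hnuL; have mka := lipschitz_measurable hkappaL.
have bnu t : `|nu t| <= nu_up.
  by have /andP[n1 n2] := hnu t; rewrite ger0_norm// (le_trans (ltW hn_low)).
have bka t : `|kappa t| <= kappa_up.
  by have /andP[n1 n2] := hkappa t; rewrite ger0_norm// (le_trans (ltW hk_low)).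
have sU i : sqint (@mu2 R) Omega (u i) := H1_sqint oO (Vvec_H1 i Vu).
have sth : sqint (@mu2 R) Omega th := H1_sqint oO Vt.1.1.
(* the equations are quantified jointly over three test functions: the solution
   itself serves for those that an equation does not contain *)
have Mom w : Vvec Omega k (T h) w -> _ := fun Vw =>
  let: And3 E _ _ := sol w p th Vw Qp Vt in E.
have Mom' w : Vvec Omega k (T h) w -> _ := fun Vw =>
  let: And3 E _ _ := sol' w p' th' Vw Qp' Vt' in E.
have Div s : Qh Omega k (T h) s -> _ := fun Qs =>
  let: And3 _ E _ := sol u s th Vu Qs Vt in E.
have Div' s : Qh Omega k (T h) s -> _ := fun Qs =>
  let: And3 _ E _ := sol' u' s th' Vu' Qs Vt' in E.
have Heat s : Vsca Omega k (T h) s -> _ := fun Vs =>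
  let: And3 _ _ E := sol u p s Vu Qp Vs in E.
have Heat' s : Vsca Omega k (T h) s -> _ := fun Vs =>
  let: And3 _ _ E := sol' u' p' s Vu' Qp' Vs in E.
have a0 : 0 < alpha * nu_low by exact: mulr_gt0.
have b0 : 0 < beta * kappa_low by exact: mulr_gt0.
pose e := linv (-1) u u'; pose d := lin (-1) th th'.
have Ve : Vvec Omega k (T h) e := Vvec_lin oO bO hTE (-1) Vu Vu'.
have Vd : Vsca Omega k (T h) d := Vsca_lin oO bO hTE (-1) Vt Vt'.
have Le : vec_lin Omega k (T h) (-1) u u' e by split=> // i; exact: ae_eq_refl.
have Ld : sca_lin Omega k (T h) (-1) th th' d by split=> //; exact: ae_eq_refl.
have dE : th' \- th = d by apply/funext => x; rewrite /d /lin /= mulN1r addrC.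
have fh0 : 0 <= normLv Omega (fun i => data_h k (T h) (f i)) by exact: sqrtr_ge0.
have gh0 : 0 <= normL Omega 2 (data_h k (T h) g) := normL_ge0 oO _.
have tG : beta * kappa_low * semiH1 Omega th
    <= CP * normL Omega 2 (data_h k (T h) g).
  apply: (energy_bound (ltW b0) (ltW hCP0) gh0 (semiH1_ge0 _ _)
    (h_aTh h hh _ _ Vt Vt) _ (le_trans (normL_le_normH1 oO th) (hCP _ Vt.1))).
  have := Heat th Vt; rewrite cTskew_diag addr0 => ->.
  exact: (data_bound k oO bO hTE g sth).
have sF : alpha * nu_low * semiH1v Omega u
    <= CP * normLv Omega (fun i => data_h k (T h) (f i)).
  apply: (energy_bound (ltW a0) (ltW hCP0) fh0 (semiH1v_ge0 _ _)
    (h_ah h hh _ _ Vt Vu) _ (le_trans (normLv_le_normH1v Omega u) (hCPv _ Vu.1))).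
  have := datav_bound k oO bO hTE f sU; apply: le_trans.
  rewrite -(Mom u Vu) cNskew_diag (Div p Qp) !addr0 -addrA lerDl addr_ge0//.
    exact: cFh_ge0.
  exact: dh_ge0.
(* heat equations tested with [d]: the transport by [u'] drops out, and the
   transport by [e] is moved onto [th] by skew-symmetry *)
have heat : beta * kappa_low * semiH1 Omega d ^+ 2
    <= CT * kappa_lip * semiW1 (T h) q th * semiH1 Omega d ^+ 2
       + CT_hat * semiH1v Omega e * semiH1 Omega d * semiH1 Omega th.
  apply: le_trans (h_aTh h hh _ _ Vt' Vd) _.
  rewrite (heat_difference (Heat' d Vd) (Heat d Vd)
    (aTh_lin hTE th' mka bka (hST h hh) Ld Vd)
    (etrans (esym (cTskew_diag k (T h) u' d)) (cTskew_lin2 hTE u' d Ld))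
    (cTskew_lin1 hTE th d Le)).
  rewrite -cTskewC; apply: lerD; last exact: h_cT.
  have := h_aThL h hh _ _ _ _ Vt' Vt Vt hth_q Vd; rewrite dE distrC.
  move=> /(le_trans (ler_norm _)) /le_trans; apply.
  by rewrite le_eqVlt; apply/orP; left; apply/eqP; ring.
have bp s : Qh Omega k (T h) s -> bform Omega e s = 0.
  move=> Qs; have := bform_linu oO bO hTE (-1) Vu Vu' Qs.
  by rewrite (Div s Qs) (Div' s Qs) mulr0 addr0.
(* momentum equations tested with [e]: the Forchheimer term is monotone, and the
   pressures drop out because [e] is discretely divergence free *)
have mom : alpha * nu_low * semiH1v Omega e ^+ 2
    <= CV * nu_lip * semiW1v (T h) q u * semiH1 Omega d * semiH1v Omega e
       + CN * semiH1v Omega e ^+ 2 * semiH1v Omega u.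
  apply: le_trans (h_ah h hh _ _ Vt' Ve) _.
  apply: le_trans (momentum_difference (Mom' e Ve) (Mom e Ve)
    (ah_lin hTE th' mnu bnu (hSV h hh) Le Ve)
    (etrans (esym (cNskew_diag k (T h) u' e)) (cNskew_lin2 hTE u' e Le))
    (cNskew_lin1 hTE u e Le) (cFh_mono hTE r2 Le) (dh_lin1 hTE e Le)
    (dh_ge0 k (T h) e) (bp p' Qp') (bp p Qp)) _.
  rewrite -cNskewC; apply: lerD; last first.
    by rewrite expr2 mulrA; exact: h_cN.
  have := h_ahL h hh _ _ _ _ Vt' Vt Vu hu_q Ve; rewrite dE distrC.
  move=> /(le_trans (ler_norm _)) /le_trans; apply.
  by rewrite le_eqVlt; apply/orP; left; apply/eqP; ring.
have [e0 d0] : semiH1v Omega e = 0 /\ semiH1 Omega d = 0.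
  apply: (smallness_absorption a0 b0 (ltW hCT_hat) (ltW hCN) _
    (semiH1v_ge0 _ _) (semiH1_ge0 _ _) (semiH1_ge0 _ _) hsmallT heat mom sF tG).
    exact: (mulr_ge0 (mulr_ge0 (ltW hCV) (ltW hn_lip)) (powR_ge0 _ _)).
  move: hsmall; rewrite exprMn; congr (_ < 1); congr (_ + _).
  by congr (_ / _); ring.
have ue i : ae_eq (@mu2 R) Omega (u' i) (u i).
  have := semiH1_eq0 oO (Ve.1 i) (hCP _ (Ve.1 i)) (semiH1v_eq0 e0 i).
  apply: filterS => x xH Ox; apply/eqP; rewrite -subr_eq0; apply/eqP.
  by have := xH Ox; rewrite /e /linv /lin /= mulN1r addrC.
split=> //; last first.
  have := semiH1_eq0 oO Vd.1 (hCP _ Vd.1) d0.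
  apply: filterS => x xH Ox; apply/eqP; rewrite -subr_eq0; apply/eqP.
  by have := xH Ox; rewrite /d /lin /= mulN1r addrC.
have Lu : vec_lin Omega k (T h) 0 u u u'.
  by split=> // i; apply: filterS (ue i) => x xH Ox; rewrite xH// /lin mul0r add0r.
(* with equal velocities and temperatures, all terms of the momentum equations
   but the pressures agree *)
suff : ae_eq (@mu2 R) Omega (lin (-1) p p') (cst 0).
  apply: filterS => x xH Ox; apply/eqP; rewrite -subr_eq0; apply/eqP.
  by have := xH Ox; rewrite /lin /= mulN1r addrC.
have Qd := Qh_lin oO bO (-1) Qp Qp'.
apply: (infsup_eq0 oO hbeta_is Qd (h_infsup h hh _ Qd)) => w Vw.
have c0 (a b c : R) : a = 0 * b + c -> a = c by rewrite mul0r add0r.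
apply: (pressure_difference (Mom' w Vw) (Mom w Vw)).
- rewrite (c0 _ _ _ (ah_lin hTE th' mnu bnu (hSV h hh) Lu Vw)).
  apply/eqP; rewrite -subr_eq0 -normr_le0.
  by have := h_ahL h hh _ _ _ _ Vt' Vt Vu hu_q Vw; rewrite dE d0 mulr0 !mul0r.
- rewrite (c0 _ _ _ (cNskew_lin2 hTE u' w Lu)).
  exact: (c0 _ _ _ (cNskew_lin1 hTE u w Lu)).
- exact: (cFh_congr hTE w r2 Lu).
- exact: (c0 _ _ _ (dh_lin1 hTE w Lu)).
- exact: (bform_linq oO (-1) Vw Qp Qp').
Qed.
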